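(* For every positive integer $p$ there exist: (i) constants $\lambda_p,\tau_p$ with $0<\tau_p<\lambda_p$ and $v_p<\lambda_p<w_p$, for which there is $\Theta_p\in C^2(I)$ with $\Theta_p(0)=\Theta_p(1)=0$ such that $\omega(T_p^{-n}([0,x]))-\Phi_p(x)=(-\lambda_p)^n\Theta_p(x)+O(x(1-x)\tau_p^n)$ for all $x\in I$ and all integers $n\ge0$ (implied constant depending only on $p$); (ii) a function $\Psi_p\in C^2(I)$ with $\Psi_p(0)=\Psi_p(1)=0$, such that the function $\psi_p(x)=\big((p+x)\Psi_p'(x)\big)'$ is positive on $I$; and (iii) a positive bounded linear functional $\mathscr{L}_p:C(I)\to\mathbb{R}$; such that the following holds. For every $f_0\in C^1(I)$ with $\int_I f_0\,d\omega=1$, letting $\nu$ be the measure on $I$ given by $d\nu=f_0\,d\omega$ and $g_0(x)=(p+x)f_0(x)$, for every integer $n\ge0$ and every $x\in I$, $$\Big|\nu\big(T_p^{-n}([0,x])\big)-\Phi_p(x)-(-\lambda_p)^n\mathscr{L}_p(g_0')\Psi_p(x)\Big|\le\tau_p^n\,(\ln(p+1)-\ln p)^2\,\frac{p+1}{2}\,\|\psi_p\|\;\mathrm{osc}\Big(\frac{g_0'}{\psi_p}\Big)\,\Phi_p(x)\,(1-\Phi_p(x)).$$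
   Context: Let $I=[0,1]$ and let $\omega$ be Lebesgue measure on $I$. For a positive integer $p$, the generalized Gauss transformation $T_p:I\to I$ is defined by $T_p(0)=0$ and $T_p(x)=\{p/x\}$ for $x\neq0$, where $\{\cdot\}$ denotes the fractional part. Put $$\Phi_p(x)=\frac{\ln(p+x)-\ln p}{\ln(p+1)-\ln p},\qquad v_p=\frac{p}{2\left(p^2+\frac23p+\frac19\right)},\qquad w_p=\frac{p}{2\left(p^2+\frac23p-\frac29\right)}.$$ $\|\cdot\|$ is the supremum norm on $C(I)$, and $\mathrm{osc}(f)=\sup_I f-\inf_I f$. A linear functional on $C(I)$ is positive if it takes nonnegative functions to nonnegative numbers. The measure $d\nu=f_0\,d\omega$ means $\nu(A)=\int_A f_0\,d\omega$ (a signed measure if $f_0$ takes negative values). *)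

(* Defs.v *)
From HB Require Import structures.
From mathcomp Require Import all_boot all_order all_algebra.
From mathcomp Require Import all_classical all_reals all_analysis.

Set Implicit Arguments.
Unset Strict Implicit.
Unset Printing Implicit Defensive.

Import Order.TTheory GRing.Theory Num.Theory.
Import numFieldNormedType.Exports.

Local Open Scope classical_set_scope.
Local Open Scope ring_scope.

(* Functions on [0, 1] are represented by functions R -> R, of which only the
   values on [0, 1] matter. *)

Definition unitI {R : realType} : set R := `[0, 1].

(** * Function spaces on [0, 1] *)

Section FunctionSpaces.
Context {R : realType}.
Implicit Types f : R -> R.

Definition contI f := {within unitI, continuous f}.

(* The derivative relative to [0, 1]: one-sided at the end points (the filter
   [within unitI x^'] only sees y in [0, 1] with y != x), so that it does not
   depend on the values of f outside [0, 1]. *)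
Definition diff_quotient f (x y : R) : R := (f y - f x) / (y - x).

Definition derivableI f (x : R) : Prop :=
  cvg (diff_quotient f x @ within unitI x^').

Definition derivI f (x : R) : R :=
  lim (diff_quotient f x @ within unitI x^').

Definition C1I f := (forall x, unitI x -> derivableI f x) /\ contI (derivI f).

Definition C2I f := (forall x, unitI x -> derivableI f x) /\ C1I (derivI f).

Definition normI f : R := sup [set `|f x| | x in unitI].

Definition osc f : R := sup (f @` unitI) - inf (f @` unitI).

(* A positive bounded linear functional on C([0, 1]). The first clause makes L
   descend from functions on R to functions on [0, 1]. *)
Definition positive_bounded_linear_functional (L : (R -> R) -> R) : Prop :=
  [/\ (forall f g, contI f -> contI g ->
         (forall x, unitI x -> f x = g x) -> L f = L g),
      (forall (a : R) f g, contI f -> contI g ->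
         L (fun x => a * f x + g x) = a * L f + L g),
      (exists M : R, forall f, contI f -> `|L f| <= M * normI f) &
      (forall f, contI f -> (forall x, unitI x -> 0 <= f x) -> 0 <= L f)].

End FunctionSpaces.

(** * The generalized Gauss transformation *)

Section GaussTransformation.
Context {R : realType}.
Implicit Types (p n : nat) (x : R).

Definition frac_part x : R := x - (Num.floor x)%:~R.

Definition gaussT p x : R := if x == 0 then 0 else frac_part (p%:R / x).

Definition gaussT_preim p n (A : set R) : set R :=
  unitI `&` iter n (gaussT p) @^-1` A.

Definition omega (A : set R) : R := fine (lebesgue_measure A).

Definition nu (f0 : R -> R) (A : set R) : R :=
  \int[lebesgue_measure]_(x in A) f0 x.

Definition log_const p : R := ln (p%:R + 1) - ln p%:R.

Definition Phi p x : R := (ln (p%:R + x) - ln p%:R) / log_const p.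

Definition v_ p : R := p%:R / (2 * (p%:R ^+ 2 + 2 / 3 * p%:R + 1 / 9)).

Definition w_ p : R := p%:R / (2 * (p%:R ^+ 2 + 2 / 3 * p%:R - 2 / 9)).

End GaussTransformation.

(* Main.v *)
Require Import Defs.
From HB Require Import structures.
From mathcomp Require Import all_boot all_order all_algebra.
From mathcomp Require Import all_classical all_reals all_analysis.
From mathcomp Require Import ring lra.
Set Implicit Arguments.
Unset Strict Implicit.
Unset Printing Implicit Defensive.

Import Order.TTheory GRing.Theory Num.Theory.
Import numFieldNormedType.Exports.
Local Open Scope classical_set_scope.
Local Open Scope ring_scope.

(** Put F_n(x) = nu(T_p^{-n}([0,x])). The inverse branches of T_p are x -> p/(p+j+x) for j >= 0, so
    F_{n+1}(x) is the sum over j of F_n(p/(p+j)) - F_n(p/(p+j+x)). In terms of h_n = ((p+x) F_n')'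
    this recursion reads h_{n+1} = - U h_n, where U ([op]) is a positive linear operator on C(I).
    Hence h_n = (-1)^n U^n g_0', while Phi_p is the solution of ((p+x) F')' = 0 with boundary values
    0 and 1.

    Powers of U: there is a positive functional mu with U h >= mu(h) for h >= 0 ([op_ge_doeblin]),
    and each U^n 1 varies by a factor at most 2^10 ([iter_op1_ratio]), since the inverse branches
    contract distortion. A Doeblin argument ([perron_frobenius]) then gives a positive psi with U
    psi = lambda psi, a positive functional L and t in (0,1) such that a psi <= h <= b psi implies
    |U^n h - lambda^n L(h) psi| <= (lambda t)^n (b - a) psi. Taking for a and b the extreme values
    of h/psi produces the oscillation in the error term, with tau = lambda t.

    Size of lambda: for an explicit function phi ([testfun]) the series U phi telescopes to
    3/(3x+3p+1)^2, and v_p phi <= U phi < w_p phi on I, the first inequality being strict off 0.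
    Applying L, for which L(U phi) = lambda L(phi), gives v_p < lambda < w_p ([op_spectrum]).

    Return from h_n to F_n: let Psi solve ((p+x) Psi')' = psi with zero boundary values. The
    difference F_n - Phi_p - (-lambda)^n L(g_0') Psi vanishes at 0 and 1, and comparing it with the
    barrier Phi_p (1 - Phi_p) in a maximum principle ([maximum_principle]) gives the stated bound
    ([error_bound]). The same principle proves h_{n+1} = - U h_n without differentiating an infinite
    series ([push_solves]).

    The estimate for Lebesgue measure is the case f_0 = 1, with Theta = L(g_0') Psi, since Phi_p (1
    - Phi_p) is at most a constant times x(1-x) ([Phi_parabola]). Throughout, functions on I are
    extended to the real line by composition with the retraction [clamp]. *)

(** * Limits with a rate *)

Section Rates.
Context {R : realType}.
Implicit Types (f g r : nat -> R) (l : R).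

Lemma cvg_of_rate f r l :
  (forall n, `|f n - l| <= r n) -> r @ \oo --> 0 -> f @ \oo --> l.
Proof.
move=> fr r0; apply/subr_cvg0/norm_cvg0P.
by apply: squeeze_cvgr (cvg_cst 0) r0; apply: nearW => n; rewrite normr_ge0 fr.
Qed.

Lemma cvg_le f l b : f @ \oo --> l -> (forall n, f n <= b) -> l <= b.
Proof. by move=> fl fb; apply: (cvgr_to_le fl); exact: nearW. Qed.

Lemma cvg_ge f l b : f @ \oo --> l -> (forall n, b <= f n) -> b <= l.
Proof. by move=> fl fb; apply: (cvgr_to_ge fl); exact: nearW. Qed.

Lemma cvg_le_cvg f g l k :
  f @ \oo --> l -> g @ \oo --> k -> (forall n, f n <= g n) -> l <= k.
Proof. by move=> fl gk fg; apply: (ler_cvg_to fl gk); exact: nearW. Qed.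

Lemma cauchy_rate f r :
  (forall n m, (n <= m)%N -> `|f m - f n| <= r n) -> r @ \oo --> 0 ->
  exists2 l, f @ \oo --> l & forall n, `|l - f n| <= r n.
Proof.
move=> fr r0.
have /cvg_ex[l fl] : cvg (f @ \oo).
  apply/cauchy_cvgP; apply: cauchy_exP => e e0.
  have /cvgrPdist_lt /(_ e e0)[N _ rN] := r0.
  exists (f N); exists N => // m Nm /=.
  rewrite -ball_normE /= distrC (le_lt_trans (fr _ _ Nm))//.
  have := rN N (leqnn N); rewrite /= sub0r normrN; apply: le_lt_trans.
  exact: ler_norm.
exists l => // n.
have fln : (fun m => `|f m - f n|) @ \oo --> `|l - f n|.
  by apply: cvg_norm; apply: cvgB => //; exact: cvg_cst.
by apply: (cvgr_to_le fln); exists n => // m; exact: fr.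
Qed.

Lemma cvg0_geometric (K t : R) : 0 <= t < 1 -> (fun n => K * t ^+ n) @ \oo --> 0.
Proof. by case/andP=> t0 t1; apply: cvg_geometric; rewrite ger0_norm. Qed.

Lemma cvg0_div_shift (K P : R) :
  0 < P -> (fun n => K / (P + n%:R)) @ \oo --> 0.
Proof.
move=> P0; suff H : (fun n : nat => (P + n%:R)^-1) @ \oo --> 0.
  by have := cvgM (cvg_cst K) H; rewrite mulr0; exact.
apply/norm_cvg0P; apply/cvgr0Pnorm_lt => e e0.
apply: filterS (nbhs_infty_gtr e^-1) => n en.
have Pn : 0 < P + n%:R by rewrite ltr_wpDr.
by rewrite normr_id ger0_norm ?invr_ge0 ?ltW// invf_plt// ltr_wpDl// ltW.
Qed.

Lemma geometric_cauchy f (K t : R) : 0 <= t < 1 ->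
  (forall n, `|f n.+1 - f n| <= K * t ^+ n) ->
  forall n m, (n <= m)%N -> `|f m - f n| <= K / (1 - t) * t ^+ n.
Proof.
move=> /andP[t0 t1] fK n m.
have s0 : 0 < 1 - t by rewrite subr_gt0.
suff H k : `|f (n + k)%N - f n| <= K / (1 - t) * (t ^+ n - t ^+ (n + k)).
  move=> /subnKC <-; apply: (le_trans (H _)).
  have K0 : 0 <= K by rewrite -[K](mulr1) -(expr0 t); apply: le_trans (fK 0%N).
  by apply: ler_wpM2l; rewrite ?gerBl ?exprn_ge0// divr_ge0// ltW.
elim: k => [|k IH]; first by rewrite addn0 !subrr mulr0 normr0.
rewrite addnS.
have -> : f (n + k).+1 - f n = (f (n + k).+1 - f (n + k)%N) + (f (n + k)%N - f n).
  by rewrite addrA subrK.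
apply: (le_trans (ler_normD _ _)); apply: le_trans (lerD (fK _) IH) _.
rewrite le_eqVlt; apply/orP; left; apply/eqP; rewrite exprS; field.
by rewrite gt_eqF.
Qed.

Lemma continuous_of_rate (f : nat -> R -> R) (F : R -> R) r :
  (forall n, continuous (f n)) -> (forall n x, `|F x - f n x| <= r n) ->
  r @ \oo --> 0 -> continuous F.
Proof.
move=> cf fr r0 x; apply/cvgrPdist_lt => e e0.
have e3 : 0 < e / 3 by rewrite divr_gt0.
have /cvgrPdist_lt /(_ _ e3)[N _ rN] := r0.
have rN3 : r N < e / 3.
  have := rN N (leqnn N); rewrite /= sub0r normrN; apply: le_lt_trans.
  exact: ler_norm.
have /cvgrPdist_lt/(_ _ e3) := cf N x; apply: filterS => y xy.
have -> : F x - F y = (F x - f N x) + (f N x - f N y) - (F y - f N y) by ring.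
apply: (le_lt_trans (ler_normB _ _)).
apply: (le_lt_trans (lerD (ler_normD _ _) (fr N y))).
have := fr N x; lra.
Qed.

End Rates.

(** * Differentiation *)

Section Differentiation.
Context {R : realType}.
Implicit Types (f g : R -> R) (x a b d : R).

Lemma is_derive_cont f x d : is_derive x 1 f d -> {for x, continuous f}.
Proof.
case=> /derivable1_diffP fx _; exact: differentiable_continuous.
Qed.

Lemma is_derive_within f (df : R -> R) a b :
  (forall x, a <= x <= b -> is_derive x 1 f (df x)) ->
  {within `[a, b], continuous f}.
Proof.
move=> fd; apply: derivable_within_continuous => x; rewrite in_itv /= => xab.
by have [] := fd x xab.
Qed.

Lemma itv_segment_le f (df : R -> R) a b : a <= b ->
  (forall x, a < x < b -> is_derive x 1 f (df x)) ->
  {within `[a, b], continuous f} -> (forall x, a < x < b -> 0 <= df x) ->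
  f a <= f b.
Proof.
rewrite le_eqVlt => /predU1P[-> //|ab] fd fc d0.
have D x : x \in `]a, b[ -> is_derive x 1 f (df x) by rewrite in_itv; exact: fd.
have [c] := MVT ab D fc; rewrite in_itv /= => cab E.
rewrite -subr_ge0 E mulr_ge0 ?d0// subr_ge0.
exact: ltW.
Qed.

Lemma is_derive_le f (df : R -> R) a b : a <= b ->
  (forall x, a <= x <= b -> is_derive x 1 f (df x)) ->
  (forall x, a <= x <= b -> 0 <= df x) -> f a <= f b.
Proof.
move=> ab fd d0.
have W x : a < x < b -> a <= x <= b by case/andP=> ? ?; rewrite !ltW.
apply: (itv_segment_le ab (df := df)).
- by move=> x /W; exact: fd.
- exact: is_derive_within fd.
- by move=> x /W; exact: d0.
Qed.

Lemma is_derive_div_shift (c a x : R) : a + x != 0 ->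
  is_derive x 1 (fun t => c / (a + t)) (- c / (a + x) ^+ 2).
Proof.
move=> ax.
have H : is_derive x 1 (fun t => a + t) 1.
  by have := is_deriveD (is_derive_cst a x 1) (is_derive_id x 1); rewrite add0r; exact.
have := is_deriveZ c (@is_deriveV _ (fun t => a + t) x 1 1 ax H).
move=> [D E]; split; first exact: D.
rewrite -[LHS]/('D_1 (c \*: (fun y => (a + y)^-1)) x) E /GRing.scale /=.
by rewrite /GRing.scale /= mulr1; ring.
Qed.

Lemma is_derive_near f g x d : (\near x, f x = g x) ->
  is_derive x 1 f d -> is_derive x 1 g d.
Proof.
move=> fg [D E]; split; first exact: near_eq_derivable D.
by rewrite -E; apply/esym/near_eq_derive.
Qed.

End Differentiation.

(** * Primitives and the retraction onto the unit interval *)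

Section Primitive.
Context {R : realType}.
Implicit Types (h k : R -> R) (x y : R).

(** The base point is -1 rather than 0, so that 0 is an interior point of the domain of integration
    and [prim h] has a two-sided derivative on all of [0, 1]. Only its values up to an additive
    constant matter. *)
Definition prim h x : R := \int[lebesgue_measure]_(t in `[-1, x]) h t.

Lemma is_derive_prim h x : continuous h -> -1 < x -> is_derive x 1 (prim h) (h x).
Proof.
move=> ch x1.
have xx : x < x + 1 by rewrite ltrDl.
have intf : lebesgue_measure.-integrable `[-1, x + 1] (EFin \o h).
  apply: continuous_compact_integrable; first exact: segment_compact.
  exact: continuous_subspaceT.
have [D E] := @continuous_FTC1_closed _ h (-1) x (x + 1) xx intf x1 (ch x).
by split; [exact: D | rewrite -E derive1E].
Qed.

Lemma prim_cst_diff f h x y : continuous h -> -1 < x -> x <= y ->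
  (forall t, x <= t <= y -> is_derive t 1 f (h t)) ->
  f y - f x = prim h y - prim h x.
Proof.
move=> ch x1 xy fh.
have D t : x <= t <= y -> is_derive t 1 (f \- prim h) 0.
  move=> /andP[xt ty].
  have fD : is_derive t 1 f (h t) by apply: fh; rewrite xt.
  have hD := is_derive_prim ch (lt_le_trans x1 xt).
  by have := is_deriveB fD hD; rewrite subrr; exact.
have D' t : t \in `]x, y[ -> is_derive t 1 (f \- prim h) 0.
  by rewrite in_itv /= => /andP[? ?]; apply: D; rewrite !ltW.
have [c _] := MVT_segment xy D' (is_derive_within D).
by rewrite mul0r /= => /eqP; rewrite subr_eq0 => /eqP E; lra.
Qed.

Lemma prim_le h x y : continuous h -> -1 < x -> x <= y ->
  (forall t, x <= t <= y -> 0 <= h t) -> prim h x <= prim h y.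
Proof.
move=> ch x1 xy h0; apply: (@is_derive_le _ _ h) => // t /andP[xt _].
by apply: is_derive_prim => //; exact: lt_le_trans xt.
Qed.

Lemma primB_linear a h k x y : continuous h -> continuous k ->
  -1 < x -> x <= y ->
  prim (fun t => a * h t + k t) y - prim (fun t => a * h t + k t) x =
  a * (prim h y - prim h x) + (prim k y - prim k x).
Proof.
move=> ch ck x1 xy.
have cc : continuous (fun t => a * h t + k t).
  by move=> t; apply: cvgD; [apply: cvgM; [exact: cvg_cst | exact: ch] | exact: ck].
have D t : x <= t <= y ->
    is_derive t 1 (fun t => a * prim h t + prim k t) (a * h t + k t).
  move=> /andP[xt _]; have t1 := lt_le_trans x1 xt.
  exact: (is_deriveD (is_deriveZ a (is_derive_prim ch t1)) (is_derive_prim ck t1)).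
by rewrite -(prim_cst_diff cc x1 xy D); ring.
Qed.

Lemma prim_diff_bound h B x y : continuous h -> -1 < x -> x <= y ->
  (forall t, x <= t <= y -> `|h t| <= B) ->
  `|prim h y - prim h x| <= B * (y - x).
Proof.
move=> ch x1 xy hB.
have D t : x <= t -> is_derive t 1 (prim h) (h t).
  by move=> xt; exact: is_derive_prim (lt_le_trans x1 xt).
have D' t : t \in `]x, y[ -> is_derive t 1 (prim h) (h t).
  by rewrite in_itv /= => /andP[? ?]; apply: D; rewrite ltW.
have W : {within `[x, y], continuous (prim h)}.
  by apply: (@is_derive_within _ _ h) => t /andP[xt _]; exact: D.
have [c xc ->] := MVT_segment xy D' W.
by rewrite normrM (ger0_norm (_ : 0 <= y - x)) ?subr_ge0// ler_wpM2r ?subr_ge0 ?hB.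
Qed.

(** Composition with this retraction turns a function continuous on [0, 1] into one continuous on
    the whole line, to which [prim] and ordinary derivatives apply. *)
Definition clamp x : R := Num.max 0 (Num.min 1 x).

Lemma clamp_in x : 0 <= clamp x <= 1.
Proof. by rewrite /clamp le_max lexx /= ge_max ler01 ge_min lexx. Qed.

Lemma clamp_id x : 0 <= x <= 1 -> clamp x = x.
Proof. by case/andP=> x0 x1; rewrite /clamp min_r// max_r. Qed.

Lemma clampK x : clamp (clamp x) = clamp x.
Proof. exact/clamp_id/clamp_in. Qed.

Lemma continuous_clamp : continuous clamp.
Proof.
move=> x; apply: continuous_max; first exact: cvg_cst.
by apply: continuous_min; [exact: cvg_cst | exact: cvg_id].
Qed.

End Primitive.

(** * A Perron-Frobenius theorem for positive operators *)

Section PerronFrobenius.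
Context {R : realType} {T : Type} (x0 : T) (X : (T -> R) -> Prop)
  (U : (T -> R) -> T -> R) (mu : (T -> R) -> R) (M C : R).
Implicit Types (f g h : T -> R) (a b : R) (n k : nat).
(** [X] is a space of bounded functions, closed under uniform limits with a rate. [U_ge_mu] is the
    Doeblin minorization by the positive functional [mu], and [U1_ratio] bounds the variation of all
    iterates of 1 by the same factor [C]. *)
Context
  (X1 : X (fun=> 1))
  (XL : forall a f g, X f -> X g -> X (fun x => a * f x + g x))
  (Xlim : forall (f : nat -> T -> R) g r, (forall n, X (f n)) ->
     (forall n x, `|g x - f n x| <= r n) -> r @ \oo --> 0 -> X g)
  (Xbnd : forall f, X f -> exists B, forall x, `|f x| <= B)
  (XU : forall f, X f -> X (U f))
  (UL : forall a f g, X f -> X g ->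
     U (fun x => a * f x + g x) = (fun x => a * U f x + U g x))
  (muL : forall a f g, X f -> X g ->
     mu (fun x => a * f x + g x) = a * mu f + mu g)
  (mu1 : 0 < mu (fun=> 1))
  (mu_ge0 : forall f, X f -> (forall x, 0 <= f x) -> 0 <= mu f)
  (U_ge_mu : forall f, X f -> (forall x, 0 <= f x) -> forall x, mu f <= U f x)
  (U1_le : forall x, U (fun=> 1) x <= M)
  (U1_ratio : forall n x y, iter n U (fun=> 1) x <= C * iter n U (fun=> 1) y).

Let XB f g : X f -> X g -> X (fun x => f x - g x).
Proof.
move=> Xf Xg; have := XL (-1) Xg Xf.
by congr X; apply/funext => x; rewrite mulN1r addrC.
Qed.

Let XZ a f : X f -> X (fun x => a * f x).
Proof.
move=> Xf; have := XL a Xf (XB X1 X1).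
by congr X; apply/funext => x; rewrite subrr addr0.
Qed.

Let UB f g x : X f -> X g -> U (fun x => f x - g x) x = U f x - U g x.
Proof.
move=> Xf Xg.
have -> : (fun x => f x - g x) = (fun x => -1 * g x + f x).
  by apply/funext => y; rewrite mulN1r addrC.
by rewrite UL// mulN1r addrC.
Qed.

Let U0 x : U (fun=> 0) x = 0.
Proof.
have -> : (fun=> 0) = (fun y : T => (1 : R) - 1) by apply/funext => y; rewrite subrr.
by rewrite UB// subrr.
Qed.

Let UZ a f x : X f -> U (fun x => a * f x) x = a * U f x.
Proof.
move=> Xf; have X0 := XB X1 X1.
have -> : (fun x => a * f x) = (fun x => a * f x + (1 - 1)).
  by apply/funext => y; rewrite subrr addr0.
rewrite UL//; have -> : (fun=> 1 - 1) = (fun=> 0) :> (T -> R).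
  by apply/funext => y; rewrite subrr.
by rewrite U0 addr0.
Qed.

Let muB f g : X f -> X g -> mu (fun x => f x - g x) = mu f - mu g.
Proof.
move=> Xf Xg.
have -> : (fun x => f x - g x) = (fun x => -1 * g x + f x).
  by apply/funext => y; rewrite mulN1r addrC.
by rewrite muL// mulN1r addrC.
Qed.

Let muZ a f : X f -> mu (fun x => a * f x) = a * mu f.
Proof.
move=> Xf; have X0 := XB X1 X1.
have -> : (fun x => a * f x) = (fun x => a * f x + (1 - 1)).
  by apply/funext => y; rewrite subrr addr0.
by rewrite muL// muB// subrr addr0.
Qed.

Let U_ge0 f x : X f -> (forall x, 0 <= f x) -> 0 <= U f x.
Proof. by move=> Xf f0; exact: le_trans (mu_ge0 Xf f0) (U_ge_mu Xf f0 x). Qed.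

Let U_le f g x : X f -> X g -> (forall x, f x <= g x) -> U f x <= U g x.
Proof.
move=> Xf Xg fg; rewrite -subr_ge0 -UB//; apply: U_ge0; first exact: XB.
by move=> y; rewrite subr_ge0.
Qed.

Let mu_le f g : X f -> X g -> (forall x, f x <= g x) -> mu f <= mu g.
Proof.
move=> Xf Xg fg; rewrite -subr_ge0 -muB//; apply: mu_ge0; first exact: XB.
by move=> y; rewrite subr_ge0.
Qed.

Let M_ge_mu1 : mu (fun=> 1) <= M.
Proof. exact: le_trans (U_ge_mu X1 (fun=> ler01) x0) (U1_le x0). Qed.

Let M0 : 0 < M. Proof. exact: lt_le_trans M_ge_mu1. Qed.

Let C1 : 1 <= C. Proof. by have := U1_ratio 0 x0 x0; rewrite /= mulr1. Qed.

Let C0 : 0 < C. Proof. exact: lt_le_trans C1. Qed.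

Let Xiter n f : X f -> X (iter n U f).
Proof. by move=> Xf; elim: n => //= n; exact: XU. Qed.

(** Chosen so that [dlt * U e <= mu e] for every iterate [e] of 1 ([mu_e_lower]) and for the
    multiples of the eigenfunction. In each step one end of a bracket gains half of this, whence the
    contraction factor [th] below. *)
Let dlt := mu (fun=> 1) / (C ^+ 2 * M).

Let dlt_gt0 : 0 < dlt.
Proof. by rewrite divr_gt0// mulr_gt0// exprn_gt0. Qed.

Let dlt_le1 : dlt <= 1.
Proof.
rewrite ler_pdivrMr ?mulr_gt0 ?exprn_gt0// mul1r (le_trans M_ge_mu1)//.
by rewrite ler_peMl ?(ltW M0)// exprn_ege1.
Qed.

Let th := 1 - dlt / 2.

Let th_in : 0 < th < 1.
Proof. by move: dlt_gt0 dlt_le1; rewrite /th; lra. Qed.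

(* A Doeblin argument: the oscillation of [U^n h / e_n] is contracted by [th]. *)
Let oscillation_step (e h : T -> R) a b : X e -> X h -> (forall x, 0 < e x) ->
  (forall x, dlt * U e x <= mu e) -> a <= b ->
  (forall x, a * e x <= h x <= b * e x) ->
  exists a' b', [/\ a <= a', b' <= b, b' - a' = th * (b - a) &
    forall x, a' * U e x <= U h x <= b' * U e x].
Proof.
move=> Xe Xh e0 de ab abh.
have Xk := XB Xh (XZ a Xe); have Xk' := XB (XZ b Xe) Xh.
have k0 x : 0 <= h x - a * e x by rewrite subr_ge0; case/andP: (abh x).
have k0' x : 0 <= b * e x - h x by rewrite subr_ge0; case/andP: (abh x).
have Uk x : mu (fun x => h x - a * e x) <= U h x - a * U e x.
  by rewrite -UZ// -UB//; [exact: U_ge_mu | exact: XZ].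
have Uk' x : mu (fun x => b * e x - h x) <= b * U e x - U h x.
  by rewrite -UZ// -UB//; [exact: U_ge_mu | exact: XZ].
have E : mu (fun x => h x - a * e x) + mu (fun x => b * e x - h x) = (b - a) * mu e.
  by rewrite !muB ?muZ//; [ring | exact: XZ | exact: XZ].
have m0 := mu_ge0 Xk k0; have m0' := mu_ge0 Xk' k0'.
have ba0 : 0 <= b - a by rewrite subr_ge0.
have s0 : 0 <= (b - a) * (dlt / 2) by rewrite mulr_ge0// divr_ge0// ltW.
have de' x : (b - a) * (dlt / 2) * U e x <= (b - a) * mu e / 2.
  have := ler_wpM2l ba0 (de x); lra.
(* By [E] the [mu]-values of the two nonnegative remainders [h - a e] and [b e - h] add up to
   [(b - a) * mu e], so one of them is at least half of that. The minorization then moves the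
   corresponding end of the bracket inwards by [(b - a) * (dlt / 2)]. *)
have [H|H] := leP ((b - a) * mu e / 2) (mu (fun x => h x - a * e x)).
- exists (a + (b - a) * (dlt / 2)), b; split => //.
  + by rewrite lerDl.
  + by rewrite /th; ring.
  + move=> x; have := Uk x; have := Uk' x; have := de' x; rewrite mulrDl.
    by move: H m0'; lra.
- exists a, (b - (b - a) * (dlt / 2)); split => //.
  + by rewrite gerBl.
  + by rewrite /th; ring.
  + move=> x; have := Uk x; have := Uk' x; have := de' x; rewrite mulrBl.
    by move: H m0 E; lra.
Qed.

(** Nested brackets for [U^n h / e_n] shrink geometrically to the point [l]. This is used twice:
    with the iterates of 1 as [e n], where [l] is the eigenvalue, and with [lam ^+ n * psi], where
    [l] is the value of the eigenfunctional. *)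
Let oscillation_iter (e : nat -> T -> R) h a b :
  (forall n, X (e n)) -> X h -> (forall n x, 0 < e n x) ->
  (forall n, e n.+1 = U (e n)) ->
  (forall n x, dlt * e n.+1 x <= mu (e n)) ->
  (forall x, a * e 0%N x <= h x <= b * e 0%N x) ->
  exists l, a <= l <= b /\ forall n x,
    `|iter n U h x - l * e n x| <= th ^+ n * (b - a) * e n x.
Proof.
move=> Xe Xh e0 eU de abh.
have ab : a <= b.
  have /andP[H1 H2] := abh x0.
  by have := le_trans H1 H2; rewrite ler_pM2r.
pose bracket n (p : R * R) := p.1 <= p.2 /\
  forall x, p.1 * e n x <= iter n U h x <= p.2 * e n x.
have step n (p : R * R) : bracket n p -> exists q : R * R,
    [/\ bracket n.+1 q, p.1 <= q.1, q.2 <= p.2 & q.2 - q.1 = th * (p.2 - p.1)].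
  case=> p12 pn.
  have de' x : dlt * U (e n) x <= mu (e n) by rewrite -eU.
  have [a' [b' [H1 H2 H3 H4]]] :=
    oscillation_step (Xe n) (Xiter n Xh) (e0 n) de' p12 pn.
  exists (a', b'); split => //; split; last by move=> x; rewrite eU.
  rewrite /= -subr_ge0 H3; apply: mulr_ge0; last by rewrite subr_ge0.
  by case/andP: th_in => /ltW.
have bracket0 : bracket 0%N (a, b) by split.
(* Dependent choice of the successive brackets; a pair that is not a bracket is sent to itself as a
   dummy value. *)
have /choice[nxt nxtP] : forall np : nat * (R * R), exists q : R * R,
    bracket np.1 np.2 -> [/\ bracket np.1.+1 q, np.2.1 <= q.1, q.2 <= np.2.2 &
      q.2 - q.1 = th * (np.2.2 - np.2.1)].
  move=> [n p]; have [/step[q Hq]|nb] := pselect (bracket n p); first by exists q.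
  by exists p => /nb.
pose s := fix s n := if n is m.+1 then nxt (m, s m) else (a, b).
have sb n : bracket n (s n).
  by elim: n => //= n IH; have [] := nxtP (n, s n) IH.
have sS n : [/\ (s n).1 <= (s n.+1).1, (s n.+1).2 <= (s n).2 &
    (s n.+1).2 - (s n.+1).1 = th * ((s n).2 - (s n).1)].
  by have [] := nxtP (n, s n) (sb n).
have sD n : (s n).2 - (s n).1 = th ^+ n * (b - a).
  elim: n => [|n IH]; first by rewrite expr0 mul1r.
  by have [_ _ ->] := sS n; rewrite IH exprS mulrA.
have smono n k : (s n).1 <= (s (n + k)%N).1 /\ (s (n + k)%N).2 <= (s n).2.
  elim: k => [|k [IH1 IH2]]; first by rewrite addn0.
  have [H1 H2 _] := sS (n + k)%N; rewrite addnS.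
  by split; [exact: le_trans H1 | exact: le_trans IH2].
have thgeo : (fun n => th ^+ n * (b - a)) @ \oo --> 0.
  have /andP[t0 t1] := th_in.
  have := @cvg0_geometric R (b - a) th; rewrite (ltW t0) t1 => /(_ isT).
  by under eq_fun do rewrite mulrC.
have [l ll lr] : exists2 l, (fun n => (s n).1) @ \oo --> l &
    forall n, `|l - (s n).1| <= th ^+ n * (b - a).
  apply: cauchy_rate thgeo => n m /subnKC <-.
  have [H1 H2] := smono n (m - n)%N; rewrite ger0_norm ?subr_ge0// -sD.
  by have [H3 _] := sb (n + (m - n))%N; lra.
have ln n : (s n).1 <= l <= (s n).2.
  apply/andP; split.
    apply: (cvgr_to_ge ll); exists n => // m /= /subnKC <-.
    by have [] := smono n (m - n)%N.
  apply: (cvgr_to_le ll); exists n => // m /= /subnKC <-.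
  by have [_] := smono n (m - n)%N; apply: le_trans; have [] := sb (n + (m - n))%N.
exists l; split; first exact: (ln 0%N).
move=> n x; have [_ /(_ x)/andP[H1 H2]] := sb n; have /andP[L1 L2] := ln n.
have en := ltW (e0 n x).
have := ler_wpM2r en L1; have := ler_wpM2r en L2.
have := congr1 (fun t => t * e n x) (sD n); rewrite /= mulrBl => <-.
by move=> ? ?; rewrite ler_norml; lra.
Qed.

Let e n := iter n U (fun=> 1).

Let Xe n : X (e n). Proof. exact: Xiter. Qed.

Let mu_e n y : e n y * mu (fun=> 1) <= C * mu (e n).
Proof.
rewrite -!muZ//; apply: mu_le; [exact: XZ|exact: XZ|move=> x].
by rewrite mulr1; exact: U1_ratio.
Qed.

Let e_gt0 n x : 0 < e n x.
Proof.
elim: n x => [|n IH] x; first exact: ltr01.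
apply: lt_le_trans (U_ge_mu (Xe n) (fun y => ltW (IH y)) x).
have := lt_le_trans (mulr_gt0 (IH x) mu1) (mu_e n x).
by rewrite pmulr_rgt0.
Qed.

Let mu_e_lower n x : dlt * e n.+1 x <= mu (e n).
Proof.
have H : e n.+1 x <= C * e n x * M.
  apply: le_trans (_ : U (fun y => (C * e n x) * 1) x <= _).
    apply: U_le; [exact: Xe | exact: XZ | move=> y; rewrite mulr1].
    exact: U1_ratio.
  by rewrite UZ// ler_wpM2l// mulr_ge0 ?ltW.
have D0 : 0 < C ^+ 2 * M by rewrite mulr_gt0 ?exprn_gt0.
rewrite /dlt mulrAC ler_pdivrMr//.
apply: (le_trans (ler_wpM2l (ltW mu1) H)).
have -> : mu (fun=> 1) * (C * e n x * M) = (e n x * mu (fun=> 1)) * (C * M) by ring.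
have -> : mu (e n) * (C ^+ 2 * M) = (C * mu (e n)) * (C * M) by ring.
by rewrite ler_wpM2r// mulr_ge0 ?ltW.
Qed.

(** For [h = U 1] the iterates are [e n.+1], so [oscillation_iter] supplies [lam] with [e n.+1]
    close to [lam * e n] up to a relative error of order [th ^+ n]. Therefore the normalized
    iterates [e n / e n x0] are uniformly Cauchy, and their limit is the eigenfunction. *)
Let perron_eigenvector : exists lam psi,
  [/\ 0 < lam, X psi, (forall x, C^-1 <= psi x <= C) &
      forall x, U psi x = lam * psi x].
Proof.
have U1bnd x : mu (fun=> 1) * e 0%N x <= U (fun=> 1) x <= M * e 0%N x.
  by rewrite !mulr1 U1_le andbT; apply: U_ge_mu.
have [lam [/andP[lam1 lamM] lamP]] :=
  oscillation_iter Xe (XU X1) e_gt0 (fun=> erefl) mu_e_lower U1bnd.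
have lam0 : 0 < lam by exact: lt_le_trans lam1.
have /andP[t0 t1] := th_in.
have t01 : 0 <= th < 1 by rewrite ltW.
have eS n x : `|e n.+1 x - lam * e n x| <= th ^+ n * M * e n x.
  have := lamP n x; rewrite -iterSr => /le_trans; apply.
  apply: ler_wpM2r; first exact: ltW.
  by apply: ler_wpM2l; rewrite ?gerBl ?ltW// exprn_gt0.
pose q n x := e n x / e n x0.
(* The factor [2 * M] comes from two uses of [eS]; the factor [C ^+ 2 / mu 1] bounds
   [e n x / e n.+1 x0]. *)
pose K := 2 * M * C ^+ 2 / mu (fun=> 1).
have qbnd n x : C^-1 <= q n x <= C.
  rewrite ler_pdivrMr ?e_gt0// U1_ratio andbT.
  by rewrite ler_pdivlMr ?e_gt0// mulrC ler_pdivrMr// mulrC U1_ratio.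
have qS n x : `|q n.+1 x - q n x| <= K * th ^+ n.
  have E0 := e_gt0 n x0; have E1 := e_gt0 n.+1 x0.
  have -> : q n.+1 x - q n x = ((e n.+1 x - lam * e n x) * e n x0 -
      e n x * (e n.+1 x0 - lam * e n x0)) / (e n x0 * e n.+1 x0).
    by rewrite /q; field; rewrite !gt_eqF.
  have tM : 0 <= th ^+ n * M by rewrite mulr_ge0 ?exprn_ge0 ?ltW.
  rewrite normrM normfV (gtr0_norm (mulr_gt0 E0 E1)) ler_pdivrMr ?mulr_gt0//.
  apply: (le_trans (ler_normB _ _)); rewrite !normrM (gtr0_norm E0).
  rewrite (gtr0_norm (e_gt0 n x)).
  apply: (le_trans (lerD (ler_wpM2r (ltW E0) (eS n x))
    (ler_wpM2l (ltW (e_gt0 n x)) (eS n x0)))).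
  have -> : th ^+ n * M * e n x * e n x0 + e n x * (th ^+ n * M * e n x0) =
    2 * (th ^+ n * M) * e n x0 * e n x by ring.
  have H : e n x * mu (fun=> 1) <= C ^+ 2 * e n.+1 x0.
    apply: (le_trans (mu_e n x)).
    apply: le_trans (_ : C * e n.+1 x0 <= _).
      apply: ler_wpM2l; first exact: ltW.
      by apply: U_ge_mu => // y; exact: ltW.
    apply: ler_wpM2r; first exact: ltW.
    by rewrite expr2 ler_peMl// ltW.
  have -> : K * th ^+ n * (e n x0 * e n.+1 x0) =
    2 * (th ^+ n * M) * e n x0 * (C ^+ 2 * e n.+1 x0 / mu (fun=> 1)).
    by rewrite /K; field; rewrite gt_eqF.
  by apply: ler_wpM2l; [exact: mulr_ge0 (mulr_ge0 (ler0n _ 2) tM) (ltW E0) | rewrite ler_pdivlMr].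
have /choice[psi psiP] x : exists l, (fun n => q n x) @ \oo --> l /\
    forall n, `|l - q n x| <= K / (1 - th) * th ^+ n.
  have [l l1 l2] := @cauchy_rate R (fun n => q n x) _
    (geometric_cauchy t01 (qS ^~ x)) (@cvg0_geometric R (K / (1 - th)) th t01).
  by exists l.
have Xq n : X (q n).
  have -> : q n = (fun x => (e n x0)^-1 * e n x).
    by apply/funext => y; rewrite /q mulrC.
  exact: XZ.
have Xpsi : X psi.
  apply: (Xlim Xq (r := fun n => K / (1 - th) * th ^+ n)).
    by move=> n x; have [_] := psiP x.
  exact: cvg0_geometric.
exists lam, psi; split => //.
  move=> x; have [H _] := psiP x; apply/andP; split.
    by apply: (cvg_ge H) => n; case/andP: (qbnd n x).
  by apply: (cvg_le H) => n; case/andP: (qbnd n x).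
move=> x; apply/eqP; rewrite -subr_eq0 -normr_le0.
set r := K / (1 - th).
(* Replacing [psi] by [q n] in the eigenvalue equation costs three errors ([A1], [A2], [A3]), each a
   multiple of [th ^+ n]; their coefficients are collected here. *)
have H0 : (fun n => (r * M + M * C + lam * r) * th ^+ n) @ \oo --> 0.
  exact: cvg0_geometric.
apply: (cvg_ge H0) => n.
have UZq : U (q n) x = e n.+1 x / e n x0.
  have -> : q n = (fun x => (e n x0)^-1 * e n x).
    by apply/funext => y; rewrite mulrC.
  by rewrite UZ// mulrC.
have pq y : - (r * th ^+ n) <= psi y - q n y <= r * th ^+ n.
  by rewrite -ler_norml; have [_] := psiP y.
have r0 : 0 <= r * th ^+ n.
  by have [_ /(_ n)] := psiP x; apply: le_trans.
have A1 : `|U psi x - U (q n) x| <= r * th ^+ n * M.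
  rewrite -UB// ler_norml; apply/andP; split.
    apply: le_trans (_ : U (fun=> - (r * th ^+ n) * 1) x <= _).
      by rewrite UZ// mulNr lerN2 ler_wpM2l.
    by apply: U_le => [||y]; [exact: XZ|exact: XB|rewrite mulr1; case/andP: (pq y)].
  apply: le_trans (_ : U (fun=> r * th ^+ n * 1) x <= _).
    by apply: U_le => [||y]; [exact: XB|exact: XZ|rewrite mulr1; case/andP: (pq y)].
  by rewrite UZ// ler_wpM2l.
have A2 : `|U (q n) x - lam * q n x| <= th ^+ n * M * C.
  have -> : U (q n) x - lam * q n x = (e n.+1 x - lam * e n x) / e n x0.
    by rewrite UZq /q; field; rewrite gt_eqF ?e_gt0.
  rewrite normrM normfV (gtr0_norm (e_gt0 n x0)) ler_pdivrMr ?e_gt0//.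
  apply: (le_trans (eS n x)); rewrite -(mulrA _ C).
  apply: ler_wpM2l; last exact: U1_ratio.
  by apply: mulr_ge0; rewrite ?exprn_ge0 ?ltW.
have A3 : `|lam * q n x - lam * psi x| <= lam * (r * th ^+ n).
  rewrite -mulrBr normrM (gtr0_norm lam0) ler_wpM2l ?(ltW lam0)// distrC.
  by have [_] := psiP x.
have -> : U psi x - lam * psi x = (U psi x - U (q n) x) +
  (U (q n) x - lam * q n x) + (lam * q n x - lam * psi x) by ring.
apply: (le_trans (ler_normD _ _)); apply: (le_trans (lerD (ler_normD _ _) A3)).
by move: A1 A2; lra.
Qed.

(** [L f] is the limit of [U^n f / (lam ^+ n * psi)] at [x0]; linearity and [L (U f) = lam * L f]
    are read off this limit. Keeping the bracket [a], [b] arbitrary lets the error be expressed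
    later by the oscillation of [f / psi]. *)
Theorem perron_frobenius : exists (lam t : R) (psi : T -> R) (L : (T -> R) -> R),
  [/\ [/\ 0 < lam, 0 < t < 1, X psi, (forall x, C^-1 <= psi x <= C) &
         forall x, U psi x = lam * psi x],
      (forall a f g, X f -> X g -> L (fun x => a * f x + g x) = a * L f + L g),
      (forall f, X f -> L (U f) = lam * L f) &
      forall f a b, X f -> (forall x, a * psi x <= f x <= b * psi x) ->
        a <= L f <= b /\ forall n x,
        `|iter n U f x - lam ^+ n * L f * psi x| <=
          t ^+ n * (b - a) * (lam ^+ n * psi x)].
Proof.
have [lam [psi [lam0 Xpsi psi_bnd Upsi]]] := perron_eigenvector.
have /andP[t0 t1] := th_in.
have psi0 x : 0 < psi x.
  by case/andP: (psi_bnd x) => H _; apply: lt_le_trans H; rewrite invr_gt0.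
pose E n x := lam ^+ n * psi x.
have XE n : X (E n) by exact: XZ.
have E0 n x : 0 < E n x by rewrite mulr_gt0// exprn_gt0.
have ES n : E n.+1 = U (E n).
  by apply/funext => x; rewrite /E UZ// Upsi exprSr mulrA.
have mupsi : mu (fun=> 1) <= C * mu psi.
  rewrite -muZ//; apply: mu_le => // [|x]; first exact: XZ.
  by case/andP: (psi_bnd x) => H _; rewrite -ler_pdivrMl ?mulr1.
(* The same [dlt] serves for [E n]: since [psi] lies between [C^-1] and [C], one has
   [U psi <= C * M] and [mu psi >= mu 1 / C]. *)
have Ede n x : dlt * E n.+1 x <= mu (E n).
  have -> : dlt * E n.+1 x = lam ^+ n * (dlt * (lam * psi x)).
    by rewrite /E exprSr; ring.
  rewrite muZ//; apply: ler_wpM2l; first by rewrite exprn_ge0// ltW.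
  rewrite -Upsi.
  have H : U psi x <= C * M.
    apply: le_trans (_ : U (fun=> C * 1) x <= _).
      apply: U_le => // [|y]; first exact: XZ.
      by rewrite mulr1; case/andP: (psi_bnd y).
    by rewrite UZ// ler_wpM2l ?(ltW C0).
  apply: (le_trans (ler_wpM2l (ltW dlt_gt0) H)).
  have -> : dlt * (C * M) = mu (fun=> 1) / C.
    by rewrite /dlt; field; rewrite !gt_eqF.
  by rewrite ler_pdivrMr// mulrC.
pose S f n := iter n U f x0 / E n x0.
pose L f := lim (S f @ \oo).
have LP f a b : X f -> (forall x, a * psi x <= f x <= b * psi x) ->
    [/\ S f @ \oo --> L f, a <= L f <= b & forall n x,
      `|iter n U f x - L f * E n x| <= th ^+ n * (b - a) * E n x].
  move=> Xf fab.
  have fab0 x : a * E 0%N x <= f x <= b * E 0%N x by rewrite /E expr0 mul1r.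
  have [l [lab lP]] := oscillation_iter XE Xf E0 ES Ede fab0.
  have Sl : S f @ \oo --> l.
    apply: (@cvg_of_rate _ _ (fun n => (b - a) * th ^+ n)); last first.
      by apply: cvg0_geometric; rewrite ltW.
    move=> n; have := lP n x0.
    have -> : S f n - l = (iter n U f x0 - l * E n x0) / E n x0.
      by rewrite /S; field; rewrite gt_eqF.
    by rewrite normrM normfV (gtr0_norm (E0 n x0)) ler_pdivrMr// (mulrC (b - a)).
  have -> : L f = l by exact: cvg_lim Sl.
  by split.
have LC f : X f -> S f @ \oo --> L f.
  move=> Xf; have [B fB] := Xbnd Xf.
  have B0 : 0 <= B by exact: le_trans (normr_ge0 _) (fB x0).
  have BC x : B <= B * C * psi x.
    rewrite -mulrA ler_peMr//; case/andP: (psi_bnd x) => H _.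
    by rewrite -ler_pdivrMl ?mulr1.
  have fB' x : - (B * C) * psi x <= f x <= B * C * psi x.
    have := fB x; rewrite ler_norml => /andP[H1 H2].
    by rewrite mulNr (le_trans _ H1) ?lerN2//= (le_trans H2).
  by have [] := LP _ _ _ Xf fB'.
have iterL n a u v : X u -> X v -> iter n U (fun x => a * u x + v x) =
    (fun x => a * iter n U u x + iter n U v x).
  move=> Xu Xv; elim: n => [//|n IH].
  by rewrite iterS IH UL//; exact: Xiter.
exists lam, th, psi, L; split.
- by split => //; rewrite t0.
- move=> a f g Xf Xg.
  have H := cvgD (cvgM (cvg_cst a) (LC f Xf)) (LC g Xg).
  apply: (cvg_unique _ (LC _ (XL a Xf Xg))) => //.
  have -> : S (fun x => a * f x + g x) = (fun n => a * S f n + S g n).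
    by apply/funext => n; rewrite /S iterL// mulrDl mulrA.
  exact: H.
- move=> f Xf.
  have H1 : (fun n => S f n.+1) @ \oo --> L f by rewrite (cvg_shiftS (S f)); exact: LC.
  have H := cvgM (cvg_cst lam) H1.
  apply: (cvg_unique _ (LC _ (XU Xf))) => //.
  have -> : S (U f) = (fun n => lam * S f n.+1).
    apply/funext => n; rewrite /S -iterSr /E exprS.
    by field; rewrite !gt_eqF ?exprn_gt0.
  exact: H.
- move=> f a b Xf fab; have [_ ? H] := LP f a b Xf fab; split => // n x.
  by have := H n x; rewrite /E mulrCA mulrA.
Qed.

End PerronFrobenius.

(** * The operator acting on the derivatives of the densities *)

Section Operator.
Context {R : realType} (P : R) (P1 : 1 <= P).
Implicit Types (h k : R -> R) (x y B : R) (j n N : nat).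

Let P0 : 0 < P. Proof. exact: lt_le_trans P1. Qed.

Definition branch j x : R := P / (P + j%:R + x).
Definition acoef j x : R := j%:R / (P + j%:R + x) ^+ 2.
Definition ccoef j x : R :=
  (P + x) * P / ((P + j%:R + x) ^+ 3 * (P + j.+1%:R + x)).

(** Minus the [j]-th term of the derivative of the sum of [weight j * g (branch j x)] with [g' = h],
    after summation by parts (see [flux_derive]): the factor [weight j] has derivative
    [acoef j - acoef j.+1], and [ccoef j] is [weight j] times minus the derivative of [branch j]. *)
Definition opterm h j x : R :=
  acoef j.+1 x * (prim h (branch j x) - prim h (branch j.+1 x)) +
  ccoef j x * h (branch j x).

Definition oppart N h x : R := \sum_(j < N) opterm h j x.

(** The series is evaluated at [clamp x], so that [op h] is again a function on the whole line that
    is determined by its values on [0, 1]. *)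
Definition op h x : R := lim (oppart N h (clamp x) @[N --> \oo]).

Lemma den_ge j x : 0 <= x -> P <= P + j%:R + x.
Proof. by move=> x0; rewrite -addrA lerDl addr_ge0. Qed.

Lemma den_gt0 j x : 0 <= x -> 0 < P + j%:R + x.
Proof. by move=> x0; exact: lt_le_trans (den_ge j x0). Qed.

Lemma den_ge1 j x : 0 <= x -> 1 <= P + j%:R + x.
Proof. by move=> x0; exact: le_trans (den_ge j x0). Qed.

Lemma branch_gt0 j x : 0 <= x -> 0 < branch j x.
Proof. by move=> x0; rewrite divr_gt0// den_gt0. Qed.

Lemma branch_gtN1 j x : 0 <= x -> -1 < branch j x.
Proof. by move=> /(branch_gt0 j); apply: lt_trans; rewrite ltrN10. Qed.

Lemma branch_le1 j x : 0 <= x -> branch j x <= 1.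
Proof. by move=> x0; rewrite ler_pdivrMr ?den_gt0// mul1r den_ge. Qed.

Lemma branchS j x : 0 <= x ->
  branch j x - branch j.+1 x =
  P * ((P + j%:R + x)^-1 - (P + j.+1%:R + x)^-1).
Proof. by move=> x0; rewrite /branch mulrBr. Qed.

Lemma branch_decr j x : 0 <= x -> branch j.+1 x <= branch j x.
Proof.
move=> x0; rewrite /branch ler_wpM2l ?(ltW P0)// lef_pV2 ?posrE ?den_gt0//.
by rewrite lerD2r lerD2l ler_nat.
Qed.

Lemma acoef_ge0 j x : 0 <= acoef j x.
Proof. by rewrite divr_ge0// sqr_ge0. Qed.

Lemma acoef_le1 j x : 0 <= x -> acoef j x <= 1.
Proof.
move=> x0; rewrite ler_pdivrMr ?exprn_gt0 ?den_gt0// mul1r expr2.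
apply: le_trans (_ : P + j%:R + x <= _).
  by rewrite -[leLHS]add0r -addrA lerD ?(ltW P0)// lerDl.
by rewrite ler_peMr ?den_ge1// ltW// den_gt0.
Qed.

Lemma ccoef_ge0 j x : 0 <= x -> 0 <= ccoef j x.
Proof.
move=> x0; apply: divr_ge0; apply: mulr_ge0; rewrite ?(ltW P0) ?ltW//.
- by rewrite ltr_wpDr.
- by rewrite exprn_gt0// den_gt0.
- exact: den_gt0.
Qed.

Lemma ccoef_le j x : 0 <= x ->
  ccoef j x <= (P + j%:R + x)^-1 - (P + j.+1%:R + x)^-1.
Proof.
move=> x0; have D0 := den_gt0 j x0; have D1 := den_gt0 j.+1 x0.
have -> : (P + j%:R + x)^-1 - (P + j.+1%:R + x)^-1 =
  (P + j%:R + x) ^+ 2 / ((P + j%:R + x) ^+ 3 * (P + j.+1%:R + x)).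
  rewrite -natr1; field; rewrite !gt_eqF//.
  by have := D1; rewrite -natr1.
apply: ler_wpM2r; first by rewrite invr_ge0 mulr_ge0 ?exprn_ge0 ?ltW.
rewrite expr2; apply: ler_pM; rewrite ?(ltW P0) ?den_ge ?addr_ge0 ?(ltW P0)//.
by rewrite lerD2r lerDl.
Qed.

(** Both parts are dominated by telescoping quantities: [acoef <= 1] multiplies an integral over an
    interval of length [branch j x - branch j.+1 x], and [ccoef] is itself at most the difference of
    the reciprocals. This yields the tail estimate of order [1 / (P + n)], uniform in [x]. *)
Lemma opterm_bound h B j x : continuous h -> (forall t, `|h t| <= B) ->
  0 <= x ->
  `|opterm h j x| <= B * (P + 1) * ((P + j%:R + x)^-1 - (P + j.+1%:R + x)^-1).
Proof.
move=> ch hB x0; have B0 : 0 <= B := le_trans (normr_ge0 _) (hB 0).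
rewrite /opterm; apply: (le_trans (ler_normD _ _)).
have H1 : `|acoef j.+1 x * (prim h (branch j x) - prim h (branch j.+1 x))| <=
    B * (P * ((P + j%:R + x)^-1 - (P + j.+1%:R + x)^-1)).
  rewrite normrM ger0_norm ?acoef_ge0//.
  apply: (le_trans (ler_wpM2r (normr_ge0 _) (acoef_le1 j.+1 x0))).
  rewrite mul1r -branchS//; apply: prim_diff_bound => //.
    exact: branch_gtN1.
  exact: branch_decr.
have H2 : `|ccoef j x * h (branch j x)| <=
    B * ((P + j%:R + x)^-1 - (P + j.+1%:R + x)^-1).
  rewrite normrM ger0_norm ?ccoef_ge0// mulrC.
  by apply: ler_pM => //; [exact: ccoef_ge0 | exact: ccoef_le].
by apply: (le_trans (lerD H1 H2)); rewrite le_eqVlt; apply/orP; left; apply/eqP; ring.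
Qed.

Lemma oppart_cauchy h B x : continuous h -> (forall t, `|h t| <= B) ->
  0 <= x -> forall n m, (n <= m)%N ->
  `|oppart m h x - oppart n h x| <= B * (P + 1) / (P + n%:R).
Proof.
move=> ch hB x0 n m nm; have B0 : 0 <= B := le_trans (normr_ge0 _) (hB 0).
have BP : 0 <= B * (P + 1) by rewrite mulr_ge0// addr_ge0// ltW.
suff H i : `|oppart (n + i) h x - oppart n h x| <=
    B * (P + 1) * ((P + n%:R + x)^-1 - (P + (n + i)%:R + x)^-1).
  rewrite -(subnKC nm); apply: (le_trans (H _)); apply: ler_wpM2l => //.
  apply: le_trans (_ : (P + n%:R + x)^-1 <= _).
    by rewrite gerBl invr_ge0 ltW// den_gt0.
  rewrite lef_pV2 ?posrE ?den_gt0//; first by rewrite lerDl.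
  by have := den_gt0 n (lexx 0); rewrite addr0.
elim: i => [|i IH]; first by rewrite addn0 !subrr mulr0 normr0.
rewrite addnS /oppart big_ord_recr /= -/(oppart _ _ _) addrAC.
apply: (le_trans (ler_normD _ _)).
apply: (le_trans (lerD IH (opterm_bound (n + i) ch hB x0))).
by rewrite -mulrDr addrA subrK.
Qed.

Lemma op_rate h B x : continuous h -> (forall t, `|h t| <= B) ->
  forall n, `|op h x - oppart n h (clamp x)| <= B * (P + 1) / (P + n%:R).
Proof.
move=> ch hB; have /andP[x0 _] := clamp_in x.
have [l Hl Hn] := cauchy_rate (oppart_cauchy ch hB x0) (cvg0_div_shift _ P0).
by move=> n; rewrite /op (cvg_lim _ Hl).
Qed.

Lemma op_cvg h B x : continuous h -> (forall t, `|h t| <= B) ->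
  (fun n => oppart n h (clamp x)) @ \oo --> op h x.
Proof.
move=> ch hB; apply: (cvg_of_rate _ (cvg0_div_shift (B * (P + 1)) P0)) => n.
by rewrite distrC; exact: op_rate.
Qed.

(** The space on which [op] acts; it contains [f \o clamp] for every [f] continuous on [0, 1]. *)
Definition bcont h := continuous h /\ exists B, forall x, `|h x| <= B.

Lemma bcont_cvg h x : bcont h ->
  (fun n => oppart n h (clamp x)) @ \oo --> op h x.
Proof. by case=> ch [B hB]; exact: op_cvg hB. Qed.

Lemma continuous_clamp_comp (f : R -> R) :
  (forall x, 0 <= x -> {for x, continuous f}) -> continuous (f \o clamp).
Proof.
move=> cf x; apply: continuous_comp; first exact: continuous_clamp.
by apply: cf; case/andP: (clamp_in x).
Qed.

Lemma continuous_branch j x : 0 <= x -> {for x, continuous (branch j)}.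
Proof.
move=> x0; have D : P + j%:R + x != 0 by rewrite gt_eqF// den_gt0.
exact: (is_derive_cont (is_derive_div_shift P D)).
Qed.

Lemma continuous_oppart h n : continuous h -> continuous (oppart n h \o clamp).
Proof.
move=> ch; apply: continuous_clamp_comp => x x0.
have cb i : {for x, continuous (branch i)} by exact: continuous_branch.
have cp i : {for x, continuous (prim h \o branch i)}.
  apply: continuous_comp; first exact: cb.
  exact: (is_derive_cont (is_derive_prim ch (branch_gtN1 i x0))).
have chb i : {for x, continuous (h \o branch i)}.
  by apply: continuous_comp; [exact: cb | exact: ch].
have cid : {for x, continuous (@id R)} by exact: cvg_id.
have cden i : {for x, continuous (fun t => P + i%:R + t)}.
  by apply: cvgD; [exact: cvg_cst | exact: cvg_id].
have cX (f : R -> R) i : {for x, continuous f} ->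
    {for x, continuous (fun t => f t ^+ i)}.
  move=> cf; apply: (@continuous_comp _ _ _ f (fun u => u ^+ i)) => //.
  exact: exprn_continuous.
have ca i : {for x, continuous (acoef i)}.
  apply: cvgM; first exact: cvg_cst.
  apply: cvgV; first by rewrite expf_neq0// gt_eqF// den_gt0.
  exact: (cX (fun t => P + i%:R + t)).
have cc i : {for x, continuous (ccoef i)}.
  apply: cvgM.
    apply: cvgM; last exact: cvg_cst.
    by apply: cvgD; [exact: cvg_cst | exact: cvg_id].
  apply: cvgV; first by rewrite mulf_neq0 ?expf_neq0// gt_eqF// den_gt0.
  by apply: cvgM; [exact: (cX (fun t => P + i%:R + t)) | exact: cden].
elim: n => [|n IH].
  have -> : oppart 0 h = (fun=> 0) by apply/funext => t; rewrite /oppart big_ord0.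
  exact: cvg_cst.
have -> : oppart n.+1 h = (fun t => oppart n h t + opterm h n t).
  by apply/funext => t; rewrite /oppart big_ord_recr.
apply: cvgD; first exact: IH.
apply: cvgD; apply: cvgM.
- exact: ca.
- by apply: cvgB; exact: cp.
- exact: cc.
- exact: chb.
Qed.

Lemma op_bcont h : bcont h -> bcont (op h).
Proof.
case=> ch [B hB]; split.
  apply: (@continuous_of_rate _ (fun n => oppart n h \o clamp) _
    (fun n => B * (P + 1) / (P + n%:R))).
  - by move=> n; exact: continuous_oppart.
  - by move=> n x; exact: op_rate.
  - exact: cvg0_div_shift.
exists (B * (P + 1) / P) => x; have := op_rate x ch hB 0%N.
by rewrite /oppart big_ord0 subr0 addr0.
Qed.

Lemma bcont1 : bcont (fun=> 1).
Proof. by split; [move=> x; exact: cvg_cst | exists 1 => x; rewrite normr1]. Qed.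

Lemma bcontL a h k : bcont h -> bcont k -> bcont (fun x => a * h x + k x).
Proof.
case=> ch [B hB] [ck [D kD]]; split.
  move=> x; apply: cvgD; last exact: ck.
  by apply: cvgM; [exact: cvg_cst | exact: ch].
exists (`|a| * B + D) => x; apply: (le_trans (ler_normD _ _)).
by rewrite lerD// normrM ler_wpM2l.
Qed.

Lemma bcont_lim (f : nat -> R -> R) g r : (forall n, bcont (f n)) ->
  (forall n x, `|g x - f n x| <= r n) -> r @ \oo --> 0 -> bcont g.
Proof.
move=> fb gf r0; split.
  by apply: (continuous_of_rate (f := f)) gf r0 => n; case: (fb n).
have [_ [B fB]] := fb 0%N; exists (r 0%N + B) => x.
rewrite -[g x](subrK (f 0%N x)); apply: (le_trans (ler_normD _ _)).
by rewrite lerD.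
Qed.

Lemma opL a h k : bcont h -> bcont k ->
  op (fun x => a * h x + k x) = (fun x => a * op h x + op k x).
Proof.
move=> bh bk; apply/funext => x.
have /andP[x0 _] := clamp_in x.
have H := cvgD (cvgM (cvg_cst a) (bcont_cvg (x := x) bh)) (bcont_cvg (x := x) bk).
apply: (cvg_unique _ (bcont_cvg (x := x) (bcontL a bh bk))) => //.
have -> : (fun n => oppart n (fun x => a * h x + k x) (clamp x)) =
  (fun n => a * oppart n h (clamp x) + oppart n k (clamp x)).
  apply/funext => n; rewrite /oppart big_distrr /= -big_split /=.
  apply: eq_bigr => j _; rewrite /opterm.
  have E := primB_linear a (proj1 bh) (proj1 bk) (branch_gtN1 j.+1 x0)
    (branch_decr j x0).
  by rewrite E; ring.
exact: H.
Qed.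

Lemma opterm_ge0 h j x : continuous h -> (forall t, 0 <= h t) -> 0 <= x ->
  0 <= opterm h j x.
Proof.
move=> ch h0 x0; rewrite addr_ge0// mulr_ge0 ?acoef_ge0 ?ccoef_ge0//.
by rewrite subr_ge0 prim_le// ?branch_gtN1// branch_decr.
Qed.

(** For every [x] in [0, 1] the interval from [branch 2 x] to [branch 0 x], over which the first two
    terms of the series integrate, contains the interval from [P / (P + 2)] to [P / (P + 1)]; there
    the weights [acoef 1] and [acoef 2] are at least [(P + 3) ^- 2]. *)
Definition doeblin h : R := (P + 3) ^- 2 * (prim h (P / (P + 1)) - prim h (P / (P + 2))).

Let Pd_gtN1 (a : R) : 0 <= a -> -1 < P / (P + a).
Proof.
move=> a0; apply: (@lt_trans _ _ 0); first by rewrite ltrN10.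
by rewrite divr_gt0// ltr_wpDr.
Qed.

Let Pd_lt : P / (P + 2) < P / (P + 1).
Proof.
rewrite ltr_pM2l// ltf_pV2 ?posrE ?addr_gt0//.
by rewrite ltrD2l ltr1n.
Qed.

Lemma doeblinL a h k : bcont h -> bcont k ->
  doeblin (fun x => a * h x + k x) = a * doeblin h + doeblin k.
Proof.
move=> [ch _] [ck _]; rewrite /doeblin primB_linear ?Pd_gtN1 ?(ltW Pd_lt)//.
by ring.
Qed.

Lemma doeblin_ge0 h : bcont h -> (forall x, 0 <= h x) -> 0 <= doeblin h.
Proof.
move=> [ch _] h0; rewrite mulr_ge0 ?invr_ge0 ?sqr_ge0// subr_ge0.
by rewrite prim_le ?Pd_gtN1 ?(ltW Pd_lt).
Qed.

Lemma doeblin_gt0 h : bcont h -> (forall x, 0 <= h x) ->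
  (forall x, P / (P + 2) <= x <= P / (P + 1) -> 0 < h x) -> 0 < doeblin h.
Proof.
move=> [ch _] h0 h1; apply: mulr_gt0.
  by rewrite invr_gt0 exprn_gt0// addr_gt0.
rewrite subr_gt0.
have D x : P / (P + 2) <= x -> is_derive x 1 (prim h) (h x).
  move=> xP; apply: (is_derive_prim ch); apply: lt_le_trans xP.
  exact: Pd_gtN1.
have D' x : x \in `]P / (P + 2), P / (P + 1)[ -> is_derive x 1 (prim h) (h x).
  by rewrite in_itv /= => /andP[? _]; apply: D; exact: ltW.
have W : {within `[P / (P + 2), P / (P + 1)], continuous (prim h)}.
  by apply: (@is_derive_within _ _ h) => t /andP[xt _]; exact: D.
have [c] := MVT Pd_lt D' W; rewrite in_itv /= => /andP[c1 c2] E.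
by rewrite -subr_gt0 E mulr_gt0 ?subr_gt0// h1// !ltW.
Qed.

Lemma op_ge_doeblin h : bcont h -> (forall x, 0 <= h x) ->
  forall x, doeblin h <= op h x.
Proof.
move=> bh h0 x; have [ch _] := bh; have /andP[x0 x1] := clamp_in x.
have H2 : doeblin h <= oppart 2 h (clamp x).
  set y := clamp x in x0 x1 *.
  have Py : 0 < P + y by rewrite ltr_wpDr.
  have Pa (a : R) : 0 <= a -> 0 < P + a by move=> a0; rewrite ltr_wpDr.
  have b0 : P / (P + 1) <= branch 0 y.
    by rewrite /branch addr0 ler_pM2l// lef_pV2 ?posrE ?Pa// lerD2l.
  have b2 : branch 2 y <= P / (P + 2).
    by rewrite /branch ler_pM2l// lef_pV2 ?posrE ?den_gt0 ?Pa// lerDl.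
  have p0 : prim h (P / (P + 1)) <= prim h (branch 0 y) by rewrite prim_le// Pd_gtN1.
  have p2 : prim h (branch 2 y) <= prim h (P / (P + 2)).
    by rewrite prim_le// branch_gtN1.
  have ale (i : nat) : (0 < i <= 2)%N -> (P + 3) ^- 2 <= acoef i y.
    case/andP=> i1 i2; rewrite /acoef -[leLHS]mul1r ler_pM ?invr_ge0 ?sqr_ge0//.
      by rewrite ler1n.
    rewrite lef_pV2 ?posrE ?exprn_gt0 ?den_gt0 ?addr_gt0//.
    rewrite lerXn2r ?nnegrE ?(ltW (den_gt0 _ _))// ?addr_ge0 ?(ltW P0)//.
    rewrite -addrA lerD2l; have : i%:R <= 2 :> R by rewrite ler_nat.
    by move: x1; lra.
  have c0 : 0 <= ccoef 0 y * h (branch 0 y) by rewrite mulr_ge0// ccoef_ge0.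
  have c1 : 0 <= ccoef 1 y * h (branch 1 y) by rewrite mulr_ge0// ccoef_ge0.
  have d0 : 0 <= prim h (branch 0 y) - prim h (branch 1 y).
    by rewrite subr_ge0 prim_le ?branch_gtN1// branch_decr.
  have d1 : 0 <= prim h (branch 1 y) - prim h (branch 2 y).
    by rewrite subr_ge0 prim_le ?branch_gtN1// branch_decr.
  have a1 := ler_wpM2r d0 (ale 1%N isT).
  have a2 := ler_wpM2r d1 (ale 2%N isT).
  have e0 : 0 <= (P + 3) ^- 2 by rewrite invr_ge0 sqr_ge0.
  have := ler_wpM2l e0 (lerB p0 p2).
  rewrite /doeblin /oppart !big_ord_recr big_ord0 /= add0r /opterm.
  by move: a1 a2 c0 c1; lra.
apply: le_trans H2 _; apply: (cvgr_to_ge (bcont_cvg (x := x) bh)); exists 2%N => // n /=.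
move=> /subnKC <-; elim: (n - 2)%N => [|i IH]; first by rewrite addn0.
apply: (le_trans IH); rewrite addnS /oppart [leRHS]big_ord_recr /=.
by rewrite lerDl opterm_ge0.
Qed.

Lemma op1_le x : op (fun=> 1) x <= (P + 1) / P.
Proof.
have H (t : R) : `|1 : R| <= 1 by rewrite normr1.
have := @op_rate (fun=> 1) 1 x (proj1 bcont1) H 0%N.
rewrite /oppart big_ord0 subr0 addr0 mul1r; apply: le_trans; exact: ler_norm.
Qed.

Lemma op_clamp h x : op h (clamp x) = op h x.
Proof. by rewrite /op clampK. Qed.

End Operator.

(** * Bounded distortion *)

(* The cone of the nonnegative functions with distortion at most
   [((1 + y) / (1 + x)) ^+ 10] is invariant under the operator, because the
   branches satisfy [((1 + s) / (1 + t)) ^+ 2 <= (1 + y) / (1 + x)]; the weights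
   contribute at most [5] to the exponent. *)
Section Distortion.
Context {R : realType}.

Definition comparable_upto (k : nat) (r u v : R) :=
  u <= r ^+ k * v /\ v <= r ^+ k * u.

Lemma comparable_upto_refl r u : comparable_upto 0 r u u.
Proof. by rewrite /comparable_upto expr0 mul1r. Qed.

Lemma comparable_uptoM i j r u v u' v' : 0 <= u -> 0 <= v -> 0 <= u' -> 0 <= v' ->
  comparable_upto i r u v -> comparable_upto j r u' v' ->
  comparable_upto (i + j) r (u * u') (v * v').
Proof.
move=> u0 v0 u0' v0' [H1 H2] [H3 H4]; rewrite /comparable_upto exprD.
by split; [have := ler_pM u0 u0' H1 H3 | have := ler_pM v0 v0' H2 H4];
  rewrite mulrACA.
Qed.

Lemma comparable_uptoD i r u v u' v' :
  comparable_upto i r u v -> comparable_upto i r u' v' ->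
  comparable_upto i r (u + u') (v + v').
Proof. by move=> [H1 H2] [H3 H4]; split; rewrite mulrDr lerD. Qed.

Lemma comparable_uptoW i j r u v : 1 <= r -> 0 <= u -> 0 <= v -> (i <= j)%N ->
  comparable_upto i r u v -> comparable_upto j r u v.
Proof.
move=> r1 u0 v0 ij [H1 H2]; have rij : r ^+ i <= r ^+ j by rewrite ler_weXn2l.
by split; [apply: le_trans H1 _ | apply: le_trans H2 _]; rewrite ler_wpM2r.
Qed.

Lemma comparable_uptoX i k r u v : 0 <= u -> 0 <= v ->
  comparable_upto k r u v -> comparable_upto (k * i) r (u ^+ i) (v ^+ i).
Proof.
move=> u0 v0 uv; elim: i => [|i IH].
  by rewrite muln0 !expr0; exact: comparable_upto_refl.
by rewrite mulnS !exprS; apply: comparable_uptoM => //; rewrite exprn_ge0.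
Qed.

Lemma comparable_uptoV k r u v : 0 < u -> 0 < v ->
  comparable_upto k r u v -> comparable_upto k r u^-1 v^-1.
Proof.
move=> u0 v0 [H1 H2]; split; rewrite ler_pdivlMr// mulrC ler_pdivrMr//.
Qed.

Context (P : R) (P1 : 1 <= P).

Definition low_distortion (h : R -> R) := forall x y, 0 <= x -> x <= y -> y <= 1 ->
  comparable_upto 10 ((1 + y) / (1 + x)) (h x) (h y).

Let P0 : 0 < P. Proof. exact: lt_le_trans P1. Qed.

Context (x y : R) (x0 : 0 <= x) (xy : x <= y) (y1 : y <= 1).

Let r := (1 + y) / (1 + x).

Let y0 : 0 <= y. Proof. exact: le_trans xy. Qed.

Let x10 : 0 < 1 + x. Proof. by rewrite ltr_wpDr. Qed.

Let r1 : 1 <= r. Proof. by rewrite ler_pdivlMr// mul1r lerD2l. Qed.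

Lemma comparable_shift (u : R) : 1 <= u -> comparable_upto 1 r (u + x) (u + y).
Proof.
move=> u1; have ux : 0 < u + x by rewrite ltr_wpDr// (lt_le_trans _ u1).
rewrite /comparable_upto expr1; split.
  apply: le_trans (_ : u + y <= _); first by rewrite lerD2l.
  by rewrite ler_peMl// (le_trans (ltW ux))// lerD2l.
rewrite /r mulrAC ler_pdivlMr//.
have : 0 <= (u - 1) * (y - x) by rewrite mulr_ge0 ?subr_ge0.
lra.
Qed.

(** With [A = u + x], [B = u + y] and [M = (B + P) * A], clearing denominators leaves [y - x] times
    [M * (M - 2 * P * (1 + x)) - P ^+ 2 * (1 + x) * (y - x)]. This is nonnegative because
    [M >= 2 * P * (1 + x) + (P + x) * (y - x)], hence also [M >= P * (1 + x)]. *)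
Lemma branch_contraction (u : R) : P <= u ->
  (1 + P / (u + x)) ^+ 2 <= r * (1 + P / (u + y)) ^+ 2.
Proof.
move=> Pu; have u0 : 0 < u := lt_le_trans P0 Pu.
have ux : 0 < u + x by rewrite ltr_wpDr.
have uy : 0 < u + y by rewrite ltr_wpDr.
have -> : 1 + P / (u + x) = (u + x + P) / (u + x) by field; rewrite gt_eqF.
have -> : 1 + P / (u + y) = (u + y + P) / (u + y) by field; rewrite gt_eqF.
rewrite !expr_div_n /r.
rewrite ler_pdivrMr ?exprn_gt0//.
have -> : (1 + y) / (1 + x) * ((u + y + P) ^+ 2 / (u + y) ^+ 2) * (u + x) ^+ 2 =
  ((1 + y) * (u + y + P) ^+ 2 * (u + x) ^+ 2) / ((1 + x) * (u + y) ^+ 2).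
  by field; rewrite !gt_eqF.
rewrite ler_pdivlMr ?mulr_gt0 ?exprn_gt0//.
set A := u + x in ux *; set B := u + y in uy *.
have PA : P + x <= A by rewrite lerD2r.
have PB : P + y <= B by rewrite lerD2r.
have d0 : 0 <= y - x by rewrite subr_ge0.
pose M := (B + P) * A.
have Px : 1 + x <= P + x by rewrite lerD2r.
have M_ge : 2 * P * (1 + x) + (P + x) * (y - x) <= M.
  apply: le_trans (_ : (P + y + P) * (P + x) <= _); last first.
    apply: ler_pM => //; rewrite ?lerD2r// !addr_ge0// ?ltW//.
  rewrite -subr_ge0.
  have -> : (P + y + P) * (P + x) - (2 * P * (1 + x) + (P + x) * (y - x)) =
    2 * P * (P - 1) + (P + x) * x by ring.
  by rewrite addr_ge0// !mulr_ge0 ?subr_ge0 ?addr_ge0// ltW.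
have M0 : 0 <= M by rewrite mulr_ge0 ?addr_ge0// ltW.
have M_ge' : P * (1 + x) <= M.
  apply: le_trans M_ge.
  have : 0 <= (P + x) * (y - x) by rewrite mulr_ge0// addr_ge0// ltW.
  have : 0 <= P * (1 + x) by rewrite mulr_ge0// ltW.
  by lra.
have H1 : M * ((P + x) * (y - x)) <= M * (M - 2 * P * (1 + x)).
  by rewrite ler_wpM2l// lerBrDl.
have H2 : P * (1 + x) * (P * (y - x)) <= M * ((P + x) * (y - x)).
  apply: ler_pM => //; rewrite ?mulr_ge0 ?(ltW P0) ?(ltW x10)//.
  by rewrite ler_wpM2r// lerDl.
have -> : (A + P) ^+ 2 * ((1 + x) * B ^+ 2) =
  (1 + x) * (M + P * (y - x)) ^+ 2 by rewrite /M /A /B; ring.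
have -> : (1 + y) * (B + P) ^+ 2 * A ^+ 2 = (1 + x) * M ^+ 2 + (y - x) * M ^+ 2.
  by rewrite /M; ring.
rewrite -subr_ge0.
have -> : (1 + x) * M ^+ 2 + (y - x) * M ^+ 2 - (1 + x) * (M + P * (y - x)) ^+ 2 =
  (y - x) * (M * (M - 2 * P * (1 + x)) - P * (1 + x) * (P * (y - x))) by ring.
by rewrite mulr_ge0// subr_ge0 (le_trans H2).
Qed.

(** The square in [branch_contraction] halves the exponent 10 of the distortion, which leaves room
    for the weights. *)
Lemma low_distortion_branch (h : R -> R) u : low_distortion h -> (forall t, 0 <= h t) ->
  P <= u -> comparable_upto 5 r (h (P / (u + x))) (h (P / (u + y))).
Proof.
move=> hd h0 Pu; have u0 : 0 < u := lt_le_trans P0 Pu.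
have ux : 0 < u + x by rewrite ltr_wpDr.
have uy : 0 < u + y by rewrite ltr_wpDr.
have t0 : 0 <= P / (u + y) by rewrite divr_ge0// ltW.
have ts : P / (u + y) <= P / (u + x).
  by rewrite ler_pM2l// lef_pV2 ?posrE// lerD2l.
have s1 : P / (u + x) <= 1.
  by rewrite ler_pdivrMr// mul1r (le_trans Pu)// lerDl.
have := branch_contraction Pu; have := hd _ _ t0 ts s1.
set s := P / (u + x) in ts s1 *; set t := P / (u + y) in t0 ts *.
move=> [H1 H2] st; have t1 : 0 < 1 + t by rewrite ltr_wpDr.
have E : ((1 + s) / (1 + t)) ^+ 10 <= r ^+ 5.
  rewrite (exprM _ 2 5); apply: lerXn2r; rewrite ?nnegrE ?sqr_ge0//.
    exact: le_trans r1.
  by rewrite expr_div_n ler_pdivrMr// exprn_gt0.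
by split; [apply: le_trans H2 _ | apply: le_trans H1 _]; rewrite ler_wpM2r.
Qed.

(** Under the substitution [s = P / (u + p)] both differences become integrals over the same
    interval of [u], so the integrands can be compared pointwise. The comparison is carried out as
    monotonicity in [u] of a combination of primitives. *)
Lemma prim_branch_le (h : R -> R) (p q u0 u1 K : R) : continuous h ->
  0 <= p -> 0 <= q -> P <= u0 -> u0 <= u1 ->
  (forall u, P <= u -> h (P / (u + p)) * (u + p) ^- 2 <=
      K * (h (P / (u + q)) * (u + q) ^- 2)) ->
  prim h (P / (u0 + p)) - prim h (P / (u1 + p)) <=
  K * (prim h (P / (u0 + q)) - prim h (P / (u1 + q))).
Proof.
move=> ch p0 q0 Pu u01 hK.
have D (v u : R) : 0 <= v -> P <= u ->
    is_derive u 1 (fun u => prim h (P / (v + u)))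
      (h (P / (v + u)) * (- P / (v + u) ^+ 2)).
  move=> v0 Pu'; have vu : 0 < v + u by rewrite ltr_wpDl// (lt_le_trans P0).
  have D1 := is_derive_div_shift P (lt0r_neq0 vu).
  have s1 : -1 < P / (v + u).
    by apply: (@lt_trans _ _ 0); rewrite ?ltrN10// divr_gt0.
  exact: (@is_derive1_comp _ (prim h) _ u _ _ (is_derive_prim ch s1) D1).
have D' u : u0 <= u <= u1 ->
    is_derive u 1 (fun u => prim h (P / (p + u)) - K * prim h (P / (q + u)))
    (h (P / (p + u)) * (- P / (p + u) ^+ 2) -
     K * (h (P / (q + u)) * (- P / (q + u) ^+ 2))).
  move=> /andP[uu _]; have Pu' := le_trans Pu uu.
  exact: (is_deriveB (D p u p0 Pu') (is_deriveZ K (D q u q0 Pu'))).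
have D0 u : u0 <= u <= u1 -> 0 <= h (P / (p + u)) * (- P / (p + u) ^+ 2) -
     K * (h (P / (q + u)) * (- P / (q + u) ^+ 2)).
  move=> /andP[uu _]; have := ler_wpM2l (ltW P0) (hK u (le_trans Pu uu)).
  by rewrite ![u + _]addrC; lra.
have := is_derive_le u01 D' D0; rewrite ![u0 + _]addrC ![u1 + _]addrC.
by lra.
Qed.

Let z_gt0 j t : 0 <= t -> 0 < P + j%:R + t.
Proof. exact: den_gt0. Qed.

Let z_ge1 j : 1 <= P + j%:R.
Proof. by rewrite (le_trans P1)// lerDl. Qed.

(** Count of exponents: the integral term has 2 from [acoef] and 5 + 2 from the integrand and the
    Jacobian, in all 9; the pointwise term has 1 + 4 from [ccoef] and 5 from [h]. The exponent 10 is
    the fixed point of [k -> 5 + k / 2]. *)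
Lemma opterm_comparable (h : R -> R) j : continuous h -> low_distortion h ->
  (forall t, 0 <= h t) -> comparable_upto 10 r (opterm P h j x) (opterm P h j y).
Proof.
move=> ch hd h0.
have z0 i : 0 <= P + i%:R + x by rewrite ltW// z_gt0.
have z0' i : 0 <= P + i%:R + y by rewrite ltW// z_gt0.
have zc i : comparable_upto 1 r (P + i%:R + x) (P + i%:R + y).
  exact: comparable_shift.
have zV i : comparable_upto 1 r (P + i%:R + x)^-1 (P + i%:R + y)^-1.
  by apply: comparable_uptoV => //; exact: z_gt0.
have ac : comparable_upto 2 r (acoef P j.+1 x) (acoef P j.+1 y).
  rewrite /acoef -!exprVn; apply: (@comparable_uptoM 0 2) => //.
  - by rewrite exprn_ge0// invr_ge0.
  - by rewrite exprn_ge0// invr_ge0.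
  - exact: comparable_upto_refl.
  - by apply: (@comparable_uptoX 2 1); rewrite ?invr_ge0.
have pc : comparable_upto 7 r (prim h (branch P j x) - prim h (branch P j.+1 x))
    (prim h (branch P j y) - prim h (branch P j.+1 y)).
  have H u : P <= u -> comparable_upto 7 r (h (P / (u + x)) * (u + x) ^- 2)
      (h (P / (u + y)) * (u + y) ^- 2).
    move=> Pu; have ux : 0 < u + x by rewrite ltr_wpDr// (lt_le_trans P0).
    have uy : 0 < u + y by rewrite ltr_wpDr// (lt_le_trans P0).
    have Vx : 0 <= (u + x)^-1 by rewrite invr_ge0 ltW.
    have Vy : 0 <= (u + y)^-1 by rewrite invr_ge0 ltW.
    rewrite -!exprVn; apply: (@comparable_uptoM 5 2); rewrite ?exprn_ge0//.
      exact: low_distortion_branch.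
    apply: (@comparable_uptoX 2 1) => //; apply: comparable_uptoV => //.
    by apply: comparable_shift; exact: le_trans Pu.
  have Pj : P <= P + j%:R by rewrite lerDl.
  have jj : P + j%:R <= P + j.+1%:R by rewrite lerD2l ler_nat.
  by split; apply: prim_branch_le => // u /H[].
have cc : comparable_upto 5 r (ccoef P j x) (ccoef P j y).
  apply: (@comparable_uptoM 1 4).
  - by rewrite mulr_ge0 ?addr_ge0// ltW.
  - by rewrite mulr_ge0 ?addr_ge0// ltW.
  - by rewrite invr_ge0 mulr_ge0// exprn_ge0.
  - by rewrite invr_ge0 mulr_ge0// exprn_ge0.
  - apply: (@comparable_uptoM 1 0); rewrite ?addr_ge0// ?(ltW P0)//.
      by have := zc 0%N; rewrite !addr0.
    exact: comparable_upto_refl.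
  - apply: comparable_uptoV.
    + by rewrite mulr_gt0 ?exprn_gt0// z_gt0.
    + by rewrite mulr_gt0 ?exprn_gt0// z_gt0.
    apply: (@comparable_uptoM 3 1); rewrite ?exprn_ge0//.
    exact: (@comparable_uptoX 3 1).
have p0 t : 0 <= t -> 0 <= prim h (branch P j t) - prim h (branch P j.+1 t).
  by move=> t0; rewrite subr_ge0 prim_le ?branch_gtN1// branch_decr.
apply: comparable_uptoD.
  apply: (@comparable_uptoW 9) => //.
  - by rewrite mulr_ge0 ?acoef_ge0 ?p0.
  - by rewrite mulr_ge0 ?acoef_ge0 ?p0.
  - by apply: (@comparable_uptoM 2 7); rewrite ?acoef_ge0 ?p0.
apply: (@comparable_uptoM 5 5); rewrite ?ccoef_ge0//.
apply: low_distortion_branch => //; by rewrite lerDl.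
Qed.

End Distortion.

(** * Uniform bounds on the variation of the iterates of the constant 1 *)

Section BoundedDistortion.
Context {R : realType} (P : R) (P1 : 1 <= P).

Lemma low_distortion_op (h : R -> R) : bcont h -> (forall t, 0 <= h t) ->
  low_distortion h -> low_distortion (op P h).
Proof.
move=> bh h0 hd x y x0 xy y1; have [ch _] := bh.
have y0 := le_trans x0 xy; have x1 := le_trans xy y1.
have H n : comparable_upto 10 ((1 + y) / (1 + x)) (oppart P n h (clamp x))
    (oppart P n h (clamp y)).
  rewrite !clamp_id ?x0 ?x1 ?y0 ?y1// /oppart.
  elim: n => [|n IH].
    by rewrite !big_ord0 /comparable_upto mulr0.
  by rewrite !big_ord_recr; apply: comparable_uptoD => //; exact: opterm_comparable.
have Hx := bcont_cvg P1 (x := x) bh; have Hy := bcont_cvg P1 (x := y) bh.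
split.
- by apply: (cvg_le_cvg Hx (cvgM (cvg_cst _) Hy)) => n; case: (H n).
- by apply: (cvg_le_cvg Hy (cvgM (cvg_cst _) Hx)) => n; case: (H n).
Qed.

(** The constant 1 has low distortion and [op] preserves this property; on [0, 1] the ratio
    [(1 + t) / (1 + s)] is at most 2. *)
Lemma iter_op1_ratio n x y :
  iter n (op P) (fun=> 1) x <= 2 ^+ 10 * iter n (op P) (fun=> 1) y.
Proof.
set e := iter n (op P) (fun=> 1).
have [be e0 ed] : [/\ bcont e, forall t, 0 <= e t & low_distortion e].
  rewrite /e {e}; elim: n => [|n [b p d]] /=.
    split => //; [exact: bcont1|]; move=> s t s0 st t1.
    have : comparable_upto 0 ((1 + t) / (1 + s)) 1 1 by exact: comparable_upto_refl.
    apply: comparable_uptoW => //.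
    by rewrite ler_pdivlMr ?mul1r ?lerD2l// ltr_wpDr.
  split; [exact: op_bcont | | exact: low_distortion_op].
  by move=> t; apply: le_trans (op_ge_doeblin P1 b p t); exact: doeblin_ge0.
have ec t : e (clamp t) = e t by rewrite /e {e be e0 ed}; case: n => //= m; rewrite op_clamp.
have ratio (s t : R) : 0 <= s -> s <= t -> t <= 1 -> ((1 + t) / (1 + s)) ^+ 10 <= 2 ^+ 10.
  move=> s0 st t1; have s1 : 0 < 1 + s by rewrite ltr_wpDr.
  have t0 := le_trans s0 st.
  have t2 : (1 + t) / (1 + s) <= 2 by rewrite ler_pdivrMr//; lra.
  by apply: lerXn2r t2; rewrite nnegrE// divr_ge0 ?(ltW s1)// addr_ge0.
rewrite -(ec x) -(ec y).
have /andP[x0 x1] := clamp_in x; have /andP[y0 y1] := clamp_in y.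
have [xy|/ltW yx] := leP (clamp x) (clamp y).
- have [H _] := ed _ _ x0 xy y1; apply: le_trans H _.
  by rewrite ler_wpM2r// ratio.
- have [_ H] := ed _ _ y0 yx x1; apply: le_trans H _.
  by rewrite ler_wpM2r// ratio.
Qed.

End BoundedDistortion.

(** * The test function *)

Section TestFunction.
Context {R : realType} (P : R) (P1 : 1 <= P).
Implicit Types x y z : R.

Let P0 : 0 < P. Proof. exact: lt_le_trans P1. Qed.

(* If [(P + x) F' = testprim] then the density of the pushforward of [F'] is
   computed by the telescoping sum of [3 / (3 z + 1) - 3 / (3 (z + 1) + 1)]. *)
Definition testprim x : R := 9 * P * (P + x) / ((3 * P + x) * (3 * P + 4 * x)).

Definition testfun x : R :=
  18 * P * (3 * P ^+ 2 + 4 * P * x + 2 * x ^+ 2) /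
  ((3 * P + x) ^+ 2 * (3 * P + 4 * x) ^+ 2).

Definition testfunI := testfun \o clamp.

Let d1 x : 0 <= x -> 0 < 3 * P + x. Proof. by move: P0; lra. Qed.
Let d4 x : 0 <= x -> 0 < 3 * P + 4 * x. Proof. by move: P0; lra. Qed.

Let num_gt0 x : 0 <= x -> 0 < 3 * P ^+ 2 + 4 * P * x + 2 * x ^+ 2.
Proof.
move=> x0; have P2 : 0 < P ^+ 2 by rewrite exprn_gt0.
have Px : 0 <= P * x by rewrite mulr_ge0// ltW.
by have := sqr_ge0 x; lra.
Qed.

Lemma testfun_gt0 x : 0 <= x -> 0 < testfun x.
Proof.
move=> x0; apply: divr_gt0; apply: mulr_gt0.
- exact: mulr_gt0.
- exact: num_gt0.
- by rewrite exprn_gt0// d1.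
- by rewrite exprn_gt0// d4.
Qed.

Lemma is_derive_testprim x : 0 <= x -> is_derive x 1 testprim (- testfun x).
Proof.
move=> x0.
have lin (a b : R) : is_derive x 1 (fun t => a + b * t) b.
  have := is_deriveD (is_derive_cst a x 1) (is_deriveZ b (is_derive_id x 1)).
  have -> : 0 + b *: (1 : R) = b by rewrite add0r /GRing.scale /= mulr1.
  exact.
have lin1 (a : R) : is_derive x 1 (fun t => a + t) 1.
  by have := is_deriveD (is_derive_cst a x 1) (is_derive_id x 1); rewrite add0r; exact.
have nz : (3 * P + x) * (3 * P + 4 * x) != 0.
  by apply: mulf_neq0; rewrite gt_eqF ?(d4 x0) ?(d1 x0).
have [D V] := is_deriveM (is_deriveZ (9 * P) (lin1 P))
  (is_deriveV (f := fun t => (3 * P + t) * (3 * P + 4 * t)) nz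
    (is_deriveM (lin1 (3 * P)) (lin (3 * P) 4))).
split; first exact: D.
apply: (etrans V); rewrite /GRing.scale /= /GRing.scale /= /testfun.
by field; rewrite !gt_eqF ?(d4 x0) ?(d1 x0).
Qed.

Lemma testfunI_bcont : bcont testfunI.
Proof.
have c : continuous testfunI.
  apply: continuous_clamp_comp => x x0.
  have cid : {for x, continuous (@id R)} by exact: cvg_id.
  have cst (a : R) : {for x, continuous (fun=> a)} by exact: cvg_cst.
  have cX (f : R -> R) i : {for x, continuous f} ->
      {for x, continuous (fun t => f t ^+ i)}.
    move=> cf; apply: (@continuous_comp _ _ _ f (fun u => u ^+ i)) => //.
    exact: exprn_continuous.
  apply: cvgM.
    apply: cvgM; first exact: cst.
    apply: cvgD; first by apply: cvgD; [exact: cst | apply: cvgM; [exact: cst | exact: cid]].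
    by apply: cvgM; [exact: cst | exact: (cX id)].
  have nz : (3 * P + x) ^+ 2 * (3 * P + 4 * x) ^+ 2 != 0.
    exact: lt0r_neq0 (mulr_gt0 (exprn_gt0 2 (d1 x0)) (exprn_gt0 2 (d4 x0))).
  apply: cvgV; first exact: nz.
  apply: cvgM; [apply: (cX (fun t => 3 * P + t)) | apply: (cX (fun t => 3 * P + 4 * t))].
    by apply: cvgD; [exact: cst | exact: cid].
  by apply: cvgD; [exact: cst | apply: cvgM; [exact: cst | exact: cid]].
split => //; exists (18 * P * (3 * P ^+ 2 + 4 * P + 2) / ((3 * P) ^+ 2 * (3 * P) ^+ 2)).
move=> x; rewrite /testfunI /=; have /andP[x0 x1] := clamp_in x.
rewrite ger0_norm; last by rewrite ltW// testfun_gt0.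
set y := clamp x in x0 x1 *.
have P30 : 0 <= 3 * P by rewrite mulr_ge0// ltW.
have PP : 0 < 18 * P by rewrite mulr_gt0.
rewrite /testfun; apply: ler_pM.
- by rewrite mulr_ge0 ?(ltW PP)// ltW// num_gt0.
- by rewrite invr_ge0 mulr_ge0 ?sqr_ge0.
- rewrite ler_wpM2l ?(ltW PP)//; have : y ^+ 2 <= 1 by rewrite expr_le1.
  have : 4 * P * y <= 4 * P by rewrite ler_piMr// mulr_ge0// ltW.
  by lra.
- rewrite lef_pV2 ?posrE ?mulr_gt0 ?exprn_gt0 ?(d4 x0) ?(d1 x0) ?mulr_gt0//.
  have sq (u : R) : 3 * P <= u -> (3 * P) ^+ 2 <= u ^+ 2.
    by move=> Pu; rewrite lerXn2r ?nnegrE// (le_trans P30).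
  by apply: ler_pM; rewrite ?sqr_ge0// sq// lerDl// mulr_ge0.
Qed.

(** Here [y] stands for [P + x] and [z] for [P + j + x]. The first two summands are the derivative
    in [x] of [3 * (P + x) / (3 * z + 1)], the telescoping flux; the last is
    [acoef j x * testprim (branch j x)], the boundary term of the summation by parts. Thus [opterm]
    is a difference of consecutive values of [Q]. *)
Let Q y z : R := 3 / (3 * z + 1) - 9 * y / (3 * z + 1) ^+ 2 -
  (z - y) * (9 * (z + 1)) / (z * ((3 * z + 1) * (3 * z + 4))).

Let Q_bound y z : 0 <= y -> y <= z -> 0 < z -> `|Q y z| <= 3 / z.
Proof.
move=> y0 yz z0.
have a0 : 0 < 3 * z + 1 by lra.
have b0 : 0 < 3 * z + 4 by lra.
have A : 0 <= 3 / (3 * z + 1) <= z^-1.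
  by rewrite divr_ge0 ?(ltW a0)//= ler_pdivrMr// ler_pdivlMl//; lra.
have B : 0 <= 9 * y / (3 * z + 1) ^+ 2 <= z^-1.
  have n0 : 0 <= 9 * y by rewrite mulr_ge0.
  apply/andP; split; first by rewrite divr_ge0// sqr_ge0.
  rewrite ler_pdivrMr ?exprn_gt0// ler_pdivlMl//.
  have : z * y <= z * z by rewrite ler_pM2l.
  by lra.
have C : 0 <= (z - y) * (9 * (z + 1)) / (z * ((3 * z + 1) * (3 * z + 4))) <= z^-1.
  have D0 : 0 < z * ((3 * z + 1) * (3 * z + 4)) by rewrite !mulr_gt0.
  have zy : 0 <= z - y by rewrite subr_ge0.
  have z1 : 0 <= 9 * (z + 1) by lra.
  apply/andP; split; first exact: divr_ge0 (mulr_ge0 zy z1) (ltW D0).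
  rewrite ler_pdivrMr// mulKf ?gt_eqF//.
  apply: le_trans (_ : z * (9 * (z + 1)) <= _); last by nra.
  by rewrite ler_wpM2r// gerBl.
have -> : 3 / z = z^-1 + z^-1 + z^-1 by ring.
by rewrite /Q ler_norml; move: A B C => /andP[? ?] /andP[? ?] /andP[? ?]; lra.
Qed.

(** The partial sums telescope, [Q] tends to 0 as [z] grows, and what remains is
    [Q (P + x) (P + x)], where the boundary term vanishes. *)
Lemma op_testfun x : op P testfunI x = 3 / (3 * clamp x + 3 * P + 1) ^+ 2.
Proof.
have [c [B tB]] := testfunI_bcont.
have /andP[x0 x1] := clamp_in x; set y := clamp x in x0 x1 *.
have pdiff j : prim testfunI (branch P j y) - prim testfunI (branch P j.+1 y) =
    testprim (branch P j.+1 y) - testprim (branch P j y).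
  have D t : branch P j.+1 y <= t <= branch P j y ->
      is_derive t 1 (fun t => - testprim t) (testfunI t).
    move=> /andP[t1 t2]; have t0 : 0 <= t by apply: le_trans t1; rewrite ltW// branch_gt0.
    rewrite /testfunI /= clamp_id; last by rewrite t0 (le_trans t2)// branch_le1.
    by have := is_deriveN (is_derive_testprim t0); rewrite opprK; exact.
  rewrite -(prim_cst_diff c (branch_gtN1 P1 j.+1 x0) (branch_decr P1 j x0) D).
  by rewrite opprK addrC.
have term j : opterm P testfunI j y =
    Q (P + y) (P + j%:R + y) - Q (P + y) (P + j.+1%:R + y).
  rewrite /opterm pdiff /testfunI /= clamp_id; last first.
    by rewrite ltW ?branch_gt0// branch_le1.
  rewrite /acoef /ccoef /branch /testprim /testfun /Q.
  have z0 := den_gt0 P1 j x0.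
  have -> : P + j.+1%:R + y = P + j%:R + y + 1 by rewrite -natr1; ring.
  have -> : j.+1%:R = P + j%:R + y + 1 - (P + y) by rewrite -natr1; ring.
  set w := P + y; set z := P + j%:R + y in z0 *.
  have E1 : 3 * P + P / z = P * (3 * z + 1) / z by field; rewrite gt_eqF.
  have E4 : 3 * P + 4 * (P / z) = P * (3 * z + 4) / z by field; rewrite gt_eqF.
  have F1 : 3 * P + P / (z + 1) = P * (3 * z + 4) / (z + 1) by field; rewrite gt_eqF; lra.
  have F4 : 3 * P + 4 * (P / (z + 1)) = P * (3 * z + 7) / (z + 1).
    by field; rewrite gt_eqF; lra.
  rewrite E1 E4 F1 F4; field.
  by repeat (apply/andP; split); rewrite gt_eqF; move: P0; lra.
have sum n : oppart P n testfunI y = Q (P + y) (P + y) - Q (P + y) (P + n%:R + y).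
  rewrite /oppart; elim: n => [|n IH]; first by rewrite big_ord0 addr0 subrr.
  by rewrite big_ord_recr /= IH term addrA subrK.
have H : (fun n => oppart P n testfunI y) @ \oo --> Q (P + y) (P + y).
  apply: (cvg_of_rate _ (cvg0_div_shift 3 P0)) => n.
  rewrite sum addrAC subrr sub0r normrN.
  have z0 := den_gt0 P1 n x0.
  have Py : 0 <= P + y by rewrite addr_ge0// ltW.
  apply: le_trans (Q_bound Py _ z0) _; first by rewrite lerD2r lerDl.
  rewrite ler_pM2l// lef_pV2 ?posrE//; first by rewrite lerDl.
  by have := den_gt0 P1 n (lexx 0); rewrite addr0.
have Hx := bcont_cvg P1 (x := x) testfunI_bcont.
rewrite (cvg_unique _ Hx H)// /Q subrr mul0r mul0r subr0; field.
by rewrite !gt_eqF//; move: P0; lra.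
Qed.

Let ge_fraction (N e q a b : R) : e != 0 -> q != 0 -> a != 0 -> b != 0 ->
  3 / e ^+ 2 - P / (2 / 9 * q ^+ 2) * (18 * P * N / (a ^+ 2 * b ^+ 2)) =
  3 * (q ^+ 2 * (a * b) ^+ 2 - 27 * P ^+ 2 * N * e ^+ 2) /
  (e ^+ 2 * q ^+ 2 * a ^+ 2 * b ^+ 2).
Proof. by move=> e0 q0 a0 b0; field; rewrite e0 q0 a0 b0. Qed.

Let lt_fraction (N e k a b : R) : e != 0 -> k != 0 -> a != 0 -> b != 0 ->
  P / (2 / 9 * k) * (18 * P * N / (a ^+ 2 * b ^+ 2)) - 3 / e ^+ 2 =
  3 * (27 * P ^+ 2 * N * e ^+ 2 - k * (a * b) ^+ 2) /
  (e ^+ 2 * k * a ^+ 2 * b ^+ 2).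
Proof. by move=> e0 k0 a0 b0; field; rewrite e0 k0 a0 b0. Qed.

(** The lower constant is the value at 0 of the quotient of [op testfun] by [testfun], so the two
    sides agree at 0 and the numerator of their difference has a factor [x]. The cofactor [D] is
    written with nonnegative coefficients in [P], [x] and [1 - x]; its summand [108 * P ^+ 3 * x]
    gives strictness for [x > 0]. *)
Lemma op_testfun_ge x : 0 <= x <= 1 ->
  P / (2 * (P ^+ 2 + 2 / 3 * P + 1 / 9)) * testfun x <= 3 / (3 * x + 3 * P + 1) ^+ 2 /\
  (0 < x ->
  P / (2 * (P ^+ 2 + 2 / 3 * P + 1 / 9)) * testfun x < 3 / (3 * x + 3 * P + 1) ^+ 2).
Proof.
move=> /andP[x0 x1].
have e0 : 0 < 3 * x + 3 * P + 1 by move: P0; lra.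
have q0 : 0 < 3 * P + 1 by move: P0; lra.
have A1 := d1 x0; have A4 := d4 x0.
pose den := (3 * x + 3 * P + 1) ^+ 2 * (3 * P + 1) ^+ 2 * (3 * P + x) ^+ 2 * (3 * P + 4 * x) ^+ 2.
have den0 : 0 < den by rewrite !mulr_gt0 ?exprn_gt0.
pose D := 486 * P ^+ 4 * (1 - x) + 162 * P ^+ 3 * ((1 - x) * (1 + x)) +
  702 * P ^+ 3 * (x * (1 - x)) + 108 * P ^+ 3 * x + 243 * P ^+ 2 * x +
  342 * P ^+ 2 * (x ^+ 2 * (1 - x)) + 54 * P ^+ 2 * x ^+ 2 + 120 * P * x ^+ 2 +
  (96 * P + 16) * x ^+ 3.
have E : 3 / (3 * x + 3 * P + 1) ^+ 2 -
    P / (2 * (P ^+ 2 + 2 / 3 * P + 1 / 9)) * testfun x = 3 * (x * D) / den.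
  have -> : 2 * (P ^+ 2 + 2 / 3 * P + 1 / 9) = 2 / 9 * (3 * P + 1) ^+ 2 by field.
  rewrite /testfun ge_fraction ?gt_eqF// -/den.
  by congr (3 * _ / _); rewrite /D; ring.
have x1' : 0 <= 1 - x by rewrite subr_ge0.
have p0 := ltW P0.
have P4 := exprn_ge0 4 p0; have P3 := exprn_ge0 3 p0; have P2 := exprn_ge0 2 p0.
have X2 := exprn_ge0 2 x0; have X3 := exprn_ge0 3 x0.
have D0 : 108 * P ^+ 3 * x <= D.
  have := mulr_ge0 P4 x1'.
  have := mulr_ge0 P3 (mulr_ge0 x1' (addr_ge0 ler01 x0)).
  have := mulr_ge0 P3 (mulr_ge0 x0 x1').
  have := mulr_ge0 P2 x0.
  have := mulr_ge0 P2 (mulr_ge0 X2 x1').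
  have := mulr_ge0 P2 X2.
  have := mulr_ge0 p0 X2.
  have := mulr_ge0 p0 X3.
  by move: X3; rewrite /D; lra.
have xP3 : 0 <= 108 * P ^+ 3 * x by rewrite !mulr_ge0.
split.
  rewrite -subr_ge0 E divr_ge0 ?(ltW den0)// mulr_ge0//.
  by apply: mulr_ge0 => //; exact: le_trans D0.
move=> x0'; rewrite -subr_gt0 E divr_gt0// mulr_gt0//.
by apply: mulr_gt0 => //; apply: lt_le_trans D0; rewrite !mulr_gt0// exprn_gt0.
Qed.

Lemma op_testfun_lt x : 0 <= x <= 1 ->
  3 / (3 * x + 3 * P + 1) ^+ 2 < P / (2 * (P ^+ 2 + 2 / 3 * P - 2 / 9)) * testfun x.
Proof.
move=> /andP[x0 x1].
have e0 : 0 < 3 * x + 3 * P + 1 by move: P0; lra.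
have q0 : 0 < 9 * P ^+ 2 + 6 * P - 2.
  by have := exprn_ge0 2 (ltW P0); move: P1; lra.
have A1 := d1 x0; have A4 := d4 x0.
pose den := (3 * x + 3 * P + 1) ^+ 2 * (9 * P ^+ 2 + 6 * P - 2) * (3 * P + x) ^+ 2 * (3 * P + 4 * x) ^+ 2.
have den0 : 0 < den by rewrite !mulr_gt0 ?exprn_gt0.
(* Every summand is nonnegative for [x] in [0, 1], and the first is positive because [x] and [1 - x]
   do not vanish together. *)
pose D := 243 * P ^+ 4 * ((1 - x) ^+ 2 + x ^+ 2) +
  P ^+ 3 * x * (243 + 405 * (1 - x) ^+ 2 + 459 * x ^+ 2) +
  P ^+ 2 * x ^+ 2 * (252 + 396 * (1 - x) + 342 * x ^+ 2) +
  P * x ^+ 3 * (144 + 96 * (1 - x)) + 32 * x ^+ 4.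
have E : P / (2 * (P ^+ 2 + 2 / 3 * P - 2 / 9)) * testfun x -
    3 / (3 * x + 3 * P + 1) ^+ 2 = 3 * D / den.
  have -> : 2 * (P ^+ 2 + 2 / 3 * P - 2 / 9) = 2 / 9 * (9 * P ^+ 2 + 6 * P - 2) by field.
  rewrite /testfun lt_fraction ?gt_eqF// -/den.
  by congr (3 * _ / _); rewrite /D; ring.
have x1' : 0 <= 1 - x by rewrite subr_ge0.
have p0 := ltW P0.
rewrite -subr_gt0 E divr_gt0// mulr_gt0//.
have H1 : 0 < 243 * P ^+ 4 * ((1 - x) ^+ 2 + x ^+ 2).
  rewrite !mulr_gt0 ?exprn_gt0//.
  have -> : (1 - x) ^+ 2 + x ^+ 2 = 1 - 2 * (x * (1 - x)) by ring.
  nra.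
have P3 := exprn_ge0 3 p0; have P2 := exprn_ge0 2 p0.
have X2 := exprn_ge0 2 x0; have X3 := exprn_ge0 3 x0; have X4 := exprn_ge0 4 x0.
have Y2 : 0 <= (1 - x) ^+ 2 by rewrite sqr_ge0.
have P3x := mulr_ge0 P3 x0.
have := mulr_ge0 P3x Y2.
have := mulr_ge0 P3x X2.
have P2x := mulr_ge0 P2 X2.
have := mulr_ge0 P2x x1'.
have := mulr_ge0 P2x X2.
have Px := mulr_ge0 p0 X3.
have := mulr_ge0 Px x1'.
by move: H1 P3x P2x Px X4; rewrite /D; lra.
Qed.

End TestFunction.

(** * The leading eigenvalue *)

Section Spectrum.
Context {R : realType} (P : R) (P1 : 1 <= P).

Let P0 : 0 < P. Proof. exact: lt_le_trans P1. Qed.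

Theorem op_spectrum : exists (lam t : R) (psi : R -> R) (L : (R -> R) -> R),
  [/\ [/\ 0 < t < 1, bcont psi, (forall x, (2 ^+ 10)^-1 <= psi x) &
         forall x, op P psi x = lam * psi x],
      P / (2 * (P ^+ 2 + 2 / 3 * P + 1 / 9)) < lam <
      P / (2 * (P ^+ 2 + 2 / 3 * P - 2 / 9)),
      (forall a f g, bcont f -> bcont g -> L (fun x => a * f x + g x) = a * L f + L g) &
      forall f a b, bcont f -> (forall x, a * psi x <= f x <= b * psi x) ->
        a <= L f <= b /\ forall n x,
        `|iter n (op P) f x - lam ^+ n * L f * psi x| <=
          t ^+ n * (b - a) * (lam ^+ n * psi x)].
Proof.
have mu1 : 0 < doeblin P (fun=> 1) by apply: doeblin_gt0 => //; exact: bcont1.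
have [lam [t [psi [L [[lam0 t01 bpsi psiC psiE] LL LU LP]]]]] :=
  @perron_frobenius R R 0 (@bcont R) (op P) (doeblin P) ((P + 1) / P) (2 ^+ 10)
  (bcont1) (@bcontL R) (@bcont_lim R) (fun f bf => proj2 bf)
  (@op_bcont R P P1) (@opL R P P1) (@doeblinL R P P1) mu1 (@doeblin_ge0 R P P1)
  (@op_ge_doeblin R P P1) (@op1_le R P P1) (@iter_op1_ratio R P P1).
have C0 : 0 < 2 ^+ 10 :> R by rewrite exprn_gt0.
have L_ge f a : bcont f -> (forall x, a * psi x <= f x) -> a <= L f.
  move=> bf af; have [_ [B fB]] := bf.
  have B0 : 0 <= B := le_trans (normr_ge0 _) (fB 0).
  have fab x : a * psi x <= f x <= B * 2 ^+ 10 * psi x.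
    rewrite af/=; apply: (le_trans (le_trans (ler_norm _) (fB x))).
    rewrite -mulrA ler_peMr//; case/andP: (psiC x) => H _.
    by rewrite -ler_pdivrMl ?mulr1.
  by have [/andP[]] := LP _ _ _ bf fab.
(* One application of [op] makes [f] bounded below by the positive constant [doeblin f], hence by a
   positive multiple of [psi], and [L (op f) = lam * L f]. Positivity of [f] is asked on the
   interval that defines [doeblin]; it avoids 0, where the lower bound for the test function is an
   equality. *)
have L_gt0 f : bcont f -> (forall x, 0 <= f x) ->
    (forall x, P / (P + 2) <= x <= P / (P + 1) -> 0 < f x) -> 0 < L f.
  move=> bf f0 f1; have m0 := doeblin_gt0 P1 bf f0 f1.
  have H : doeblin P f / 2 ^+ 10 <= L (op P f).
    apply: L_ge => [|x]; first exact: op_bcont.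
    apply: le_trans (op_ge_doeblin P1 bf f0 x).
    rewrite mulrAC ler_pdivrMr// ler_wpM2l ?(ltW m0)//.
    by case/andP: (psiC x).
  have := lt_le_trans (divr_gt0 m0 C0) H.
  by rewrite LU// pmulr_rgt0.
have J0 x : P / (P + 2) <= x -> 0 < x.
  by apply: lt_le_trans; rewrite divr_gt0// addr_gt0.
have J1 x : x <= P / (P + 1) -> x <= 1.
  by move=> /le_trans; apply; rewrite ler_pdivrMr ?mul1r ?lerDl// addr_gt0.
have bphi := testfunI_bcont P1.
have bUphi : bcont (op P (testfunI P)) by exact: op_bcont.
have phi0 x : 0 < testfunI P x.
  by apply: testfun_gt0 => //; case/andP: (clamp_in x).
have Lphi : 0 < L (testfunI P) by apply: L_gt0 => // x; exact: ltW.
exists lam, t, psi, L; split => //.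
- by split => // x; case/andP: (psiC x).
- set v := P / (2 * (P ^+ 2 + 2 / 3 * P + 1 / 9)).
  set w := P / (2 * (P ^+ 2 + 2 / 3 * P - 2 / 9)).
  apply/andP; split.
    have : 0 < L (fun x => (- v) * testfunI P x + op P (testfunI P) x).
      apply: L_gt0; first exact: bcontL.
        move=> x; rewrite mulNr addrC subr_ge0 op_testfun//.
        by have [] := op_testfun_ge P1 (clamp_in x).
      move=> x /andP[x0 x1]; rewrite mulNr addrC subr_gt0 op_testfun//.
      have [_] := op_testfun_ge P1 (clamp_in x); apply.
      by rewrite clamp_id ?(J0 x)// ltW ?J0// J1.
    by rewrite LL// LU// mulNr addrC -mulrBl pmulr_lgt0// subr_gt0.
  (* The multiple [w * testfunI] is written as [(w - 1) * testfunI + testfunI] to fit the form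
     [a * f + g] in which linearity is available. *)
  have : 0 < L (fun x => (-1) * op P (testfunI P) x +
      ((w - 1) * testfunI P x + testfunI P x)).
    apply: L_gt0; first by do 2 apply: bcontL => //.
      move=> x; rewrite mulN1r addrC subr_ge0 op_testfun// ltW//.
      by have := op_testfun_lt P1 (clamp_in x); rewrite -/w /testfunI /=; lra.
    move=> x _; rewrite mulN1r addrC subr_gt0 op_testfun//.
    by have := op_testfun_lt P1 (clamp_in x); rewrite -/w /testfunI /=; lra.
  rewrite LL//; last exact: bcontL.
  rewrite LL// LU//.
  have -> : -1 * (lam * L (testfunI P)) + ((w - 1) * L (testfunI P) + L (testfunI P)) =
    (w - lam) * L (testfunI P) by ring.
  by rewrite pmulr_lgt0// subr_gt0.
Qed.

End Spectrum.

(** * The boundary value problem *)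

Section BoundaryValueProblem.
Context {R : realType} (p : nat) (hp : (0 < p)%N).
Local Notation P := (p%:R : R).
Local Notation c := (log_const p : R).
Implicit Types (F G D k h : R -> R) (x A b e : R).

Lemma param_ge1 : 1 <= P. Proof. by rewrite ler1n. Qed.

Let P0 : 0 < P. Proof. by rewrite ltr0n. Qed.

Let Px_gt0 x : -1 < x -> 0 < P + x.
Proof. by move=> x1; have := param_ge1; lra. Qed.

Lemma log_const_gt0 : 0 < c.
Proof. by rewrite subr_gt0 ltr_ln ?posrE ?addr_gt0// ltrDl. Qed.

Lemma Phi0 : Phi p 0 = 0 :> R.
Proof. by rewrite /Phi addr0 subrr mul0r. Qed.

Lemma Phi1 : Phi p 1 = 1 :> R.
Proof. by rewrite /Phi divff// gt_eqF// log_const_gt0. Qed.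

Lemma is_derive_Phi x : -1 < x -> is_derive x 1 (Phi p) (c^-1 / (P + x)).
Proof.
move=> x1; have Px := Px_gt0 x1.
have D1 : is_derive x 1 (fun t => P + t) 1.
  by have := is_deriveD (is_derive_cst P x 1) (is_derive_id x 1); rewrite add0r; exact.
have D2 := @is_derive1_comp _ (@ln R) _ x _ _ (is_derive1_ln Px) D1.
have [D V] := is_deriveZ c^-1 (is_deriveB D2 (is_derive_cst (ln P) x 1)).
have E : Phi p = c^-1 \*: ((@ln R) \o (fun t => P + t) - cst (ln P)).
  by apply/funext => t; rewrite /Phi mulrC.
by rewrite E; split=> //; apply: (etrans V); rewrite subr0 mulr1.
Qed.

Lemma Phi_in x : 0 <= x <= 1 -> 0 <= Phi p x <= 1.
Proof.
move=> /andP[x0 x1].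
have mono a b : 0 <= a -> a <= b -> Phi p a <= Phi p b.
  move=> a0 ab; rewrite /Phi ler_pM2r ?invr_gt0 ?log_const_gt0// lerD2r.
  by rewrite ler_ln ?posrE ?lerD2l// ltr_wpDr// (le_trans a0).
by have := mono 0 x (lexx 0) x0; have := mono x 1 x0 x1; rewrite Phi0 Phi1 => -> ->.
Qed.

(* [(P + x) F'] is nondecreasing, so [F] is convex in the variable [Phi]. *)
Lemma convex_le0 F k (dk : R -> R) : contI F -> F 0 <= 0 -> F 1 <= 0 ->
  (forall x, 0 < x < 1 -> is_derive x 1 F (k x / (P + x))) ->
  (forall x, 0 < x < 1 -> is_derive x 1 k (dk x)) ->
  (forall x, 0 < x < 1 -> 0 <= dk x) ->
  forall x, 0 <= x <= 1 -> F x <= 0.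
Proof.
move=> cF F0 F1 Fd kd dk0 x /andP[x0 x1].
rewrite leNgt; apply/negP => Fx.
have {}x0 : 0 < x.
  by rewrite lt_neqAle x0 andbT; apply/eqP => E; move: Fx; rewrite -E ltNge F0.
have {}x1 : x < 1.
  by rewrite lt_neqAle x1 andbT; apply/eqP => E; move: Fx; rewrite E ltNge F1.
have sub a b : 0 <= a -> b <= 1 -> {within `[a, b], continuous F}.
  move=> a0 b1; apply: continuous_subspaceW cF => t; rewrite /unitI /= !in_itv /=.
  by move=> /andP[t0 t1]; rewrite (le_trans a0 t0) (le_trans t1 b1).
have DL t : t \in `]0, x[ -> is_derive t 1 F (k t / (P + t)).
  by rewrite in_itv /= => /andP[t0 t1]; apply: Fd; rewrite t0 (lt_trans t1).
have DR t : t \in `]x, 1[ -> is_derive t 1 F (k t / (P + t)).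
  by rewrite in_itv /= => /andP[t0 t1]; apply: Fd; rewrite t1 (lt_trans x0).
have [u] := MVT x0 DL (sub 0 x (lexx 0) (ltW x1)).
rewrite in_itv /= => /andP[u0 ux] Eu.
have [w] := MVT x1 DR (sub x 1 (ltW x0) (lexx 1)).
rewrite in_itv /= => /andP[xw w1] Ew.
have ku : 0 < k u.
  have : 0 < k u / (P + u) * (x - 0) by rewrite -Eu; lra.
  rewrite subr0 pmulr_lgt0// pmulr_lgt0// invr_gt0 Px_gt0//.
  exact: lt_trans u0.
have kw : k w < 0.
  have : k w / (P + w) * (1 - x) < 0 by rewrite -Ew; lra.
  have x1' : 0 < 1 - x by rewrite subr_gt0.
  rewrite pmulr_llt0// pmulr_llt0// invr_gt0 Px_gt0//.
  by apply: lt_trans xw; apply: lt_trans x0.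
have uw : u <= w by rewrite ltW// (lt_trans ux).
have uw01 t : u <= t <= w -> 0 < t < 1.
  by move=> /andP[ut tw]; rewrite (lt_le_trans u0 ut) (le_lt_trans tw w1).
have kuw : k u <= k w.
  apply: (@is_derive_le _ k dk) => // t /uw01; [exact: kd|exact: dk0].
by move: ku kw kuw; lra.
Qed.

Lemma is_derive_PhiM K x : -1 < x ->
  is_derive x 1 (fun t => K * (Phi p t * (1 - Phi p t)))
    (K * c^-1 * (1 - 2 * Phi p x) / (P + x)).
Proof.
move=> x1; have D := is_derive_Phi x1.
have [D' V] := is_deriveZ K (is_deriveM D (is_deriveB (is_derive_cst (1 : R) x 1) D)).
split; first exact: D'.
apply: (etrans V); rewrite /GRing.scale /= /GRing.scale /=.
have -> : (cst (1 : R) - Phi p) x = 1 - Phi p x by [].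
by ring.
Qed.

Lemma contI_of_derive F (dF : R -> R) :
  (forall x, 0 <= x <= 1 -> is_derive x 1 F (dF x)) -> contI F.
Proof. by move=> FD; exact: is_derive_within FD. Qed.

(** For the barrier [B = K * (Phi * (1 - Phi))] with [K = e * c ^+ 2 * ((P + 1) / 2)] one computes
    [((P + x) B')' = - e * (P + 1) / (P + x)], which is at most [- e] on [0, 1]. So [D - B] and
    [- D - B] are convex in the variable [Phi] and vanish at both ends, and [convex_le0] applies to
    each. *)
Lemma maximum_principle D k (eta : R -> R) e : contI D -> D 0 = 0 -> D 1 = 0 ->
  (forall x, 0 < x < 1 -> is_derive x 1 D (k x / (P + x))) ->
  (forall x, 0 < x < 1 -> is_derive x 1 k (eta x)) ->
  (forall x, 0 < x < 1 -> `|eta x| <= e) ->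
  forall x, 0 <= x <= 1 ->
  `|D x| <= e * c ^+ 2 * ((P + 1) / 2) * (Phi p x * (1 - Phi p x)).
Proof.
have c0 := log_const_gt0.
suff upper D' k' (eta' : R -> R) : contI D' -> D' 0 = 0 -> D' 1 = 0 ->
    (forall x, 0 < x < 1 -> is_derive x 1 D' (k' x / (P + x))) ->
    (forall x, 0 < x < 1 -> is_derive x 1 k' (eta' x)) ->
    (forall x, 0 < x < 1 -> `|eta' x| <= e) ->
    forall x, 0 <= x <= 1 ->
    D' x <= e * c ^+ 2 * ((P + 1) / 2) * (Phi p x * (1 - Phi p x)).
  move=> cD D0 D1 Dd kd ke x xI; rewrite ler_norml; apply/andP; split.
    rewrite lerNl; apply: (upper (fun x => - D x) (fun x => - k x) (fun x => - eta x)) => //.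
    - by move=> t; apply: cvgN; exact: cD.
    - by rewrite D0 oppr0.
    - by rewrite D1 oppr0.
    - by move=> t t01; rewrite mulNr; exact: (is_deriveN (Dd t t01)).
    - by move=> t t01; exact: (is_deriveN (kd t t01)).
    - by move=> t t01; rewrite normrN ke.
  exact: (upper D k eta).
move=> cD D0 D1 Dd kd ke x xI.
have e0 : 0 <= e.
  by apply: le_trans (ke (1 / 2) _); rewrite ?normr_ge0//; apply/andP; split; lra.
set K := e * c ^+ 2 * ((P + 1) / 2).
rewrite -subr_le0.
pose kE x := k' x - K * c^-1 * (1 - 2 * Phi p x).
pose dE x := eta' x + e * (P + 1) / (P + x).
have N1 (t : R) : 0 < t -> -1 < t by move=> t0; rewrite (lt_trans _ t0)// ltrN10.
apply: (@convex_le0 (fun x => D' x - K * (Phi p x * (1 - Phi p x))) kE dE) => //.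
- have cP : contI (fun x => K * (Phi p x * (1 - Phi p x))).
    apply: (@contI_of_derive _ (fun t => K * c^-1 * (1 - 2 * Phi p t) / (P + t))).
    move=> t /andP[t0 _]; apply: is_derive_PhiM.
    by rewrite (lt_le_trans _ t0)// ltrN10.
  by move=> t; apply: cvgB; [exact: cD | exact: cP].
- by rewrite D0 Phi0 mul0r mulr0 subrr.
- by rewrite D1 Phi1 subrr !mulr0 subrr.
- move=> t t01; have /andP[t0 _] := t01.
  have -> : kE t / (P + t) = k' t / (P + t) - K * c^-1 * (1 - 2 * Phi p t) / (P + t).
    by rewrite /kE; ring.
  exact: (is_deriveB (Dd t t01) (is_derive_PhiM K (N1 t t0))).
- move=> t t01; have /andP[t0 _] := t01; have DP := is_derive_Phi (N1 t t0).
  have [D2 V] := is_deriveB (kd t t01) (is_deriveZ (K * c^-1)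
    (is_deriveB (is_derive_cst (1 : R) t 1) (is_deriveZ 2 DP))).
  split; first exact: D2.
  apply: (etrans V); rewrite /dE /K /GRing.scale /=.
  by field; rewrite !gt_eqF// Px_gt0// N1.
- move=> t t01; have /andP[t0 t1] := t01.
  have Pt := Px_gt0 (N1 t t0).
  have H : e <= e * (P + 1) / (P + t).
    by rewrite ler_pdivlMr// ler_wpM2l// lerD2l ltW.
  by rewrite /dE; have := ke t t01; rewrite ler_norml => /andP[]; lra.
Qed.

(* [((P + x) F')' = h] on [0, 1], with [F 0 = 0] and [F 1 = b]. *)
Definition solves h b F := [/\ contI F, F 0 = 0, F 1 = b &
  exists A, forall x, 0 < x < 1 -> is_derive x 1 F ((A + prim h x) / (P + x))].

Lemma solvesB a h k b b' F G : continuous h -> continuous k ->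
  solves h b F -> solves k b' G ->
  [/\ contI (fun x => F x - a * G x), F 0 - a * G 0 = 0, F 1 - a * G 1 = b - a * b' &
  exists K, (forall x, 0 < x < 1 ->
      is_derive x 1 (fun x => F x - a * G x) (K x / (P + x))) /\
    (forall x, 0 < x < 1 -> is_derive x 1 K (h x - a * k x))].
Proof.
move=> ch ck [cF F0 F1 [A FA]] [cG G0 G1 [B GB]]; split.
- by move=> t; apply: cvgB; [exact: cF | apply: cvgM; [exact: cvg_cst | exact: cG]].
- by rewrite F0 G0 mulr0 subrr.
- by rewrite F1 G1.
exists (fun x => (A + prim h x) - a * (B + prim k x)); split=> x x01.
  rewrite mulrBl -mulrA; exact: (is_deriveB (FA x x01) (is_deriveZ a (GB x x01))).
have /andP[x0 _] := x01; have x1 : -1 < x by rewrite (lt_trans _ x0)// ltrN10.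
have := is_deriveB (is_deriveD (is_derive_cst A x 1) (is_derive_prim ch x1))
  (is_deriveZ a (is_deriveD (is_derive_cst B x 1) (is_derive_prim ck x1))).
by rewrite !add0r; exact.
Qed.

(** The integral of [q] from 0 is a particular solution; a multiple of [Phi], which solves the
    homogeneous equation, adjusts the value at 1. The clamping keeps [q] continuous on the whole
    line, in particular away from zeros of [P + t]. *)
Definition solution h b x : R :=
  let q := fun t => prim h (clamp t) / (P + clamp t) in
  prim q x - prim q 0 + (b - (prim q 1 - prim q 0)) * Phi p x.

Lemma is_derive_solution h b : continuous h ->
  exists A, forall x, 0 <= x <= 1 ->
    is_derive x 1 (solution h b) ((A + prim h x) / (P + x)).
Proof.
move=> ch; pose q := fun t => prim h (clamp t) / (P + clamp t).
have cq : continuous q.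
  apply: (@continuous_clamp_comp _ (fun t => prim h t / (P + t))) => x x0.
  have x1 : -1 < x by rewrite (lt_le_trans _ x0)// ltrN10.
  apply: cvgM; first exact: (is_derive_cont (is_derive_prim ch x1)).
  apply: cvgV; first by rewrite gt_eqF// Px_gt0.
  by apply: cvgD; [exact: cvg_cst | exact: cvg_id].
pose B := b - (prim q 1 - prim q 0).
exists (B * c^-1) => x xI; have /andP[x0 _] := xI.
have x1 : -1 < x by rewrite (lt_le_trans _ x0)// ltrN10.
have [D V] := is_deriveD (is_deriveB (is_derive_prim cq x1) (is_derive_cst (prim q 0) x 1))
  (is_deriveZ B (is_derive_Phi x1)).
split; first exact: D.
apply: (etrans V); rewrite /GRing.scale /= /q clamp_id//.
by ring.
Qed.

Lemma solution_solves h b : continuous h -> solves h b (solution h b).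
Proof.
move=> ch; have [A AD] := is_derive_solution b ch.
split; first exact: contI_of_derive AD.
- by rewrite /solution /= subrr Phi0 mulr0 addr0.
- by rewrite /solution /= Phi1 mulr1 addrC subrK.
- by exists A => x /andP[x0 x1]; apply: AD; rewrite !ltW.
Qed.

End BoundaryValueProblem.

(** * Continuity on [0, 1] expressed through the retraction *)

Section ContI.
Context {R : realType}.
Implicit Types (f g : R -> R) (x : R).

Lemma unitIE x : unitI x = (0 <= x <= 1) :> Prop.
Proof. by rewrite /unitI /= in_itv. Qed.

Lemma contIP f : contI f <-> continuous (f \o clamp).
Proof.
split=> [/subspace_continuousP cf x | cf].
- have Ix : unitI (clamp x) by rewrite unitIE; exact: clamp_in.
  apply: cvg_comp (cf _ Ix) => W WH.
  have H : nbhs x (clamp @^-1` (fun y => unitI y -> W y)) := continuous_clamp WH.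
  apply: (@filterS _ (nbhs x) _ _ _ _ H) => y /= Wy; apply: Wy.
  by rewrite unitIE; exact: clamp_in.
- apply: (@subspace_eq_continuous _ unitI _ (f \o clamp)).
    by move=> x; rewrite inE unitIE => xI; rewrite /= clamp_id.
  exact: continuous_subspaceT.
Qed.

Lemma eq_contI f g : (forall x, 0 <= x <= 1 -> f x = g x) -> contI f -> contI g.
Proof.
move=> fg /contIP cf; apply/contIP; rewrite (_ : g \o clamp = f \o clamp)//.
by apply/funext => x /=; rewrite (fg _ (clamp_in x)).
Qed.

Lemma contI_seq f (u : nat -> R) (l : R) : contI f -> (forall n, 0 <= u n <= 1) ->
  0 <= l <= 1 -> u @ \oo --> l -> (fun n => f (u n)) @ \oo --> f l.
Proof.
move=> /contIP cf u01 l01 ul.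
have -> : (fun n => f (u n)) = (fun n => (f \o clamp) (u n)).
  by apply/funext => n /=; rewrite clamp_id.
by have := cvg_comp _ _ ul (cf l); rewrite /= clamp_id.
Qed.

End ContI.

(** * Pushing forward by one step *)

Section Transfer.
Context {R : realType} (p : nat) (hp : (0 < p)%N).
Local Notation P := (p%:R : R).
Local Notation c := (log_const p : R).
Implicit Types (F G h : R -> R) (x A b B : R) (j N : nat).

Let P0 : 0 < P. Proof. by rewrite ltr0n. Qed.
Let P1 : 1 <= P. Proof. exact: param_ge1. Qed.

(** For a distribution function [F], the [j]-th term is the mass between [branch j x] and
    [branch j 0]; the limit in [N] is the distribution function one step later. *)
Definition pushpart F N x : R := \sum_(j < N) (F (branch P j 0) - F (branch P j x)).

Lemma branch_lt1 j x : 0 < x -> branch P j x < 1.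
Proof.
by move=> x0; rewrite ltr_pdivrMr ?(den_gt0 P1 _ (ltW x0))// mul1r -addrA ltrDl ltr_wpDl.
Qed.

Lemma is_derive_branch j x : 0 <= x ->
  is_derive x 1 (branch P j) (- P / (P + j%:R + x) ^+ 2).
Proof. by move=> x0; apply: is_derive_div_shift; rewrite gt_eqF// den_gt0. Qed.

(** The simplified form of [(P + x) * |branch'| / (P + branch)] for the [j]-th branch: the factor by
    which [(P + s) F'(s)] at [s = branch j x] enters [(P + x)] times the derivative of the pushed
    function. *)
Definition weight j x : R := (P + x) / ((P + j%:R + x) * (P + j.+1%:R + x)).

Lemma pushpart_derive F h A N x : continuous h ->
  (forall x, 0 < x < 1 -> is_derive x 1 F ((A + prim h x) / (P + x))) ->
  0 < x < 1 ->
  is_derive x 1 (pushpart F N)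
    ((\sum_(j < N) (weight j x * (A + prim h (branch P j x)))) / (P + x)).
Proof.
move=> ch FA /andP[x0 x1]; have Px : 0 < P + x by rewrite addr_gt0.
elim: N => [|N IH].
  rewrite big_ord0 mul0r.
  have -> : pushpart F 0 = cst 0 by apply/funext => t; rewrite /pushpart big_ord0.
  exact: is_derive_cst.
have -> : pushpart F N.+1 = (fun t => pushpart F N t + (F (branch P N 0) - F (branch P N t))).
  by apply/funext => t; rewrite /pushpart big_ord_recr.
have s01 : 0 < branch P N x < 1 by rewrite branch_gt0 ?branch_lt1// ltW.
have D1 := @is_derive1_comp _ F _ x _ _ (FA _ s01) (is_derive_branch N (ltW x0)).
have [D V] := is_deriveD IH (is_deriveB (is_derive_cst (F (branch P N 0)) x 1) D1).
split; first exact: D.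
apply: (etrans V); rewrite big_ord_recr /= sub0r [RHS]mulrDl; congr (_ + _).
have z0 := den_gt0 P1 N (ltW x0).
rewrite /weight; set g := A + prim h _; rewrite /branch.
have -> : P + N.+1%:R + x = P + N%:R + x + 1 by rewrite -natr1; ring.
set z := P + N%:R + x in z0 *; have z1 : 0 < z + 1 by rewrite addr_gt0.
have -> : P + P / z = P * (z + 1) / z by field; rewrite gt_eqF.
by field; rewrite !gt_eqF.
Qed.

(** Since [weight j] equals [(j + 1) / (P + j + 1 + x) - j / (P + j + x)], its derivative is
    [acoef j - acoef j.+1]. Summation by parts produces [oppart] and one boundary term at [N]; the
    other one vanishes because [acoef 0 = 0]. *)
Lemma flux_derive h A N x : continuous h -> 0 < x ->
  is_derive x 1 (fun x => \sum_(j < N) (weight j x * (A + prim h (branch P j x))))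
    (- oppart P N h x - acoef P N x * (A + prim h (branch P N x))).
Proof.
move=> ch x0.
elim: N => [|N IH].
  have -> : acoef P 0 x = 0 by rewrite /acoef mul0r.
  rewrite /oppart big_ord0 mul0r subr0 oppr0.
  have -> : (fun x => \sum_(j < 0) (weight j x * (A + prim h (branch P j x)))) = cst 0.
    by apply/funext => t; rewrite big_ord0.
  exact: is_derive_cst.
have -> : (fun x => \sum_(j < N.+1) (weight j x * (A + prim h (branch P j x)))) =
   (fun x => \sum_(j < N) (weight j x * (A + prim h (branch P j x))) +
     weight N x * (A + prim h (branch P N x))).
  by apply/funext => t; rewrite big_ord_recr.
have z0 := den_gt0 P1 N (ltW x0); have z1 := den_gt0 P1 N.+1 (ltW x0).
have lin1 (a : R) : is_derive x 1 (fun t => a + t) 1.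
  by have := is_deriveD (is_derive_cst a x 1) (is_derive_id x 1); rewrite add0r; exact.
have nz : (P + N%:R + x) * (P + N.+1%:R + x) != 0 by rewrite mulf_neq0// gt_eqF.
have DW := is_deriveM (lin1 P)
  (is_deriveV (f := fun t => (P + N%:R + t) * (P + N.+1%:R + t)) nz
    (is_deriveM (lin1 (P + N%:R)) (lin1 (P + N.+1%:R)))).
have Dp := @is_derive1_comp _ (prim h) _ x _ _
  (is_derive_prim ch (branch_gtN1 P1 N (ltW x0))) (is_derive_branch N (ltW x0)).
have [D V] := is_deriveD IH (is_deriveM DW (is_deriveD (is_derive_cst A x 1) Dp)).
split; first exact: D.
apply: (etrans V).
set W := (P + N%:R + x) * (P + N.+1%:R + x).
rewrite -[LHS]/(- oppart P N h x - acoef P N x * (A + prim h (branch P N x)) +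
  (weight N x * (0 + h (branch P N x) * (- P / (P + N%:R + x) ^+ 2)) +
   (A + prim h (branch P N x)) * ((P + x) *
     (- W ^- 2 * ((P + N%:R + x) * 1 + (P + N.+1%:R + x) * 1)) + W^-1 * 1))) /W.
rewrite {2}/oppart big_ord_recr /= -/(oppart P N h x) add0r /opterm /acoef /ccoef /weight.
set g0 := prim h (branch P N x); set g1 := prim h (branch P N.+1 x).
set s := oppart P N h x; set hs := h _.
move: z1; have -> : P + N.+1%:R + x = P + N%:R + x + 1 by rewrite -natr1; ring.
have -> : N.+1%:R = N%:R + 1 :> R by rewrite natr1.
move=> z1; set z := P + N%:R + x in z0 z1 *.
have -> : P + x = z - N%:R by rewrite /z; ring.
by field; rewrite !gt_eqF.
Qed.

Lemma eq_solves h b F G : (forall x, 0 <= x <= 1 -> F x = G x) ->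
  solves p h b F -> solves p h b G.
Proof.
move=> FG [cF F0 F1 [A FA]]; split.
- exact: eq_contI cF.
- by rewrite -FG ?lexx ?ler01.
- by rewrite -FG ?lexx ?ler01.
exists A => x x01; apply: is_derive_near (FA x x01).
have : x \in `]0, 1[ by rewrite in_itv.
move=> /near_in_itvoo; apply: filterS => y; rewrite in_itv /= => /andP[y0 y1].
by apply: FG; rewrite !ltW.
Qed.

Let pushpart0 F N : pushpart F N 0 = 0.
Proof. by rewrite /pushpart big1// => j _; rewrite subrr. Qed.

Let pushpart1 F N : pushpart F N 1 = F 1 - F (P / (P + N%:R)).
Proof.
rewrite /pushpart; elim: N => [|N IH].
  by rewrite big_ord0 addr0 divff ?subrr// gt_eqF.
rewrite big_ord_recr /= IH /branch addr0.
by rewrite -[P + N%:R + 1]addrA natr1; ring.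
Qed.

Let contI_pushpart F N : contI F -> contI (pushpart F N).
Proof.
move=> /contIP cF; apply/contIP; elim: N => [|N IH].
  rewrite (_ : _ \o _ = cst 0); first by move=> x; exact: cvg_cst.
  by apply/funext => x; rewrite /pushpart /= big_ord0.
have -> : pushpart F N.+1 \o clamp = (fun x => (pushpart F N \o clamp) x +
    (F (branch P N 0) - (F \o clamp) ((branch P N \o clamp) x))).
  apply/funext => x; rewrite /pushpart /= big_ord_recr /= (clamp_id (x := branch _ _ _))//.
  have /andP[x0 x1] := clamp_in x.
  by rewrite ltW ?branch_gt0 ?branch_le1.
move=> x; apply: cvgD; first exact: IH.
apply: cvgB; first exact: cvg_cst.
have cb : continuous (branch P N \o clamp).
  by apply: continuous_clamp_comp => t t0; exact: continuous_branch.
exact: (@continuous_comp _ _ _ (branch P N \o clamp) (F \o clamp) x (cb x) (cF _)).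
Qed.

(** Each finite sum, corrected by a multiple of [Phi] to take the value [b] at 1, is compared with
    the solution [G] of the limiting problem. Their difference has zero boundary values and a
    right-hand side of order [1 / (P + N)], so by the maximum principle the finite sums converge to
    [G], which therefore equals [F'] on [0, 1]. *)
Theorem push_solves h b F F' : bcont h -> solves p h b F ->
  (forall x, 0 <= x <= 1 -> (fun N => pushpart F N x) @ \oo --> F' x) ->
  solves p (fun x => - op P h x) b F'.
Proof.
move=> bh Fs FF'; have [ch [B hB]] := bh; have [cF F0 F1 [A FA]] := Fs.
have [cU _] := op_bcont P1 bh.
have cU' : continuous (fun x => - op P h x) by move=> x; apply: cvgN; exact: cU.
have Gs := solution_solves hp b cU'.
set G := solution p _ b in Gs; have [cG G0 G1 [A' GA']] := Gs.
apply: (eq_solves _ Gs) => x xI.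
have B0 : 0 <= B := le_trans (normr_ge0 _) (hB 0).
pose M := `|A| + (`|prim h 0| + B).
have gM t : 0 <= t <= 1 -> `|A + prim h t| <= M.
  move=> /andP[t0 t1]; rewrite /M (le_trans (ler_normD _ _))// lerD2l.
  rewrite -[prim h t](subrK (prim h 0)) addrC (le_trans (ler_normD _ _))// lerD2l.
  apply: le_trans (prim_diff_bound ch _ t0 (fun s _ => hB s)) _; first by rewrite ltrN10.
  by rewrite subr0 ler_piMr.
(* The value missed at 1 by the first [N] branches; it tends to [F 0 = 0]. *)
pose r N := F (P / (P + N%:R)).
have r0 : r @ \oo --> 0.
  rewrite -F0; apply: contI_seq => //; first last.
  - exact: cvg0_div_shift.
  - by rewrite lexx ler01.
  move=> n; have Pn : 0 < P + n%:R by rewrite ltr_wpDr.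
  by rewrite divr_ge0 ?(ltW Pn)//= ler_pdivrMr// mul1r lerDl.
(* [B * (P + 1)] accounts for the tail of the series of [op], and [M] for the boundary term in
   [flux_derive]. *)
pose E := B * (P + 1) + M.
have bound N y : 0 <= y <= 1 ->
    `|pushpart F N y - G y + r N * Phi p y| <= E / (P + N%:R) * (c ^+ 2 * ((P + 1) / 2)).
  move=> yI.
  pose D t := pushpart F N t - G t + r N * Phi p t.
  pose k t := \sum_(j < N) (weight j t * (A + prim h (branch P j t))) -
    (A' + prim (fun x => - op P h x) t) + r N * c^-1.
  pose eta t := - oppart P N h t - acoef P N t * (A + prim h (branch P N t)) + op P h t.
  have PN : 0 < P + N%:R by rewrite ltr_wpDr.
  have cPhi : contI (Phi p : R -> R).
    apply: (@contI_of_derive _ _ (fun t => c^-1 / (P + t))) => t /andP[t0 _].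
    by apply: is_derive_Phi => //; rewrite (lt_le_trans _ t0)// ltrN10.
  have /andP[f0 f1] := Phi_in hp yI.
  have E0 : 0 <= E / (P + N%:R).
    by rewrite divr_ge0 ?(ltW PN)// addr_ge0 ?mulr_ge0 ?addr_ge0 ?normr_ge0.
  have cc : 0 <= c ^+ 2 * ((P + 1) / 2) :> R.
    by rewrite mulr_ge0 ?sqr_ge0// divr_ge0// addr_ge0.
  have : `|D y| <= E / (P + N%:R) * c ^+ 2 * ((P + 1) / 2) * (Phi p y * (1 - Phi p y)).
    apply: (@maximum_principle R p hp D k eta (E / (P + N%:R))) => //.
  - move=> t; apply: cvgD; first by apply: cvgB; [exact: contI_pushpart | exact: cG].
    by apply: cvgM; [exact: cvg_cst | exact: cPhi].
  - by rewrite /D pushpart0 G0 Phi0 mulr0 subrr addr0.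
  - by rewrite /D pushpart1 F1 G1 Phi1// mulr1 -/(r N); ring.
  - move=> t t01; have /andP[t0 _] := t01.
    have t1 : -1 < t by rewrite (lt_trans _ t0)// ltrN10.
    have -> : k t / (P + t) =
      (\sum_(j < N) (weight j t * (A + prim h (branch P j t)))) / (P + t) -
      (A' + prim (fun x => - op P h x) t) / (P + t) + r N * (c^-1 / (P + t)).
      by rewrite /k; ring.
    exact: (is_deriveD (is_deriveB (pushpart_derive N ch FA t01) (GA' t t01))
      (is_deriveZ (r N) (is_derive_Phi hp t1))).
  - move=> t /andP[t0 _]; have t1 : -1 < t by rewrite (lt_trans _ t0)// ltrN10.
    have [Dk V] := is_deriveD (is_deriveB (flux_derive A N ch t0)
      (is_deriveD (is_derive_cst A' t 1) (is_derive_prim cU' t1)))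
      (is_derive_cst (r N * c^-1) t 1).
    split; first exact: Dk.
    by apply: (etrans V); rewrite addr0 add0r opprK.
  - move=> t /andP[t0 t1].
    have tI : 0 <= t <= 1 by rewrite !ltW.
    have -> : eta t = (op P h t - oppart P N h (clamp t)) -
        acoef P N t * (A + prim h (branch P N t)).
      by rewrite clamp_id// /eta; ring.
    apply: (le_trans (ler_normB _ _)); rewrite /E mulrDl lerD//; first exact: op_rate.
    rewrite normrM ger0_norm ?acoef_ge0// mulrC.
    apply: ler_pM; rewrite ?acoef_ge0//.
      by apply: gM; rewrite ltW ?branch_gt0 ?branch_le1// ltW.
    have z0 := den_gt0 P1 N (ltW t0).
    rewrite /acoef ler_pdivrMr ?exprn_gt0// ler_pdivlMl// expr2.
    by apply: ler_pM => //; rewrite ?(ltW PN)//;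
      rewrite ?lerDl ?(ltW t0)// (le_trans _ (_ : P + N%:R <= _)) ?lerDr ?lerDl ?ltW.
  move=> /le_trans; apply; rewrite -(mulrA (E / _)) ler_piMr//.
    by rewrite mulr_ge0.
  by rewrite mulr_ile1// ?subr_ge0// gerBl.
have L1 : (fun N => pushpart F N x - G x + r N * Phi p x) @ \oo --> 0.
  apply: (@cvg_of_rate _ _ (fun N => E * (c ^+ 2 * ((P + 1) / 2)) / (P + N%:R))).
    by move=> N; rewrite subr0 mulrAC; exact: bound.
  exact: cvg0_div_shift.
have L2 : (fun N => pushpart F N x - G x + r N * Phi p x) @ \oo -->
    F' x - G x + 0 * Phi p x.
  apply: cvgD; first by apply: cvgB; [exact: FF' | exact: cvg_cst].
  by apply: cvgM => //; exact: cvg_cst.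
have H : F' x - G x + 0 * Phi p x = 0 by exact: (cvg_unique _ L2 L1).
by move: H; rewrite mul0r addr0 => /subr0_eq.
Qed.

End Transfer.

(** * Distribution functions of the iterates *)

Section GaussMap.
Context {R : realType} (p : nat) (hp : (0 < p)%N).
Local Notation P := (p%:R : R).
Local Notation T := (@gaussT R p).
Implicit Types (x y u : R) (n j : nat).

Let P0 : 0 < P. Proof. by rewrite ltr0n. Qed.
Let P1 : 1 <= P. Proof. exact: param_ge1. Qed.

Lemma gaussT_in u : 0 <= T u <= 1.
Proof.
rewrite /gaussT; case: eqP => _; first by rewrite lexx ler01.
have /andP[f1 f2] := floor_itv (P / u).
move: f2; rewrite intrD /frac_part => f2.
by apply/andP; split; lra.
Qed.

Lemma iter_gaussT_in n y : 0 <= y <= 1 -> 0 <= iter n T y <= 1.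
Proof. by case: n => //= n _; exact: gaussT_in. Qed.

(** With [j = floor (P / u) - p] the condition becomes [P + j <= P / u < P + j + x]. For [x < 1] a
    point [u = branch j x] satisfies [T u = x] but lies outside the half-open intervals; such points
    are excluded and later absorbed in a countable set. *)
Lemma gaussT_le u x : 0 < u <= 1 -> 0 <= x <= 1 -> (forall j, u <> branch P j x) ->
  T u <= x <-> exists j, branch P j x < u <= branch P j 0.
Proof.
move=> /andP[u0 u1] /andP[x0 x1] ux.
have -> : T u = P / u - (Num.floor (P / u))%:~R by rewrite /gaussT gt_eqF.
have /andP[f1 f2] := floor_itv (P / u).
have Pu : P <= P / u by rewrite ler_pdivlMr// ler_piMr// ltW.
split=> [ux'|[j /andP[j1 j2]]].
- have fp : (p%:Z <= Num.floor (P / u))%R by rewrite floor_ge_int.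
  have [j Ej] : exists j : nat, Num.floor (P / u) = (p + j)%:Z.
    exists `|Num.floor (P / u) - p%:Z|%N.
    by rewrite PoszD gez0_abs ?subr_ge0// [RHS]addrC subrK.
  have Ej' : (Num.floor (P / u))%:~R = P + j%:R :> R by rewrite Ej -pmulrn natrD.
  rewrite Ej' in ux' f1; exists j; apply/andP; split.
    rewrite lt_neqAle; apply/andP; split; first by apply/eqP => E; apply: (ux j).
    rewrite /branch ler_pdivrMr ?den_gt0// mulrC -ler_pdivrMr//.
    by rewrite -lerBlDl.
  by rewrite /branch addr0 ler_pdivlMr ?ltr_wpDr// mulrC -ler_pdivlMr.
- have Pj : 0 < P + j%:R by rewrite ltr_wpDr.
  have k1 : P + j%:R <= P / u.
    by move: j2; rewrite /branch addr0 ler_pdivlMr// mulrC -ler_pdivlMr.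
  have k2 : P / u < P + j%:R + x.
    by move: j1; rewrite /branch ltr_pdivrMr ?den_gt0// mulrC -ltr_pdivrMr.
  have -> : Num.floor (P / u) = (p + j)%:Z.
    apply: floor_def; rewrite intrD -!pmulrn natrD k1/=.
    by apply: (lt_le_trans k2); rewrite lerD2l.
  by rewrite -pmulrn natrD; lra.
Qed.

(** A nonzero [y] is recovered from the integer [floor (P / y)] and from [T y], so the preimage of a
    countable set under one step is countable. *)
Lemma countable_gaussT_preim n (C : set R) : countable C ->
  countable [set y | unitI y /\ C (iter n T y)].
Proof.
move=> cC; elim: n => [|n IH].
  by apply: sub_countable cC; apply: subset_card_le => y [].
set D := [set y | _] in IH.
apply: (@sub_countable _ _ _ ([set 0] `|`
    \bigcup_(q in [set: int] `*` D) [set P / (q.1%:~R + q.2)])); last first.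
  rewrite -bigcup2E; apply: bigcup_countable => // -[|[|[|k]]] _ //=.
  by apply: bigcup_countable => //; apply: countableX.
apply: subset_card_le => y [yI]; rewrite iterSr => Cy.
have [->|y0] := eqVneq y 0; first by left.
right; exists (Num.floor (P / y), T y) => /=.
  by split => //; split => //; rewrite unitIE; exact: gaussT_in.
have -> : (Num.floor (P / y))%:~R + T y = P / y.
  by rewrite /gaussT (negbTE y0) /frac_part addrC subrK.
by rewrite invf_div mulrC divfK// gt_eqF.
Qed.

Local Notation A n x := (gaussT_preim p n `[0, x] : set R).

Definition branch_preim n x j : set R := A n (branch P j 0) `\` A n (branch P j x).

Lemma branch_preimE n x j y : branch_preim n x j y <->
  unitI y /\ branch P j x < iter n T y <= branch P j 0.
Proof.
rewrite /branch_preim /gaussT_preim /= !in_itv /=; split.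
- move=> [[yI /andP[t0 t1]] nt]; split=> //; rewrite t1 andbT ltNge.
  by apply/negP => tx; apply: nt; rewrite t0 tx.
- move=> [yI /andP[t0 t1]]; have := yI; rewrite unitIE => /(iter_gaussT_in n)/andP[i0 _].
  by split; [rewrite i0 t1 | rewrite i0 (leNgt _ (branch P j x)) t0 => -[]].
Qed.

Lemma branch_preim_trivIset n x : 0 <= x <= 1 -> trivIset setT (branch_preim n x).
Proof.
move=> /andP[x0 x1]; apply/trivIsetP => i j _ _.
suff H (k l : nat) : (k < l)%N -> branch_preim n x k `&` branch_preim n x l = set0.
  by rewrite neq_ltn => /orP[/H//|/H]; rewrite setIC.
move=> kl; apply/seteqP; split => // y [/branch_preimE[_ /andP[h1 _]]].
move=> /branch_preimE[_ /andP[_ h2]]; move: (lt_le_trans h1 h2).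
apply/negP; rewrite -leNgt /branch ler_pM2l// lef_pV2 ?posrE ?den_gt0//.
rewrite addr0 -addrA lerD2l; apply: le_trans (_ : k.+1%:R <= _); last by rewrite ler_nat.
by rewrite -natr1 lerD2l.
Qed.

(** The points whose [n]-th iterate is 0 or one of the [branch j x], that is, those where
    [gaussT_le] does not apply. Outside this countable set [preimS] decomposes the next preimage
    into branches. *)
Let exceptional n x := [set y : R | unitI y /\
  ([set 0] `|` range (fun j => branch P j x)) (iter n T y)].

Let exceptional_countable n x : countable (exceptional n x).
Proof.
apply: countable_gaussT_preim; rewrite -bigcup2E.
apply: bigcup_countable => // -[|[|[|k]]] _ //=.
exact: (sub_countable (card_image_le _ _) (countableP _)).
Qed.

Let preimS n x : 0 <= x <= 1 ->
  A n.+1 x `\` exceptional n x = \bigcup_j branch_preim n x j `\` exceptional n x.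
Proof.
move=> xI; apply/seteqP; split => y [H1 H2]; split => //.
- have [yI yx] := H1; have := yI; rewrite unitIE => /(iter_gaussT_in n)/andP[i0 i1].
  have [j Hj] : exists j, branch P j x < iter n T y <= branch P j 0.
    apply/gaussT_le => //.
    + rewrite i1 andbT lt_neqAle i0 andbT; apply/eqP => E.
      by apply: H2; split => //; left.
    + by move=> j E; apply: H2; split => //; right; exists j.
    + by move: yx; rewrite /= in_itv /= => /andP[].
  by exists j => //; apply/branch_preimE.
- have [j _ /branch_preimE[yI Hj]] := H1.
  have := yI; rewrite unitIE => /(iter_gaussT_in n)/andP[i0 i1].
  split => //; rewrite /= in_itv /=.
  have /andP[-> _] := gaussT_in (iter n T y).
  apply/gaussT_le => //; last by exists j.
  + rewrite i1 andbT lt_neqAle i0 andbT; apply/eqP => E.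
    by apply: H2; split => //; left.
  + by move=> k E; apply: H2; split => //; right; exists k.
Qed.

Lemma branch_in j x : 0 <= x -> 0 <= branch P j x <= 1.
Proof. by move=> x0; rewrite ltW ?branch_gt0// branch_le1. Qed.

Lemma measurable_countable_set (C : set R) : countable C -> measurable C.
Proof. by apply: countable_measurable => t; exact: measurable_set1. Qed.

(** Induction on [n], for all [x] at once: up to a countable set, the preimage at step [n.+1] is a
    countable union of differences of preimages at step [n]. *)
Lemma gaussT_preim_measurable n x : 0 <= x <= 1 -> measurable (A n x).
Proof.
elim: n x => [|n IH] x xI; first by apply: measurableI; exact: measurable_itv.
rewrite -(setUIDK (A n.+1 x) (exceptional n x)) preimS//; apply: measurableU.
  apply: measurable_countable_set; apply: (sub_countable _ (exceptional_countable n x)).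
  exact: subset_card_le (@subIsetr _ _ _).
apply: measurableD; last exact: measurable_countable_set.
apply: bigcupT_measurable => j; have /andP[x0 _] := xI.
by apply: measurableD; apply: IH; apply: branch_in.
Qed.

Lemma gaussT_preim_unitI n (B : set R) : gaussT_preim p n B `<=` unitI.
Proof. by move=> y []. Qed.

Lemma branch_preim_unitI n x j : branch_preim n x j `<=` unitI.
Proof. by move=> y [[]]. Qed.

Lemma branch_preim_measurable n x j : 0 <= x -> measurable (branch_preim n x j).
Proof.
by move=> x0; apply: measurableD; apply: gaussT_preim_measurable; apply: branch_in.
Qed.

Let mu := @lebesgue_measure R.

Let integrable_unitI (f : R -> R) (B : set R) : continuous f -> measurable B ->
  B `<=` unitI -> mu.-integrable B (EFin \o f).
Proof.
move=> cf mB BI; apply: (@integrableS _ _ _ mu unitI) => //.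
  exact: measurable_itv.
by apply: continuous_compact_integrable; [exact: segment_compact | exact: continuous_subspaceT].
Qed.

Lemma nu_setD_null (f : R -> R) (B Z : set R) : continuous f -> measurable B ->
  B `<=` unitI -> countable Z -> nu f B = nu f (B `\` Z).
Proof.
move=> cf mB BI cZ; rewrite /nu /Rintegral; congr fine.
apply: negligible_integral => //; first exact: measurable_countable_set.
  exact: integrable_unitI.
exact: countable_lebesgue_measure0.
Qed.

Lemma nu_setD (f : R -> R) (B C : set R) : continuous f -> measurable B ->
  measurable C -> B `<=` C -> C `<=` unitI -> nu f (C `\` B) = nu f C - nu f B.
Proof.
move=> cf mB mC BC CI; have mCB := measurableD mC mB.
have E : nu f C = nu f B + nu f (C `\` B).
  rewrite -{1}(setDUK BC) /nu Rintegral_setU//.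
    by rewrite setDUK//; exact: integrable_unitI.
  by apply/disj_setPS => y [? []].
by rewrite E addrC addKr.
Qed.

Let nu_bigcup_ge0 (f : R -> R) (B : nat -> set R) : continuous f ->
  (forall x, 0 <= f x) -> (forall j, measurable (B j)) -> trivIset setT B ->
  \bigcup_j B j `<=` unitI ->
  (fun N => \sum_(j < N) nu f (B j)) @ \oo --> nu f (\bigcup_j B j).
Proof.
move=> cf f0 mB tB BI; have mU : measurable (\bigcup_j B j) by exact: bigcupT_measurable.
have iU : mu.-integrable (\bigcup_j B j) (EFin \o f) by exact: integrable_unitI.
have iB j : mu.-integrable (B j) (EFin \o f).
  by apply: integrable_unitI => //; apply: subset_trans BI; exact: bigcup_sup.
have H : (fun N => (\sum_(0 <= j < N) \int[mu]_(x in B j) (f x)%:E)%E) @ \oo -->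
    (nu f (\bigcup_j B j))%:E.
  rewrite /nu /Rintegral fineK; last exact: integrable_fin_num iU.
  rewrite ge0_integral_bigcup//.
  - by apply: is_cvg_nneseries => n _ _; apply: integral_ge0 => x _; rewrite lee_fin.
  - exact: measurable_int iU.
  - by move=> x _; rewrite lee_fin.
have E : (fun N => \sum_(j < N) nu f (B j)) =
    fine \o (fun N => (\sum_(0 <= j < N) \int[mu]_(x in B j) (f x)%:E)%E).
  apply/funext => N /=; rewrite (eq_bigr (fun j => (nu f (B j))%:E)).
    by rewrite sumEFin big_mkord.
  move=> j _; rewrite /nu /Rintegral fineK//; apply: integrable_fin_num => //.
  exact: mB.
by rewrite E; exact: fine_cvg H.
Qed.

(** The density may change sign, so its bound [K] is added: countable additivity for the nonnegative
    [f + K] and for the constant [K] gives the claim by subtraction. *)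
Lemma nu_bigcup (f : R -> R) (B : nat -> set R) : bcont f ->
  (forall j, measurable (B j)) -> trivIset setT B -> \bigcup_j B j `<=` unitI ->
  (fun N => \sum_(j < N) nu f (B j)) @ \oo --> nu f (\bigcup_j B j).
Proof.
case=> cf [K fK] mB tB BI; pose g x := f x + K.
have K0 : 0 <= K := le_trans (normr_ge0 _) (fK 0).
have cK : continuous (fun _ : R => K) by move=> x; exact: cvg_cst.
have cg : continuous g by move=> x; apply: cvgD; [exact: cf | exact: cvg_cst].
have g0 x : 0 <= g x.
  by have := fK x; rewrite ler_norml /g => /andP[]; lra.
have E (C : set R) : measurable C -> C `<=` unitI ->
    nu f C = nu g C - nu (fun=> K) C.
  move=> mC CI; rewrite -RintegralB//; [|exact: integrable_unitI|exact: integrable_unitI].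
  by apply: eq_Rintegral => x _; rewrite /g addrK.
have mU : measurable (\bigcup_j B j) by exact: bigcupT_measurable.
have BjI j : B j `<=` unitI by apply: subset_trans BI; exact: bigcup_sup.
rewrite E//.
have -> : (fun N => \sum_(j < N) nu f (B j)) =
    (fun N => \sum_(j < N) nu g (B j) - \sum_(j < N) nu (fun=> K) (B j)).
  by apply/funext => N; rewrite -sumrB; apply: eq_bigr => j _; rewrite E.
by apply: cvgB; apply: nu_bigcup_ge0.
Qed.

(** Up to the countable exceptional set, the preimage at step [n.+1] is the disjoint union of the
    sets [branch_preim n x j], and their masses are the terms of [pushpart]. *)
Lemma nu_gaussT_preimS (f : R -> R) n x : bcont f -> 0 <= x <= 1 ->
  (fun N => pushpart p (fun z => nu f (A n z)) N x) @ \oo --> nu f (A n.+1 x).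
Proof.
move=> bf xI; have [cf _] := bf; have /andP[x0 x1] := xI.
have mB j : measurable (branch_preim n x j) by exact: branch_preim_measurable.
have UI : \bigcup_j branch_preim n x j `<=` unitI.
  by move=> y [j _ /branch_preim_unitI].
rewrite (nu_setD_null cf _ _ (exceptional_countable n x)); last 2 first.
- exact: gaussT_preim_measurable.
- exact: gaussT_preim_unitI.
rewrite preimS// -nu_setD_null//; last exact: bigcupT_measurable.
have -> : (fun N => pushpart p (fun z => nu f (A n z)) N x) =
    (fun N => \sum_(j < N) nu f (branch_preim n x j)); last first.
  exact: nu_bigcup (branch_preim_trivIset xI) UI.
apply/funext => N; rewrite /pushpart; apply: eq_bigr => j _.
rewrite nu_setD//.
- by apply: gaussT_preim_measurable; exact: branch_in.
- by apply: gaussT_preim_measurable; exact: branch_in.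
- move=> y [yI]; rewrite /= !in_itv /= => /andP[y0 y1]; split => //=.
  rewrite in_itv /= y0 (le_trans y1)// /branch ler_pM2l// lef_pV2 ?posrE ?den_gt0//.
  by rewrite lerD2l.
- exact: gaussT_preim_unitI.
Qed.

Lemma nu_gaussT_preim0 (f : R -> R) x : continuous f -> 0 <= x <= 1 ->
  nu f (A 0 x) = prim f x - prim f 0.
Proof.
move=> cf /andP[x0 x1].
have int01 a b : mu.-integrable `[a, b] (EFin \o f).
  by apply: continuous_compact_integrable; [exact: segment_compact | exact: continuous_subspaceT].
have -> : A 0 x = `[0, x]%classic.
  apply/seteqP; split => y /=; rewrite /gaussT_preim /unitI /= !in_itv /=; first by case.
  by move=> /andP[y0 yx]; rewrite y0 yx (le_trans yx).
have b1 : (BLeft (-1 : R) <= BRight 0)%O by rewrite bnd_simp lerN10.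
have b2 : (BRight (0 : R) <= BRight x)%O by rewrite bnd_simp.
rewrite /prim (Rintegral_itvB (int01 (-1) x) b1 b2) Rintegral_itv_obnd_cbnd//.
apply: (integrableS _ _ _ (int01 0 x)) => // y /=.
by rewrite !in_itv /= => /andP[/ltW -> ->].
Qed.

Lemma eq_nu (f g : R -> R) (B : set R) : (forall x, 0 <= x <= 1 -> f x = g x) ->
  B `<=` unitI -> nu f B = nu g B.
Proof.
move=> fg BI; apply: eq_Rintegral => x; rewrite inE => /BI.
by rewrite unitIE; exact: fg.
Qed.

End GaussMap.

(** * One-sided derivatives on the unit interval *)

Section RelativeDerivative.
Context {R : realType}.
Implicit Types (f g h : R -> R) (x y d : R).

Definition relder f x d := diff_quotient f x @ within unitI x^' --> d.

Lemma relderP f x d : relder f x d <-> forall e : R, 0 < e ->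
  nbhs x (fun y => y != x -> 0 <= y <= 1 -> `|d - diff_quotient f x y| < e).
Proof.
split=> [/cvgrPdist_lt H e e0|H].
  have {}H : nbhs x (fun y => y != x -> unitI y -> `|d - diff_quotient f x y| < e).
    exact: H.
  by apply: filterS H => y H yx yI; apply: H => //; rewrite unitIE.
apply/cvgrPdist_lt => e e0.
suff : nbhs x (fun y => y != x -> unitI y -> `|d - diff_quotient f x y| < e) by [].
by apply: filterS (H e e0) => y {}H yx; rewrite unitIE; exact: H.
Qed.

(** Every point of [0, 1] is an accumulation point of [0, 1]: a short step towards the middle stays
    inside. This makes limits of difference quotients unique. *)
Lemma within_unitI_proper x : 0 <= x <= 1 -> ProperFilter (within unitI x^').
Proof.
move=> /andP[x0 x1]; split; last exact: within_filter.
move=> H; have {H} : nbhs x (fun y => y != x -> unitI y -> False) by exact: H.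
move=> /nbhs_ballP[e /= e0 be].
pose s := Num.min (e / 2) (1 / 2).
have s0 : 0 < s by rewrite lt_min !divr_gt0.
have se : s < e by rewrite gt_min (_ : e / 2 < e) ?ltr_pdivrMr//; lra.
have s1 : s <= 1 / 2 by rewrite ge_min lexx orbT.
have key y : `|x - y| = s -> 0 <= y <= 1 -> False.
  move=> xy yI; apply: (be y); rewrite ?unitIE//.
    by rewrite -ball_normE /= xy.
  by apply/eqP => E; move: xy s0; rewrite E subrr normr0 => <-; rewrite ltxx.
have [x2|x2] := leP x (1 / 2).
- apply: (key (x + s)); first by rewrite opprD addNKr normrN gtr0_norm.
  by apply/andP; split; lra.
- apply: (key (x - s)); first by rewrite opprB addrC subrK gtr0_norm.
  by apply/andP; split; lra.
Qed.

Lemma relder_derivI f x d : 0 <= x <= 1 -> relder f x d ->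
  derivableI f x /\ derivI f x = d.
Proof.
move=> xI fd; have PF := within_unitI_proper xI.
by split; [exact: cvgP fd | exact: cvg_lim fd].
Qed.

Lemma derivableI_relder f x : derivableI f x -> relder f x (derivI f x).
Proof. by []. Qed.

Lemma eq_relder f g x d : (forall x, 0 <= x <= 1 -> f x = g x) -> 0 <= x <= 1 ->
  relder f x d -> relder g x d.
Proof.
move=> fg xI /relderP H; apply/relderP => e e0; apply: filterS (H e e0) => y {}H yx yI.
by have := H yx yI; rewrite /diff_quotient !fg.
Qed.

Lemma is_derive_relder f x d : is_derive x 1 f d -> relder f x d.
Proof.
move=> /is_derive1_caratheodory[g [fg cg gx]]; apply/relderP => e e0.
have /cvgrPdist_lt /(_ e e0) := cg; rewrite gx; apply: filterS => y ge yx _.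
by rewrite /diff_quotient fg mulfK// subr_eq0.
Qed.

Lemma relder_is_derive f x d : 0 < x < 1 -> relder f x d -> is_derive x 1 f d.
Proof.
move=> x01 /relderP H; apply/is_derive1_caratheodory.
exists (fun y => if y == x then d else diff_quotient f x y); split.
- move=> y; case: eqP => [->|/eqP yx]; first by rewrite !subrr mulr0.
  by rewrite /diff_quotient divfK// subr_eq0.
- apply/cvgrPdist_lt => e e0; rewrite eqxx.
  have : x \in `]0, 1[ by rewrite in_itv.
  move=> /near_in_itvoo xI; near=> y; case: eqP => [_|/eqP yx].
    by rewrite subrr normr0.
  have : y \in `]0, 1[ by near: y.
  rewrite in_itv /= => /andP[y0 y1].
  have : y != x -> 0 <= y <= 1 -> `|d - diff_quotient f x y| < e by near: y; exact: H.
  by apply => //; rewrite !ltW.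
- by rewrite eqxx.
Unshelve. all: by end_near. Qed.

Lemma derivableI_contI f : (forall x, unitI x -> derivableI f x) -> contI f.
Proof.
move=> fd; apply/subspace_continuousP => x xI; have /relderP H := fd x xI.
apply/cvgrPdist_lt => e e0.
suff : nbhs x (fun y => unitI y -> `|f x - f y| < e) by [].
set d := lim _ in H.
have K0 : 0 < `|d| + 1 by rewrite ltr_wpDl.
have B : nbhs x (fun y => `|x - y| < e / (`|d| + 1)).
  have := @cvg_id _ (nbhs x); move=> /cvgrPdist_lt; apply.
  by rewrite divr_gt0.
apply: filterS2 (H 1 ltr01) B => y Hy By; rewrite unitIE => yI.
have [->|yx] := eqVneq y x; first by rewrite subrr normr0.
have := Hy yx yI; set q := diff_quotient f x y => dq.
have -> : f x - f y = q * (x - y).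
  rewrite /q /diff_quotient -[x - y]opprB mulrN divfK ?opprB// subr_eq0//.
rewrite normrM; apply: le_lt_trans (_ : (`|d| + 1) * `|x - y| < _); last first.
  by rewrite mulrC -ltr_pdivlMr.
apply: ler_wpM2r => //.
have -> : q = d - (d - q) by rewrite subKr.
by apply: (le_trans (ler_normB _ _)); rewrite lerD2l ltW.
Qed.

Lemma is_derive_derivI f (df : R -> R) x :
  (forall x, 0 <= x <= 1 -> is_derive x 1 f (df x)) -> 0 <= x <= 1 ->
  derivableI f x /\ derivI f x = df x.
Proof. by move=> fd xI; apply: relder_derivI => //; apply/is_derive_relder/fd. Qed.

Lemma C1I_intro f g (dg : R -> R) : (forall x, 0 <= x <= 1 -> f x = g x) ->
  (forall x, 0 <= x <= 1 -> is_derive x 1 g (dg x)) -> contI dg -> C1I f.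
Proof.
move=> fg gd cd.
have fd x : 0 <= x <= 1 -> derivableI f x /\ derivI f x = dg x.
  move=> xI; apply: relder_derivI => //; apply: (@eq_relder g) => //.
    by move=> t tI; rewrite fg.
  exact/is_derive_relder/gd.
split; first by move=> x; rewrite unitIE => /fd[].
by apply: (@eq_contI _ dg) => // x /fd[].
Qed.

Lemma C2I_intro f g h : (forall x, 0 <= x <= 1 -> is_derive x 1 f (g x)) ->
  (forall x, 0 <= x <= 1 -> is_derive x 1 g (h x)) -> contI h -> C2I f.
Proof.
move=> fd gd ch; split; first by move=> x; rewrite unitIE => /(is_derive_derivI fd)[].
by apply: (@C1I_intro _ g h) => // x /(is_derive_derivI fd)[].
Qed.

Lemma contI_bounded f : contI f -> exists B, forall x, 0 <= x <= 1 -> `|f x| <= B.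
Proof.
move=> cf; have cn : contI (fun x => `|f x|) by move=> x; apply: cvg_norm; exact: cf.
have [c _ cM] := EVT_max ler01 cn.
by exists `|f c| => x xI; apply: cM; rewrite in_itv.
Qed.

Lemma contI_bcont f : contI f -> bcont (f \o clamp).
Proof.
move=> cf; split; first exact/contIP.
by have [B fB] := contI_bounded cf; exists B => x; apply: fB; exact: clamp_in.
Qed.

Lemma eq_image_unitI f g : (forall x, 0 <= x <= 1 -> f x = g x) ->
  f @` unitI = g @` unitI.
Proof.
move=> fg; apply/seteqP; split => _ [x xI <-]; exists x => //.
  by rewrite fg// -unitIE.
by rewrite -fg// -unitIE.
Qed.

Lemma normI_ge f x : contI f -> 0 <= x <= 1 -> `|f x| <= normI f.
Proof.
move=> cf xI; have [B fB] := contI_bounded cf; apply: ub_le_sup.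
  by exists B => _ [y yI <-]; apply: fB; rewrite -unitIE.
by exists x => //; rewrite unitIE.
Qed.

Lemma inf_sup_unitI f x : contI f -> 0 <= x <= 1 ->
  inf (f @` unitI) <= f x <= sup (f @` unitI).
Proof.
move=> cf xI; have [B fB] := contI_bounded cf.
have fB' y : unitI y -> - B <= f y <= B by rewrite unitIE -ler_norml; exact: fB.
have fx : (f @` unitI) (f x) by exists x => //; rewrite unitIE.
apply/andP; split.
- by apply: ge_inf => //; exists (- B) => _ [y /fB'/andP[] ? _ <-].
- by apply: ub_le_sup => //; exists B => _ [y /fB'/andP[_ ?] <-].
Qed.

End RelativeDerivative.

(** * Convergence to the invariant distribution *)

Section Convergence.
Context {R : realType} (p : nat) (hp : (0 < p)%N).
Local Notation P := (p%:R : R).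
Local Notation c := (log_const p : R).
Local Notation F f n x := (nu f (gaussT_preim p n `[0, x])).

Let P0 : 0 < P. Proof. by rewrite ltr0n. Qed.
Let P1 : 1 <= P. Proof. exact: param_ge1. Qed.

Let opZ a (h : R -> R) : bcont h -> op P (fun x => a * h x) = (fun x => a * op P h x).
Proof.
move=> bh; have -> : (fun x => a * h x) = (fun x => (a - 1) * h x + h x).
  by apply/funext => x; ring.
by rewrite opL//; apply/funext => x; ring.
Qed.

Let bcontZ a (h : R -> R) : bcont h -> bcont (fun x => a * h x).
Proof.
move=> bh; have -> : (fun x => a * h x) = (fun x => (a - 1) * h x + h x).
  by apply/funext => x; ring.
exact: bcontL.
Qed.

Lemma iter_op_bcont n (h : R -> R) : bcont h -> bcont (iter n (op P) h).
Proof. by move=> bh; elim: n => //= n IH; exact: op_bcont. Qed.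

Lemma C1I_weighted (f : R -> R) : C1I f ->
  let g := fun x => (P + x) * f x in
  [/\ contI f, (forall x, 0 <= x <= 1 -> derivableI g x) & contI (derivI g)].
Proof.
move=> [fd cd] g; have cf := derivableI_contI fd.
have clin : contI (fun x : R => P + x).
  apply: continuous_subspaceT => x.
  by apply: cvgD; [exact: cvg_cst | exact: cvg_id].
have gd (x : R) : 0 <= x <= 1 -> derivableI g x /\ derivI g x = f x + (P + x) * derivI f x.
  move=> xI; apply: relder_derivI => //.
  have fx : relder f x (derivI f x) by apply: fd; rewrite unitIE.
  have cfx : f y @[y --> within unitI x^'] --> f x.
    have Ix : unitI x by rewrite unitIE.
    have /cvgrPdist_lt cfx := (subspace_continuousP unitI f).1 cf x Ix.
    apply/cvgrPdist_lt => e e0.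
    have H : nbhs x (fun y => unitI y -> `|f x - f y| < e) := cfx e e0.
    suff : nbhs x (fun y => y != x -> unitI y -> `|f x - f y| < e) by [].
    by apply: filterS H => y H yx; exact: H.
  (* Product rule in the form [g y - g x = (y - x) * f y + (P + x) * (f y - f x)], which is why the
     continuity [cfx] of [f] at [x] enters. *)
  have H : f y + (P + x) * diff_quotient f x y @[y --> within unitI x^'] -->
      f x + (P + x) * derivI f x.
    by apply: cvgD => //; apply: cvgM => //; exact: cvg_cst.
  apply: cvg_trans H. apply: near_eq_cvg.
  suff : nbhs x (fun y => y != x -> unitI y ->
    f y + (P + x) * diff_quotient f x y = diff_quotient g x y) by [].
  apply: (@filterE _ (nbhs x)) => y yx _; rewrite /diff_quotient /g.
  by field; rewrite subr_eq0.
split => //; first by move=> x /gd[].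
apply: (@eq_contI _ (fun x => f x + (P + x) * derivI f x)).
  by move=> x /gd[].
by move=> x; apply: cvgD; [exact: cf | apply: cvgM; [exact: clin | exact: cd]].
Qed.

(** On [0, 1] the derivative of the initial distribution function is [f = g / (P + x)], and [g] is
    its value at 0 plus the integral of its derivative: [g - prim h] is continuous on [0, 1] with
    zero derivative inside. *)
Lemma solves_initial (f : R -> R) : C1I f -> nu f unitI = 1 ->
  solves p (derivI (fun x => (P + x) * f x) \o clamp) 1 (fun x => F f 0 x).
Proof.
move=> Cf f1; have [cf gd cdg] := C1I_weighted Cf.
set g := fun x => (P + x) * f x in gd cdg *.
set h := derivI g \o clamp; have [ch _] : bcont h := contI_bcont cdg.
have [cfc _] : bcont (f \o clamp) := contI_bcont cf.
have cg : contI g by apply: derivableI_contI => x; rewrite unitIE; exact: gd.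
have N1 (x : R) : 0 <= x -> -1 < x by apply: lt_le_trans; rewrite ltrN10.
have FE (x : R) : 0 <= x <= 1 -> prim (f \o clamp) x - prim (f \o clamp) 0 = F f 0 x.
  move=> xI; rewrite -(nu_gaussT_preim0 p)//.
  by apply: eq_nu => [t tI|]; [rewrite /= clamp_id | exact: gaussT_preim_unitI].
have hD (x : R) : 0 <= x -> is_derive x 1 (prim h) (h x).
  by move=> x0; exact: is_derive_prim (N1 x x0).
have gE (x : R) : 0 <= x <= 1 -> g x = g 0 - prim h 0 + prim h x.
  move=> /andP[x0 x1].
  have D t : t \in `]0, x[ -> is_derive t 1 (g \- prim h) 0.
    rewrite in_itv /= => /andP[t0 tx].
    have tI : 0 < t < 1 by rewrite t0 (lt_le_trans tx).
    have tI' : 0 <= t <= 1 by rewrite ltW//= (le_trans (ltW tx)).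
    have Dg : is_derive t 1 g (h t).
      rewrite /h /= clamp_id//; apply: relder_is_derive => //.
      exact/derivableI_relder/gd.
    by have := is_deriveB Dg (hD t (ltW t0)); rewrite subrr; exact.
  have W : {within `[0, x], continuous (g \- prim h)}.
    have cph : contI (prim h).
      by apply: (@contI_of_derive _ _ h) => t /andP[t0 _]; exact: hD.
    have W1 : contI (g \- prim h) by move=> t; apply: cvgB; [exact: cg | exact: cph].
    apply: continuous_subspaceW W1 => t; rewrite unitIE /= in_itv /=.
    by move=> /andP[t0 tx]; rewrite t0 (le_trans tx).
  have [s _] := MVT_segment x0 D W.
  by rewrite mul0r /= => E; lra.
apply: (eq_solves FE); split.
- apply: (@contI_of_derive _ _ (f \o clamp)) => x /andP[x0 _].
  have := is_deriveB (is_derive_prim cfc (N1 x x0)) (is_derive_cst (prim (f \o clamp) 0) x 1).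
  by rewrite subr0; exact.
- by rewrite subrr.
- rewrite FE ?lexx ?ler01//; apply: etrans f1; congr (nu f _); apply/seteqP.
  by split => [y []|y yI] //; split.
exists (g 0 - prim h 0) => x x01; have /andP[x0 x1] := x01.
have xI : 0 <= x <= 1 by rewrite !ltW.
rewrite -gE// /g mulrC mulKf; last by rewrite gt_eqF// addr_gt0.
have := is_deriveB (is_derive_prim cfc (N1 x (ltW x0))) (is_derive_cst (prim (f \o clamp) 0) x 1).
by rewrite subr0 /= clamp_id//; exact.
Qed.

Lemma solves_iter (f : R -> R) n : C1I f -> nu f unitI = 1 ->
  let h := derivI (fun x => (P + x) * f x) \o clamp in
  solves p (fun x => (-1) ^+ n * iter n (op P) h x) 1 (fun x => F f n x).
Proof.
move=> Cf f1 h; have [cf gd cdg] := C1I_weighted Cf.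
have bh : bcont h := contI_bcont cdg.
elim: n => [|n IH].
  have -> : (fun x => (-1) ^+ 0 * iter 0 (op P) h x) = h.
    by apply/funext => x; rewrite expr0 mul1r.
  exact: solves_initial.
have bn : bcont (fun x => (-1) ^+ n * iter n (op P) h x).
  by apply: bcontZ; exact: iter_op_bcont.
have -> : (fun x => (-1) ^+ n.+1 * iter n.+1 (op P) h x) =
    (fun x => - op P (fun x => (-1) ^+ n * iter n (op P) h x) x).
  rewrite opZ; last exact: iter_op_bcont.
  by apply/funext => x; rewrite exprS mulN1r mulNr.
apply: push_solves bn IH _ => // x xI.
have bfc : bcont (f \o clamp) := contI_bcont cf.
have E m (z : R) : F f m z = F (f \o clamp) m z.
  by apply: eq_nu => [t tI|]; [rewrite /= clamp_id | exact: gaussT_preim_unitI].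
have := nu_gaussT_preimS hp (n := n) bfc xI; rewrite -E.
have -> : (fun z => F (f \o clamp) n z) = (fun z => F f n z) by apply/funext => z; rewrite E.
exact.
Qed.

(** The difference vanishes at 0 and at 1 and solves the boundary value problem with right-hand side
    [(-1) ^+ n * U^n h - a * psi]; [Phi] only contributes the constant [c^-1] to the flux. *)
Lemma error_bound (f psi : R -> R) n a e : C1I f -> nu f unitI = 1 -> continuous psi ->
  (forall x, `|(-1) ^+ n * iter n (op P) (derivI (fun x => (P + x) * f x) \o clamp) x -
     a * psi x| <= e) ->
  forall x, 0 <= x <= 1 ->
  `|F f n x - Phi p x - a * solution p psi 0 x| <=
    e * c ^+ 2 * ((P + 1) / 2) * (Phi p x * (1 - Phi p x)).
Proof.
move=> Cf f1 cpsi he; have [_ _ cdg] := C1I_weighted Cf.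
set h := _ \o clamp in he; have bh : bcont h := contI_bcont cdg.
have [ck _] : bcont (fun x => (-1) ^+ n * iter n (op P) h x).
  by apply: bcontZ; exact: iter_op_bcont.
set k := fun x => (-1) ^+ n * _ in ck.
have [cF F0 F1 [A FA]] := solves_iter n Cf f1.
have [cS S0 S1 [B SB]] := solution_solves hp 0 cpsi.
have N1 (x : R) : 0 <= x -> -1 < x by apply: lt_le_trans; rewrite ltrN10.
have cPhi : contI (Phi p : R -> R).
  apply: (@contI_of_derive _ _ (fun t => c^-1 / (P + t))) => t /andP[t0 _].
  by apply: is_derive_Phi => //; exact: N1.
apply: (@maximum_principle _ p hp _
  (fun x => (A + prim k x) - c^-1 - a * (B + prim psi x)) (fun x => k x - a * psi x)) => //.
- move=> x; apply: cvgB; first by apply: cvgB; [exact: cF | exact: cPhi].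
  by apply: cvgM; [exact: cvg_cst | exact: cS].
- by rewrite F0 S0 Phi0 mulr0 !subr0.
- by rewrite F1 S1 Phi1// mulr0 subr0 subrr.
- move=> x x01; have /andP[x0 _] := x01.
  have -> : (A + prim k x - c^-1 - a * (B + prim psi x)) / (P + x) =
    (A + prim k x) / (P + x) - c^-1 / (P + x) - a * ((B + prim psi x) / (P + x)) by ring.
  exact: (is_deriveB (is_deriveB (FA x x01) (is_derive_Phi hp (N1 x (ltW x0))))
    (is_deriveZ a (SB x x01))).
- move=> x /andP[x0 _]; have x1 := N1 x (ltW x0).
  have [D V] := is_deriveB (is_deriveB (is_deriveD (is_derive_cst A x 1) (is_derive_prim ck x1))
    (is_derive_cst (c^-1) x 1))
    (is_deriveZ a (is_deriveD (is_derive_cst B x 1) (is_derive_prim cpsi x1))).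
  by split; [exact: D | apply: (etrans V); rewrite !add0r subr0].
- by move=> x _; exact: he.
Qed.

(** The slope of [Phi] on [0, 1] is at most [(c * P)^-1], so this factor times [x] bounds [Phi x],
    and the same factor times [1 - x] bounds [1 - Phi x]. *)
Lemma Phi_parabola x : 0 <= x <= 1 ->
  Phi p x * (1 - Phi p x) <= (c * P) ^- 2 * (x * (1 - x)).
Proof.
move=> xI; have /andP[x0 x1] := xI; have c0 := log_const_gt0 hp : 0 < c.
have cP : 0 < c * P by rewrite mulr_gt0.
have slope (u v : R) : 0 <= u -> u <= v -> Phi p v - Phi p u <= (c * P)^-1 * (v - u).
  move=> u0 uv.
  have D (t : R) : u <= t -> is_derive t 1 (Phi p) (c^-1 / (P + t)).
    by move=> ut; apply: is_derive_Phi => //; rewrite (lt_le_trans _ ut)// (lt_le_trans _ u0)// ltrN10.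
  have D' t : t \in `]u, v[ -> is_derive t 1 (Phi p) (c^-1 / (P + t)).
    by rewrite in_itv /= => /andP[/ltW ut _]; exact: D.
  have W : {within `[u, v], continuous (Phi p : R -> R)}.
    by apply: (@is_derive_within _ _ (fun t => c^-1 / (P + t))) => t /andP[ut _]; exact: D.
  have [s] := MVT_segment uv D' W; rewrite in_itv /= => /andP[us _] ->.
  rewrite ler_wpM2r ?subr_ge0// invfM ler_wpM2l ?invr_ge0 ?(ltW c0)//.
  have s0 := le_trans u0 us.
  by rewrite lef_pV2 ?posrE ?ltr_wpDr// lerDl.
have /andP[f0 f1] := Phi_in hp xI.
have H1 := slope 0 x (lexx 0) x0; have H2 := slope x 1 x0 x1.
rewrite Phi0 !subr0 in H1; rewrite Phi1// in H2.
have -> : (c * P) ^- 2 * (x * (1 - x)) =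
  ((c * P)^-1 * x) * ((c * P)^-1 * (1 - x)) by rewrite -exprVn; ring.
by apply: ler_pM => //; rewrite subr_ge0.
Qed.

Lemma solution_C2I (psi : R -> R) a : continuous psi ->
  C2I (fun x => a * solution p psi 0 x) /\
  forall x, 0 <= x <= 1 ->
    derivI (fun x => (P + x) * derivI (solution p psi 0) x) x = psi x.
Proof.
move=> cpsi; have [A SA] := is_derive_solution hp 0 cpsi.
have N1 (x : R) : 0 <= x -> -1 < x by apply: lt_le_trans; rewrite ltrN10.
have Px (x : R) : 0 <= x -> 0 < P + x by move=> x0; rewrite ltr_wpDr.
have GD (x : R) : 0 <= x <= 1 -> is_derive x 1 (fun t => A + prim psi t) (psi x).
  move=> /andP[x0 _].
  by have := is_deriveD (is_derive_cst A x 1) (is_derive_prim cpsi (N1 x x0)); rewrite add0r; exact.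
split; last first.
  move=> x xI; apply: (relder_derivI xI _).2.
  apply: (@eq_relder _ (fun t => A + prim psi t)) => //; last exact/is_derive_relder/GD.
  move=> t tI; have /andP[t0 _] := tI.
  rewrite (is_derive_derivI SA tI).2 mulrC divfK// gt_eqF//; exact: Px.
pose G x := a * ((A + prim psi x) / (P + x)).
pose H x := a * (psi x / (P + x) - (A + prim psi x) / (P + x) ^+ 2).
apply: (@C2I_intro _ _ G H).
- by move=> x xI; exact: (is_deriveZ a (SA x xI)).
- move=> x xI; have /andP[x0 _] := xI; have Pxx := Px x x0.
  have lin1 : is_derive x 1 (fun t => P + t) 1.
    by have := is_deriveD (is_derive_cst P x 1) (is_derive_id x 1); rewrite add0r; exact.
  have [D V] := is_deriveZ a (is_deriveM (GD x xI) (is_deriveV (lt0r_neq0 Pxx) lin1)).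
  split; first exact: D.
  apply: (etrans V); rewrite /H /GRing.scale /=.
  by field; rewrite gt_eqF.
- apply/contIP; apply: continuous_clamp_comp => x x0; have Pxx := lt0r_neq0 (Px x x0).
  have clin : {for x, continuous (fun t => P + t)}.
    by apply: cvgD; [exact: cvg_cst | exact: cvg_id].
  apply: cvgM; first exact: cvg_cst.
  apply: cvgB.
    by apply: cvgM; [exact: cpsi | apply: cvgV; [exact: Pxx | exact: clin]].
  apply: cvgM.
    by apply: cvgD; [exact: cvg_cst | exact: (is_derive_cont (is_derive_prim cpsi (N1 x x0)))].
  apply: cvgV; first by rewrite expf_neq0.
  apply: (@continuous_comp _ _ _ (fun t => P + t) (fun u => u ^+ 2)) => //.
  exact: exprn_continuous.
Qed.

End Convergence.

(** * From the spectral decomposition to the error terms *)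

Theorem theorem1p3 (R : realType) (p : nat) (hp : (0 < p)%N) :
  exists (lambda tau : R) (Psi : R -> R) (L : (R -> R) -> R),
    let psi := derivI (fun x => (p%:R + x) * derivI Psi x) in
    [/\ [/\ 0 < tau < lambda,
            v_ p < lambda < w_ p &
            exists Theta : R -> R,
              [/\ C2I Theta, Theta 0 = 0, Theta 1 = 0 &
                  exists K : R, forall (x : R) (n : nat), unitI x ->
                    `|omega (gaussT_preim p n `[0, x]) - Phi p x
                      - (- lambda) ^+ n * Theta x|
                    <= K * (x * (1 - x) * tau ^+ n)]],
        [/\ C2I Psi, Psi 0 = 0, Psi 1 = 0 & forall x, unitI x -> 0 < psi x],
        positive_bounded_linear_functional L &
        forall f0 : R -> R, C1I f0 -> nu f0 unitI = 1 ->
          let g0 := fun x => (p%:R + x) * f0 x in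
          forall (n : nat) (x : R), unitI x ->
            `|nu f0 (gaussT_preim p n `[0, x]) - Phi p x
              - (- lambda) ^+ n * L (derivI g0) * Psi x|
            <= tau ^+ n * log_const p ^+ 2 * ((p%:R + 1) / 2)
               * normI psi * osc (fun y => derivI g0 y / psi y)
               * Phi p x * (1 - Phi p x)].
Proof.
have P1 : 1 <= p%:R :> R := param_ge1 hp.
have P0 : 0 < p%:R :> R by exact: lt_le_trans P1.
have c0 : 0 < log_const p :> R := log_const_gt0 hp.
have [lam [t [psi [L [[/andP[t0 t1] bpsi psiC psiE] vw LL LP]]]]] := op_spectrum P1.
have lam0 : 0 < lam.
  by case/andP: vw => + _; apply: lt_trans; rewrite divr_gt0// mulr_gt0.
have psi0 x : 0 < psi x by apply: lt_le_trans (psiC x); rewrite invr_gt0 exprn_gt0.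
(* The eigenfunction is a multiple of [op psi], which depends on its argument through [clamp]
   alone. *)
have psi_clamp x : psi (clamp x) = psi x.
  by apply: (mulfI (lt0r_neq0 lam0)); rewrite -!psiE op_clamp.
have [cpsi _] := bpsi; have cIpsi : contI psi by exact: continuous_subspaceT.
pose Psi := solution p psi 0.
have [C2Psi psiI] := solution_C2I hp 1 cpsi.
have [_ Psi0 Psi1 _] : solves p psi 0 Psi := solution_solves hp 0 cpsi.
have psi_le x : psi x <= normI psi.
  rewrite -psi_clamp; apply: le_trans (ler_norm _) (normI_ge cIpsi (clamp_in x)).
pose L' f := L (f \o clamp).
have cq (f : R -> R) : contI f -> contI (fun y => f y / psi y).
  move=> cf x; apply: cvgM; first exact: cf.
  by apply: cvgV; [rewrite gt_eqF | exact: cIpsi].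
have main (f : R -> R) n x : C1I f -> nu f unitI = 1 -> 0 <= x <= 1 ->
    forall g, g = (fun x => (p%:R + x) * f x) ->
    `|nu f (gaussT_preim p n `[0, x]) - Phi p x - (- lam) ^+ n * L' (derivI g) * Psi x|
    <= (lam * t) ^+ n * log_const p ^+ 2 * ((p%:R + 1) / 2)
       * normI psi * osc (fun y => derivI g y / psi y) * Phi p x * (1 - Phi p x).
  move=> Cf f1 xI g gE; have [_ _ cdg] := C1I_weighted p Cf.
  have bh := contI_bcont cdg; rewrite -gE in cdg bh.
  set q := fun y => derivI g y / psi y.
  (* With the extreme values of [q] as bracket, [b - a] is the oscillation of [g' / psi]. *)
  pose a := inf (q @` unitI); pose b := sup (q @` unitI).
  have hab y : a * psi y <= (derivI g \o clamp) y <= b * psi y.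
    have := inf_sup_unitI (cq _ cdg) (clamp_in y); rewrite psi_clamp -/q -/a -/b.
    by rewrite ler_pdivlMr// ler_pdivrMr.
  have [_ H] := LP _ a b bh hab.
  have ab : 0 <= b - a.
    have /andP[qa qb] := inf_sup_unitI (cq _ cdg) (clamp_in 0).
    by rewrite subr_ge0 (le_trans qa qb).
  have he y : `|(-1) ^+ n * iter n (op p%:R) (derivI g \o clamp) y -
      (- lam) ^+ n * L' (derivI g) * psi y| <= t ^+ n * (b - a) * (lam ^+ n * normI psi).
    rewrite (exprNn lam) -!mulrA -mulrBr normrM normrX normrN1 expr1n mul1r !mulrA.
    apply: (le_trans (H n y)); rewrite -!mulrA; apply: ler_wpM2l.
      by rewrite exprn_ge0// ltW.
    by rewrite ler_wpM2l// ler_wpM2l// exprn_ge0// ltW.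
  have eb := error_bound hp (n := n) Cf f1 cpsi; rewrite -gE in eb.
  apply: (le_trans (eb _ _ he _ xI)).
  by rewrite le_eqVlt /osc -/q -/a -/b; apply/orP; left; apply/eqP; rewrite exprMn; ring.
(* The [psi'] of the statement is a relative derivative and is known to agree with [psi] on [0, 1];
   norm and oscillation depend on these values alone. *)
have normI_eq (psi' : R -> R) : (forall x, 0 <= x <= 1 -> psi' x = psi x) ->
    normI psi' = normI psi /\ forall f : R -> R,
    osc (fun y => f y / psi' y) = osc (fun y => f y / psi y).
  move=> E; split; last first.
    by move=> f; rewrite /osc (@eq_image_unitI _ _ (fun y => f y / psi y))// => x /E ->.
  by rewrite /normI (@eq_image_unitI _ _ (fun y => `|psi y|))// => x /E ->.
exists lam, (lam * t), Psi, L'; move=> psi'.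
have psi'E x : 0 <= x <= 1 -> psi' x = psi x by exact: psiI.
have [normE oscE] := normI_eq _ psi'E.
split.
- split => //.
    by rewrite mulr_gt0//= gtr_pMr.
  have C1 : C1I (fun=> 1 : R).
    apply: (@C1I_intro _ _ (fun=> 1) (fun=> 0)) => //.
    by apply: continuous_subspaceT => x; exact: cvg_cst.
  have nu_omega (A : set R) : measurable A -> nu (fun=> 1) A = omega A.
    by move=> mA; rewrite /nu Rintegral_cst// mul1r.
  have nu1 : nu (fun=> 1 : R) unitI = 1.
    rewrite nu_omega; last exact: measurable_itv.
    by rewrite /omega lebesgue_measure_itv /= lte_fin ltr01 -EFinB subr0.
  (* The coefficient belonging to the density 1, for which [nu] is Lebesgue measure; [Theta] is
     [l * Psi]. *)
  set l := L' (derivI (fun x => (p%:R + x) * 1)).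
  exists (fun x => l * Psi x); split.
  + by have [] := solution_C2I hp l cpsi.
  + by rewrite Psi0 mulr0.
  + by rewrite Psi1 mulr0.
  set o := osc (fun y => derivI (fun x => (p%:R + x) * 1) y / psi y).
  exists (log_const p ^+ 2 * ((p%:R + 1) / 2) * normI psi * o * (log_const p * p%:R) ^- 2).
  move=> x n; rewrite unitIE => xI; rewrite -nu_omega; last exact: gaussT_preim_measurable.
  rewrite (mulrA _ l).
  have := main (fun=> 1) n x C1 nu1 xI _ erefl; rewrite -/l -/o => /le_trans; apply.
  have o0 : 0 <= o.
    have [_ _ cdg] := C1I_weighted p C1.
    have /andP[qa qb] := inf_sup_unitI (cq _ cdg) (clamp_in 0).
    by rewrite subr_ge0 (le_trans qa qb).
  have N0 : 0 <= normI psi by exact: le_trans (ltW (psi0 0)) (psi_le 0).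
  have K0 : 0 <= (lam * t) ^+ n * (log_const p ^+ 2 * ((p%:R + 1) / 2) * normI psi * o).
    have lt0 : 0 <= lam * t by rewrite ltW// mulr_gt0.
    have p0 : 0 <= (p%:R + 1) / 2 :> R by rewrite divr_ge0// addr_ge0.
    exact: mulr_ge0 (exprn_ge0 n lt0) (mulr_ge0 (mulr_ge0 (mulr_ge0 (sqr_ge0 _) p0) N0) o0).
  have := ler_wpM2l K0 (Phi_parabola hp xI).
  by rewrite !mulrA; move=> /le_trans; apply; rewrite le_eqVlt; apply/orP; left; apply/eqP; ring.
- split => //.
    by have -> : Psi = (fun x => 1 * solution p psi 0 x) by apply/funext => x; rewrite mul1r.
  by move=> x; rewrite unitIE => /psi'E ->.
(* From [psi >= 2 ^- 10] it follows that [|f| <= B] implies [|f| <= 2 ^+ 10 * B * psi], a bracket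
   for [f] that bounds the functional. *)
- have L'_le (f : R -> R) B : contI f -> 0 <= B ->
      (forall x, 0 <= x <= 1 -> `|f x| <= B) -> `|L' f| <= 2 ^+ 10 * B.
    move=> cf B0 fB; rewrite mulrC.
    have BC x : B <= B * 2 ^+ 10 * psi x.
      rewrite -mulrA ler_peMr// -ler_pdivrMl ?exprn_gt0// mulr1.
      exact: psiC.
    have fab x : - (B * 2 ^+ 10) * psi x <= (f \o clamp) x <= B * 2 ^+ 10 * psi x.
      have := fB _ (clamp_in x); rewrite ler_norml /= => /andP[H1 H2].
      by rewrite mulNr (le_trans _ H1) ?lerN2//= (le_trans H2).
    by have [H _] := LP _ _ _ (contI_bcont cf) fab; rewrite ler_norml.
  split.
  + move=> f g cf cg fg; rewrite /L'; congr L; apply/funext => x /=.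
    by apply: fg; rewrite unitIE clamp_in.
  + by move=> a f g cf cg; exact: LL (contI_bcont cf) (contI_bcont cg).
  + exists (2 ^+ 10) => f cf; apply: L'_le => //.
      by apply: le_trans (normI_ge cf (clamp_in 0)).
    by move=> x; exact: normI_ge.
  + move=> f cf f0; have [B fB] := contI_bounded cf.
    have B0 : 0 <= B := le_trans (normr_ge0 _) (fB _ (clamp_in 0)).
    have fab x : 0 * psi x <= (f \o clamp) x <= B * 2 ^+ 10 * psi x.
      rewrite mul0r f0 ?unitIE ?clamp_in//=.
      apply: le_trans (le_trans (ler_norm _) (fB _ (clamp_in x))) _.
      by rewrite -mulrA ler_peMr// -ler_pdivrMl ?exprn_gt0// mulr1.
    by have [/andP[]] := LP _ _ _ (contI_bcont cf) fab.
- move=> f0 Cf f1 g0 n x; rewrite unitIE => xI.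
  by rewrite normE oscE; exact: (main _ _ _ Cf f1 xI g0).
Qed.
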